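(* Let $\mathbb{K}$ be an algebraically closed field of characteristic zero, and let $X=\{T_0^{l_0}+T_1^{l_1}+T_2^{l_2}=0\}\subseteq\mathbb{K}^n$ be a trinomial hypersurface such that $n_il_{i1}>1$ for $i=0,1,2$. Assume that $X$ is factorial and that the trinomial is homogeneous, i.e. $l_{01}+\ldots+l_{0n_0}=l_{11}+\ldots+l_{1n_1}=l_{21}+\ldots+l_{2n_2}$. Let $Q\subseteq\mathbb{P}^{n-1}$ be the projective hypersurface given by $T_0^{l_0}+T_1^{l_1}+T_2^{l_2}=0$. Then $Q$ contains no cylinder if and only if every exponent in the trinomial is at least $2$, i.e. $l_{ij}\ge 2$ for all $i=0,1,2$ and $j=1,\ldots,n_i$.
   Context: Trinomial hypersurfaces: fix positive integers $n_0,n_1,n_2$ and let $n=n_0+n_1+n_2$. For each $i=0,1,2$ fix a tuple $l_i=(l_{i1},\ldots,l_{in_i})\in\mathbb{Z}_{>0}^{n_i}$ and define the monomial $T_i^{l_i}:=T_{i1}^{l_{i1}}\cdots T_{in_i}^{l_{in_i}}$ in the polynomial ring $\mathbb{K}[T_{ij};\ i=0,1,2,\ j=1,\ldots,n_i]$ in $n$ variables. A trinomial is a polynomial of the form $f=T_0^{l_0}+T_1^{l_1}+T_2^{l_2}$, and the trinomial hypersurface $X$ is the zero set $\{f=0\}$ in the affine space $\mathbb{K}^n$. It is an irreducible normal affine variety of dimension $n-1$, with algebra of regular functions $\mathbb{K}[X]=\mathbb{K}[T_{ij}]/(f)$. The condition $n_il_{i1}>1$ for $i=0,1,2$ means that $f$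 contains no linear term. An affine variety $X$ is factorial if $\mathbb{K}[X]$ is a unique factorization domain. A cylinder in $Q$ is an open subset $U\subseteq Q$ isomorphic to $Z\times\mathbb{A}^1$ for some affine variety $Z$ (varieties are nonempty). *)

(* Defs.v *)
From HB Require Import structures.
From mathcomp Require Import all_boot all_order all_algebra.
From mathcomp Require Import ring_quotient.
From mathcomp Require Import boolp classical_sets.
From mathcomp Require Import mpoly.

Set Implicit Arguments.
Unset Strict Implicit.
Unset Printing Implicit Defensive.

Import GRing.Theory.
Local Open Scope classical_set_scope.
Local Open Scope ring_scope.

Definition ring_unit (R : comNzRingType) (x : R) : Prop := exists y, x * y = 1.

Definition ring_irreducible (R : comNzRingType) (x : R) : Prop :=
  [/\ x <> 0, ~ ring_unit x
    & forall a b, x = a * b -> ring_unit a \/ ring_unit b].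

Definition ring_associated (R : comNzRingType) (x y : R) : Prop :=
  exists2 u, ring_unit u & y = u * x.

Definition unique_factorization_domain (R : comNzRingType) : Prop :=
  [/\ forall x y : R, x * y = 0 -> x = 0 \/ y = 0,
      forall x : R, x <> 0 -> ~ ring_unit x ->
        exists2 s : seq R, {in s, forall p, ring_irreducible p}
                         & x = \prod_(p <- s) p
    & forall s t : seq R,
        {in s, forall p, ring_irreducible p} ->
        {in t, forall p, ring_irreducible p} ->
        \prod_(p <- s) p = \prod_(p <- t) p ->
        exists2 s', perm_eq s s'
          & size s' = size t /\
            forall i, (i < size t)%N -> ring_associated s'`_i t`_i].

(* (f) as a decidable predicate.  The library only forms quotients by proper
   ideals, so a proof that 1 \notin (f) is carried along. *)
Definition nonunit_poly (K : fieldType) (m : nat) (f : {mpoly K[m]}) : Prop :=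
  ~ exists q, 1 = q * f.

Definition principal_ideal (K : fieldType) (m : nat) (f : {mpoly K[m]})
    (hf : nonunit_poly f) : {mpoly K[m]} -> bool :=
  fun p => `[< exists q, p = q * f >].

Lemma principal_ideal_closed (K : fieldType) (m : nat) (f : {mpoly K[m]})
  (hf : nonunit_poly f) : idealr_closed (principal_ideal hf).
Proof.
split=> [||a x y /asboolP[p ->] /asboolP[q ->]].
- by apply/asboolP; exists 0; rewrite mul0r.
- exact/asboolP.
- by apply/asboolP; exists (a * p + q); rewrite mulrDl mulrA.
Qed.

HB.instance Definition _ (K : fieldType) (m : nat) (f : {mpoly K[m]})
    (hf : nonunit_poly f) :=
  isIdealr.Build {mpoly K[m]} (principal_ideal hf) (principal_ideal_closed hf).

Definition hypersurface_ring (K : fieldType) (m : nat) (f : {mpoly K[m]})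
    (hf : nonunit_poly f) : comNzRingType :=
  {ideal_quot (principal_ideal hf : idealr {mpoly K[m]})}.

(* A unit f has the zero ring as quotient, which is not a domain; hence the
   existential over hf. *)
Definition factorial_hypersurface (K : fieldType) (m : nat)
    (f : {mpoly K[m]}) : Prop :=
  exists hf : nonunit_poly f,
    unique_factorization_domain (hypersurface_ring hf).

(* zclosed: the Zariski closed sets.  fraction_on V: the functions that are
   given on V by a single fraction with nowhere vanishing denominator. *)
Record ambient (K : fieldType) := Ambient {
  ambient_point :> Type;
  zclosed : set (set ambient_point);
  fraction_on : set ambient_point -> set (ambient_point -> K)
}.

Definition affine_zeros (K : fieldType) (m : nat) (S : set {mpoly K[m]}) :
    set 'rV[K]_m :=
  [set x | forall p, S p -> p.@[x ord0] = 0].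

Definition affine_space (K : fieldType) (m : nat) : ambient K :=
  @Ambient K 'rV[K]_m
    [set C | exists S, C = affine_zeros S]
    (fun V phi => exists G H : {mpoly K[m]},
       forall x, V x -> H.@[x ord0] != 0 /\ phi x = G.@[x ord0] / H.@[x ord0]).

(* The projective space P^(m-1): lines through the origin of K^m. *)
Definition proj_point (K : fieldType) (m : nat) : Type :=
  {L : {vspace 'rV[K]_m} | \dim L == 1%N}.

Definition proj_zeros (K : fieldType) (m : nat) (S : set {mpoly K[m]}) :
    set (proj_point K m) :=
  [set L : proj_point K m | forall p, S p -> forall v : 'rV[K]_m,
     v \in val L -> p.@[v ord0] = 0].

Definition homogeneous_poly (K : fieldType) (m : nat) (p : {mpoly K[m]}) :
    Prop :=
  exists d, p \is d.-homog.

Definition proj_space (K : fieldType) (m : nat) : ambient K :=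
  @Ambient K (proj_point K m)
    [set C | exists2 S, (forall p, S p -> homogeneous_poly p)
                      & C = proj_zeros S]
    (fun V phi => exists d (G H : {mpoly K[m]}),
       [/\ G \is d.-homog, H \is d.-homog
         & forall L, V L -> forall v : 'rV[K]_m, v \in val L -> v != 0 ->
             H.@[v ord0] != 0 /\ phi L = G.@[v ord0] / H.@[v ord0]]).

Definition open_in (K : fieldType) (T : ambient K) (A W : set T) : Prop :=
  exists2 C, zclosed C & W = A `\` C.

(* Meant for W locally closed in T, e.g. W open in a closed subset of T. *)
Definition regular_on (K : fieldType) (T : ambient K) (W : set T)
    (phi : T -> K) : Prop :=
  forall x, W x -> exists V, [/\ open_in W V, V x & fraction_on V phi].

Definition morphism (K : fieldType) (S T : ambient K) (A : set S) (B : set T)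
    (h : S -> T) : Prop :=
  (forall x, A x -> B (h x)) /\
  forall W, open_in B W ->
    open_in A (A `&` h @^-1` W) /\
    forall phi, regular_on W phi ->
      regular_on (A `&` h @^-1` W) (phi \o h).

Definition isomorphic (K : fieldType) (S T : ambient K)
    (A : set S) (B : set T) : Prop :=
  exists (h : S -> T) (k : T -> S),
    [/\ morphism A B h, morphism B A k,
        forall x, A x -> k (h x) = x & forall y, B y -> h (k y) = y].

(* Z x A^1 inside A^m x A^1 = A^(m+1). *)
Definition times_line (K : fieldType) (m : nat) (Z : set (affine_space K m)) :
    set (affine_space K (m + 1)) :=
  [set w : 'rV[K]_(m + 1) | Z (lsubmx w)].

(* An affine variety is a nonempty closed subset Z of some A^m.  Irreducibility
   of Z is not required; it is automatic when Q is irreducible. *)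
Definition contains_cylinder (K : fieldType) (T : ambient K) (Q : set T) :
    Prop :=
  exists U, open_in Q U /\
    exists m (Z : set (affine_space K m)),
      [/\ zclosed Z, Z !=set0 & isomorphic U (times_line Z)].

(* The variables T_0j, T_1j, T_2j are numbered consecutively. *)
Definition trinomial (K : fieldType) (n0 n1 n2 : nat)
    (l0 : 'I_n0 -> nat) (l1 : 'I_n1 -> nat) (l2 : 'I_n2 -> nat) :
    {mpoly K[n0 + n1 + n2]} :=
  \prod_(j < n0) 'X_(lshift n2 (lshift n1 j)) ^+ l0 j
  + \prod_(j < n1) 'X_(lshift n2 (rshift n0 j)) ^+ l1 j
  + \prod_(j < n2) 'X_(rshift (n0 + n1) j) ^+ l2 j.

Definition proj_hypersurface (K : fieldType) (m : nat) (f : {mpoly K[m]}) :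
    set (proj_space K m) :=
  proj_zeros [set f].

(* Main.v *)
Require Import Defs.
From mathcomp Require Import all_boot all_order all_algebra.
From mathcomp Require Import generic_quotient ring_quotient separable cyclotomic.
From mathcomp Require Import boolp classical_sets.
From mathcomp Require Import mpoly.
From mathcomp Require Import ring zify.

Set Implicit Arguments.
Unset Strict Implicit.
Unset Printing Implicit Defensive.

Import Order.TTheory GRing.Theory Num.Theory.
Local Open Scope ring_scope.

(** Suppose first that some exponent is one, say that of x.  The trinomial is
    x u + r with u a nonconstant monomial, and where u does not vanish the
    equation can be solved for x.  After normalizing a variable of u to one, a
    variable of another term is a free coordinate, so the open set where u does
    not vanish is a cylinder (linear_variable_cylinder).

    Suppose conversely that all exponents are at least two and that Q contains a
    cylinder U, isomorphic to Z times the affine line.  The first step produces a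
    nonzero locally nilpotent derivation of the coordinate ring K[X]
    (cylinder_field).  Each line of the cylinder is parametrized by a vector of
    polynomials in t without common zero, unique up to a scalar, so every point v
    of the cone over U is the starting point of a well-defined polynomial curve.
    The coordinate along the cylinder is a fraction on the cone; as K[X] is
    factorial, its denominator H in lowest terms has no zero there, satisfies
    the Euler relation of a homogeneous polynomial of positive degree, and is
    constant along each curve.  This makes the velocity of the curve at v locally
    a fraction in v, and, again by factoriality, a vector of fractions whose
    denominators have no zero on the cone.  A common denominator is constant
    along the curves too; multiplying by it gives a polynomial vector field, and
    the polynomial curves show that it is locally nilpotent.  That polynomials
    are determined modulo the equation by their values on X is the
    Nullstellensatz for X, proved by elimination of one variable
    (trinom_nullstellensatz).

    The second step shows that there is no such derivation (factorial_no_field).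
    Passing to components of highest weight, it may be taken homogeneous for all
    gradings of K[X] coming from the torus that acts on X (homogenize).  For two
    variables of one term there is a grading in which they have weights of
    opposite signs, whence one of them divides its own derivative and so is in
    the kernel; thus each term has at most one variable outside the kernel.  If a
    nonzero combination of the three terms is in the kernel, then comparing
    degrees in a relation between two powers with exponents at least two shows
    that all variables are in the kernel (term_not_kernel).  Otherwise, because
    the gcds of the exponents of the three terms are pairwise coprime, which
    factoriality implies (ufd_coprime_blocks), a homogeneous element of the
    kernel can only be a monomial in kernel variables, and this contradicts the
    behaviour of the derivation on the pencil of the terms
    (no_homogeneous_field). *)

(** * Locally nilpotent derivations of a domain *)

Section LocallyNilpotent.
Variables (R : comNzRingType) (D : R -> R).
Hypothesis domR : forall x y : R, x * y = 0 -> x = 0 \/ y = 0.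
Hypothesis charR : forall k, k.+1%:R != 0 :> R.
Hypothesis DD : {morph D : x y / x + y}.
Hypothesis DM : forall x y, D (x * y) = D x * y + x * D y.
Hypothesis Dnil : forall x, exists N, iter N D x = 0.

Lemma mulR_neq0 (x y : R) : x != 0 -> y != 0 -> x * y != 0.
Proof.
move=> /eqP x0 /eqP y0; apply/eqP=> xy0.
by case: (domR xy0).
Qed.

Lemma der0 : D 0 = 0.
Proof. by have := DD 0 0; rewrite addr0 -{1}[D 0]addr0 => /addrI. Qed.

Lemma derN x : D (- x) = - D x.
Proof. by apply/eqP; rewrite -addr_eq0 -DD addrC subrr der0. Qed.

Lemma iter_der0 N : iter N D 0 = 0.
Proof. by elim: N => //= N ->; exact: der0. Qed.

Lemma iter_derD N x y : iter N D (x + y) = iter N D x + iter N D y.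
Proof. by elim: N => //= N ->; rewrite DD. Qed.

Lemma iter_der_le m N x : iter m D x = 0 -> (m <= N)%N -> iter N D x = 0.
Proof.
by move=> xm mN; rewrite -(subnK mN) iterD xm iter_der0.
Qed.

Lemma iter_der_mull N c x : D c = 0 -> iter N D (c * x) = c * iter N D x.
Proof.
move=> c0; elim: N => //= N ->.
by rewrite DM c0 mul0r add0r.
Qed.

(** For nonzero x this is one more than the degree of x with respect to D, that
    is, the degree of the orbit of x under the exponential of D; it is 0 for 0. *)
Definition nilindex x : nat :=
  ex_minn (P := fun N => iter N D x == 0)
    (let: ex_intro N h := Dnil x in ex_intro _ N (introT eqP h)).

Lemma nilindexP x N : (iter N D x == 0) = (nilindex x <= N)%N.
Proof.
rewrite /nilindex; case: ex_minnP => m /eqP xm min; apply/idP/idP; first exact: min.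
by move=> mN; apply/eqP; exact: iter_der_le mN.
Qed.

Lemma nilindex_gt0 x : (0 < nilindex x)%N = (x != 0).
Proof. by rewrite lt0n -leqn0 -nilindexP. Qed.

Lemma nilindex_der x : nilindex (D x) = (nilindex x).-1.
Proof.
have e N : (nilindex (D x) <= N)%N = (nilindex x <= N.+1)%N.
  by rewrite -!nilindexP iterSr.
apply/eqP; rewrite eqn_leq e.
case: (nilindex x) (e) => [|k] // {}e; last first.
  by rewrite leqnn /= -ltnS -e.
Qed.

Lemma nilindex_le1 x : (nilindex x <= 1)%N = (D x == 0).
Proof. by rewrite -nilindexP. Qed.

(** The top term of Leibniz's formula.  Its coefficient is a binomial coefficient;
    the only thing to keep of it is that it is a positive integer. *)
Lemma iter_der_mul m k x y :
  iter m.+1 D x = 0 -> iter k.+1 D y = 0 ->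
  iter (m + k).+1 D (x * y) = 0 /\
  exists c, iter (m + k) D (x * y) = c.+1%:R * (iter m D x * iter k D y).
Proof.
have [N] := ubnP (m + k); elim: N m k x y => // N IH m k x y mkN xm yk.
case: m => [|m] in mkN xm *.
  rewrite add0n !iter_der_mull // yk mulr0; split=> //.
  by exists 0%N; rewrite mul1r.
case: k => [|k] in mkN yk *.
  rewrite addn0 mulrC !iter_der_mull // xm mulr0; split=> //.
  by exists 0%N; rewrite mul1r /= [y * _]mulrC.
have mkN1 : (m + k.+1 < N)%N by lia.
have mkN2 : (m.+1 + k < N)%N by lia.
have [z1 [c1 e1]] := IH m k.+1 (D x) y mkN1 (etrans (esym (iterSr _ _ _)) xm) yk.
have [z2 [c2 e2]] := IH m.+1 k x (D y) mkN2 xm (etrans (esym (iterSr _ _ _)) yk).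
rewrite addSnnS in z2 e2.
have E: iter (m.+1 + k.+1) D (x * y) =
   iter (m + k.+1) D (D x * y) + iter (m + k.+1) D (x * D y).
  by rewrite addSn iterSr DM iter_derD.
split; first by rewrite iterS E DD -!iterS z1 z2 addr0.
exists (c1.+1 + c2)%N; rewrite E e1 e2 -!iterSr -mulrDl -natrD.
by congr (_%:R * _); lia.
Qed.

Lemma nilindexM x y : x != 0 -> y != 0 ->
  nilindex (x * y) = (nilindex x + nilindex y).-1.
Proof.
move=> x0 y0.
have := x0; rewrite -nilindex_gt0; case ex : (nilindex x) => [//|m] _.
have := y0; rewrite -nilindex_gt0; case ey : (nilindex y) => [//|k] _.
have xm : iter m.+1 D x = 0 by apply/eqP; rewrite nilindexP ex.
have yk : iter k.+1 D y = 0 by apply/eqP; rewrite nilindexP ey.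
have [/eqP z [c e]] := iter_der_mul xm yk.
apply/eqP; rewrite addSn addnS /= eqn_leq -nilindexP z /= ltnNge -nilindexP e.
apply: mulR_neq0; first exact: charR.
by apply: mulR_neq0; rewrite nilindexP ?ex ?ey ltnn.
Qed.

(** The kernel is factorially closed: degrees add up in products. *)
Lemma der_factor x y : x * y != 0 -> D (x * y) = 0 -> D x = 0.
Proof.
move=> xy0; have x0 : x != 0 by apply: contraNneq xy0 => ->; rewrite mul0r.
have y0 : y != 0 by apply: contraNneq xy0 => ->; rewrite mulr0.
move/eqP; rewrite -nilindex_le1 nilindexM // => h; apply/eqP.
rewrite -nilindex_le1; move: y0; rewrite -nilindex_gt0; lia.
Qed.

(** A nonzero derivative D x has smaller degree than x. *)
Lemma der_dvd x y : D x = x * y -> D x = 0.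
Proof.
move=> e; apply/eqP/negPn/negP => Dx0.
have x0 : x != 0 by apply: contraNneq Dx0 => ->; rewrite der0.
have y0 : y != 0 by apply: contraNneq Dx0 => y0; rewrite e y0 mulr0.
have := nilindexM x0 y0; rewrite -e nilindex_der.
move: x0 y0; rewrite -!nilindex_gt0; lia.
Qed.

Lemma nilindex_dvd x y z : z != 0 -> z = x * y -> (nilindex x <= nilindex z)%N.
Proof.
move=> z0 e; rewrite {}e in z0 *.
have x0 : x != 0 by apply: contraNneq z0 => ->; rewrite mul0r.
have y0 : y != 0 by apply: contraNneq z0 => ->; rewrite mulr0.
by rewrite nilindexM //; move: y0; rewrite -nilindex_gt0; lia.
Qed.

Lemma derX x k : D (x ^+ k.+1) = k.+1%:R * x ^+ k * D x.
Proof.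
elim: k => [|k IH]; first by rewrite expr1 expr0 mulr1 mul1r.
rewrite exprS DM IH [x ^+ k.+1]exprS -[k.+2%:R]natr1.
by set u := x ^+ k; set c := k.+1%:R; set d := D x; ring.
Qed.

End LocallyNilpotent.

(** * Unique factorization *)

Section UniqueFactorization.
Variable R : comNzRingType.
Hypothesis ufd : unique_factorization_domain R.

Lemma ufd_domain (x y : R) : x * y = 0 -> x = 0 \/ y = 0.
Proof. by case: ufd => + _ _; apply. Qed.

Lemma ufd_mulfI (x : R) : x <> 0 -> injective ( *%R x).
Proof.
move=> x0 y z e; have /ufd_domain[//|/eqP] : x * (y - z) = 0.
  by rewrite mulrBr e subrr.
by rewrite subr_eq0 => /eqP.
Qed.

(** By uniqueness p occurs, up to a unit, in the product of factorizations of x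
    and y. *)
Lemma irreducible_prime (p x y z : R) : ring_irreducible p -> x * y = p * z ->
  (exists c, x = p * c) \/ (exists c, y = p * c).
Proof.
move=> pirr e; have [p0 _ pfac] := pirr.
have [x0|x0] := pselect (x = 0); first by left; exists 0; rewrite mulr0.
have [y0|y0] := pselect (y = 0); first by right; exists 0; rewrite mulr0.
have [[x' ex]|xu] := pselect (ring_unit x).
  by right; exists (x' * z); rewrite mulrCA -e mulrA [x' * x]mulrC ex mul1r.
have [[y' ey]|yu] := pselect (ring_unit y).
  by left; exists (y' * z); rewrite mulrCA -e mulrCA [y' * y]mulrC ey mulr1.
have [_ fact uniq] := ufd.
have [[z' ez]|zu] := pselect (ring_unit z).
  have : p = x * (y * z') by rewrite mulrA e -mulrA ez mulr1.
  case/pfac=> // -[w]; rewrite -mulrA => yw.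
  by case: yu; exists (z' * w).
have z0 : z <> 0.
  by move=> z0; rewrite z0 mulr0 in e; case: (ufd_domain e).
have [s sirr ex] := fact x x0 xu.
have [t tirr ey] := fact y y0 yu.
have [u uirr ez] := fact z z0 zu.
have [| | |s' perm [sz assoc]] := uniq (s ++ t) (p :: u).
- by move=> q; rewrite mem_cat => /orP[/sirr|/tirr].
- by move=> q; rewrite inE => /predU1P[->|/uirr].
- by rewrite big_cat big_cons /= -ex -ey -ez.
have [//|c [c' cc'] /= pE] := assoc 0%N.
have : s'`_0 \in s ++ t by rewrite (perm_mem perm) mem_nth // sz.
have qE : s'`_0 = p * c' by rewrite pE mulrAC cc' mul1r.
have dvd_prod (r : seq R) : s'`_0 \in r -> exists c, \prod_(q <- r) q = p * c.
  move=> h; exists (c' * \prod_(q <- rem s'`_0 r) q).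
  by rewrite (perm_big _ (perm_to_rem h)) big_cons mulrA -qE.
by rewrite mem_cat ex ey => /orP[/dvd_prod|/dvd_prod]; [left|right].
Qed.

(** A prime of the denominator that does not divide G divides H', and can be
    cancelled. *)
Lemma coprime_denominator (s : seq R) (G G' H' : R) :
  {in s, forall p, ring_irreducible p} ->
  {in s, forall p, ~ exists c, G = p * c} ->
  G * H' = G' * \prod_(p <- s) p -> exists c, H' = c * \prod_(p <- s) p.
Proof.
elim: s H' => [|p s IH] H' irr ndv.
  by exists H'; rewrite big_nil mulr1.
rewrite big_cons mulrCA => e.
have [|[c ec]|[c ec]] := irreducible_prime _ e; first by apply: irr; exact: mem_head.
  by case: (ndv p (mem_head _ _)); exists c.
have [p0 _ _] := irr p (mem_head _ _).
have [|||c' ec'] := IH c.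
- by move=> q qs; apply: irr; rewrite inE qs orbT.
- by move=> q qs; apply: ndv; rewrite inE qs orbT.
- by apply: (ufd_mulfI p0); rewrite -e ec mulrCA.
by exists c'; rewrite ec ec' mulrCA.
Qed.

(** Common irreducible factors are cancelled until none is left; the denominator
    then divides every other denominator of the same fraction. *)
Lemma lowest_terms (G H : R) : H <> 0 ->
  exists G0 H0, [/\ H0 <> 0, G * H0 = G0 * H
    & forall G' H', G0 * H' = G' * H0 -> exists c, H' = c * H0].
Proof.
move=> H0; have [[h hh]|Hu] := pselect (ring_unit H).
  by exists G, H; split=> // G' H' _; exists (H' * h);
    rewrite -mulrA [h * H]mulrC hh mulr1.
have [_ fact _] := ufd; have [s sirr HE] := fact H H0 Hu.
rewrite {}HE in H0 *; clear Hu.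
have [N] := ubnP (size s); elim: N s G sirr H0 => // N IH s G sirr H0 sN.
have [[p [ps [c Gc]]]|ndv] := pselect (exists p, p \in s /\ exists c, G = p * c).
  have e : \prod_(q <- s) q = p * \prod_(q <- rem p s) q.
    by rewrite (perm_big _ (perm_to_rem ps)) big_cons.
  have [|||G0 [H1 [H10 e1 e2]]] := IH (rem p s) c.
  - by move=> q /mem_rem /sirr.
  - by move=> r0; apply: H0; rewrite e r0 mulr0.
  - by rewrite size_rem //; case: (s) ps sN.
  by exists G0, H1; split=> //; rewrite Gc e -mulrA e1 mulrCA.
exists G, (\prod_(p <- s) p); split=> // G' H'.
apply: coprime_denominator => // p ps [c Gc].
by apply: ndv; exists p; split=> //; exists c.
Qed.

End UniqueFactorization.

(** * Vector fields and gradings of a polynomial ring *)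

Section Divisibility.
Variables (A : comNzRingType) (f : A).

Definition divides (p : A) : Prop := exists q, p = q * f.

Lemma divides0 : divides 0.
Proof. by exists 0; rewrite mul0r. Qed.

Lemma dividesD p q : divides p -> divides q -> divides (p + q).
Proof. by move=> [a ->] [b ->]; exists (a + b); rewrite mulrDl. Qed.

Lemma dividesMl a p : divides p -> divides (a * p).
Proof. by move=> [b ->]; exists (a * b); rewrite mulrA. Qed.

Lemma dividesMr a p : divides p -> divides (p * a).
Proof. by rewrite mulrC; exact: dividesMl. Qed.

Lemma dividesN p : divides p -> divides (- p).
Proof. by move=> [b ->]; exists (- b); rewrite mulNr. Qed.

Lemma dividesB p q : divides p -> divides q -> divides (p - q).
Proof. by move=> dp dq; apply: dividesD => //; exact: dividesN. Qed.

Lemma divides_sum (I : Type) (r : seq I) (P : pred I) (F : I -> A) :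
  (forall i, P i -> divides (F i)) -> divides (\sum_(i <- r | P i) F i).
Proof. by move=> h; apply: big_ind => //; [exact: divides0|exact: dividesD]. Qed.

Lemma dividesBr p q : divides (p - q) -> divides q -> divides p.
Proof. by move=> d1 d2; rewrite -(subrK q p); exact: dividesD. Qed.

End Divisibility.

Section VectorField.
Variables (K : comNzRingType) (n : nat).
Implicit Types (p : 'I_n -> {mpoly K[n]}) (g : {mpoly K[n]}).

Definition vder p g : {mpoly K[n]} := \sum_i p i * g^`M(i).

Lemma vderD p : {morph vder p : g h / g + h}.
Proof.
move=> g h; rewrite /vder -big_split /=; apply: eq_bigr => i _.
by rewrite mderivD mulrDr.
Qed.

Lemma vderM p g h : vder p (g * h) = vder p g * h + g * vder p h.
Proof.
rewrite /vder mulr_suml mulr_sumr -big_split /=; apply: eq_bigr => i _.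
rewrite mderivM mulrDr. ring.
Qed.

Lemma vderX p j : vder p 'X_j = p j.
Proof.
rewrite /vder (bigD1 j) //= big1 => [|i ij]; rewrite mderivX mnm1E.
  by rewrite eqxx scale1r -{1}[U_(j)%MM]add0m addmK mpolyX0 mulr1 addr0.
by rewrite eq_sym (negbTE ij) scale0r mulr0.
Qed.

Lemma vderC p c : vder p c%:MP = 0.
Proof. by rewrite /vder big1 // => i _; rewrite mderivC mulr0. Qed.

Lemma vderZ p c g : vder p (c *: g) = c *: vder p g.
Proof. by rewrite -!mul_mpolyC vderM vderC mul0r add0r. Qed.

Lemma vderB p g h : vder p (g - h) = vder p g - vder p h.
Proof. by rewrite vderD -scaleN1r vderZ scaleN1r. Qed.

Lemma vder_divides f p g :
  divides f (vder p f) -> divides f g -> divides f (vder p g).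
Proof.
move=> df [q ->]; rewrite vderM; apply: dividesD; last exact: dividesMl.
by exists (vder p q).
Qed.

Lemma vder_congr f p p' g : (forall i, divides f (p i - p' i)) ->
  divides f (vder p g - vder p' g).
Proof.
move=> h; rewrite /vder -sumrB; apply: divides_sum => i _.
by rewrite -mulrBl; exact: dividesMr.
Qed.

Lemma iter_vder_congr f p p' g N : divides f (vder p f) ->
  (forall i, divides f (p i - p' i)) ->
  divides f (iter N (vder p) g - iter N (vder p') g).
Proof.
move=> df h; elim: N => [|N IH] /=; first by rewrite subrr; exact: divides0.
set a := iter N _ g in IH *; set b := iter N _ g in IH *.
have -> : vder p a - vder p' b = vder p (a - b) + (vder p b - vder p' b).
  by rewrite vderB addrA subrK.
by apply: dividesD; [exact: vder_divides|exact: vder_congr].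
Qed.

(** A lift to the polynomial ring of a nonzero locally nilpotent derivation of
    the quotient by f.  Nilpotency on the variables suffices by Leibniz's
    formula. *)
Definition nilpotent_field f p : Prop :=
  [/\ exists j, ~ divides f (p j), divides f (vder p f)
    & forall j, exists N, divides f (iter N (vder p) 'X_j)].

End VectorField.

Section Weights.
Variables (K : comNzRingType) (n : nat) (w : {ffun 'I_n -> int}).
Implicit Types (p q g : {mpoly K[n]}) (m : 'X_{1..n}).

Definition wdeg m : int := \sum_j w j * (m j)%:Z.

Lemma wdegD m m' : wdeg (m + m')%MM = wdeg m + wdeg m'.
Proof.
rewrite /wdeg -big_split /=; apply: eq_bigr => j _.
by rewrite mnmDE PoszD mulrDr.
Qed.

Lemma wdegU j : wdeg U_(j)%MM = w j.
Proof.
rewrite /wdeg (bigD1 j) //= big1 => [|i ij]; rewrite mnm1E.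
  by rewrite eqxx mulr1 addr0.
by rewrite eq_sym (negbTE ij) mulr0.
Qed.

Definition wpart (P : pred int) p : {mpoly K[n]} :=
  \sum_(m <- msupp p | P (wdeg m)) p@_m *: 'X_[m].

Lemma mcoeff_wpart P p m : (wpart P p)@_m = if P (wdeg m) then p@_m else 0.
Proof.
rewrite /wpart raddf_sum /=.
under eq_bigr do rewrite mcoeffZ mcoeffX.
rewrite big_mkcond /=; have [ms|mNs] := boolP (m \in msupp p).
  rewrite (bigD1_seq m) //= eqxx mulr1 big1 ?addr0 // => i /negbTE ->.
  by rewrite mulr0 if_same.
rewrite (memN_msupp_eq0 mNs) if_same big1_seq // => i /andP[_ ip].
have /negbTE -> : i != m by apply: contraNneq mNs => <-.
by rewrite mulr0 if_same.
Qed.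

Lemma wpartD P : {morph wpart P : p q / p + q}.
Proof.
move=> p q; apply/mpolyP=> m; rewrite mcoeffD !mcoeff_wpart mcoeffD.
by case: ifP => //; rewrite addr0.
Qed.

Notation wcomp d := (wpart (pred1 d)).

Definition whomog (d : int) p := forall m, p@_m != 0 -> wdeg m = d.
Definition wle (d : int) p := forall m, p@_m != 0 -> wdeg m <= d.

Lemma wcomp_homog d p : whomog d (wcomp d p).
Proof. by move=> m; rewrite mcoeff_wpart /=; case: (wdeg m =P d) => // _;
  rewrite eqxx. Qed.

Lemma wcomp_id d p : whomog d p -> wcomp d p = p.
Proof.
move=> h; apply/mpolyP=> m; rewrite mcoeff_wpart /=.
by case: ifPn => // wd; have [//|/h/eqP] := eqVneq p@_m 0; rewrite (negbTE wd).
Qed.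

Lemma mcoeffM_neq0 p q m : (p * q)@_m != 0 ->
  exists a b, [/\ m = (a + b)%MM, p@_a != 0 & q@_b != 0].
Proof.
rewrite -mcoeff_msupp => /msuppM_le/allpairsP[[a b] /= [ap bq ->]].
by exists a, b; rewrite -!mcoeff_msupp.
Qed.

Lemma whomogM d e p q : whomog d p -> whomog e q -> whomog (d + e) (p * q).
Proof.
move=> hp hq m /mcoeffM_neq0[a [b [-> pa qb]]].
by rewrite wdegD (hp a) // (hq b).
Qed.

Lemma wleM d e p q : wle d p -> wle e q -> wle (d + e) (p * q).
Proof.
move=> hp hq m /mcoeffM_neq0[a [b [-> pa qb]]].
by rewrite wdegD lerD // ?hp ?hq.
Qed.

Lemma wle_sum d (I : Type) (r : seq I) (F : I -> {mpoly K[n]}) :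
  (forall i, wle d (F i)) -> wle d (\sum_(i <- r) F i).
Proof.
move=> h; apply: big_ind => [m|p q hp hq m|i _]; last exact: h.
  by rewrite mcoeff0 eqxx.
have [p0|/hp //] := eqVneq p@_m 0.
by rewrite mcoeffD p0 add0r => /hq.
Qed.

Lemma wcomp_wle0 d e p : wle e p -> e < d -> wcomp d p = 0.
Proof.
move=> h ed; apply/mpolyP=> m; rewrite mcoeff_wpart mcoeff0 /=.
case: eqP => // wd; apply/eqP/negPn/negP => /h; rewrite wd; lia.
Qed.

Lemma wle_split d p : wle d p -> exists2 p', wle (d - 1) p' & p = wcomp d p + p'.
Proof.
move=> h; exists (p - wcomp d p); last by rewrite addrC subrK.
move=> m; rewrite mcoeffB mcoeff_wpart /=; case: (wdeg m =P d) => [_|wd].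
  by rewrite subrr eqxx.
by rewrite subr0 => /h; lia.
Qed.

Lemma whomog_wle d p : whomog d p -> wle d p.
Proof. by move=> h m /h ->. Qed.

Lemma wcomp_wleM d e p q : wle d p -> wle e q ->
  wcomp (d + e) (p * q) = wcomp d p * wcomp e q.
Proof.
move=> hp hq; have [p' hp' {1}->] := wle_split hp; have [q' hq' {1}->] := wle_split hq.
have Hp := @wcomp_homog d p; have Hq := @wcomp_homog e q.
rewrite !(mulrDl, mulrDr) !wpartD (wcomp_id (whomogM Hp Hq)).
rewrite (wcomp_wle0 (wleM hp' (whomog_wle Hq))); last by lia.
rewrite (wcomp_wle0 (wleM (whomog_wle Hp) hq')); last by lia.
by rewrite (wcomp_wle0 (wleM hp' hq')) ?addr0 //; lia.
Qed.

(** Multiplying by a homogeneous polynomial commutes with taking components, which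
    makes divisibility by it a matter of components. *)
Lemma wcomp_homogM d e p q : whomog d p ->
  wcomp (d + e) (q * p) = wcomp e q * p.
Proof.
move=> hp; elim/mpolyind: q => [|c m q _ _ IH].
  have e0 P : wpart P 0 = 0.
    by apply/mpolyP=> m; rewrite mcoeff_wpart mcoeff0 if_same.
  by rewrite mul0r !e0 mul0r.
rewrite mulrDl !wpartD IH mulrDl; congr (_ + _).
have hm : whomog (wdeg m) (c *: 'X_[K, m]).
  move=> m'; rewrite mcoeffZ mcoeffX; case: (m =P m') => [-> //|_].
  by rewrite mulr0 eqxx.
have [wm|wm] := eqVneq (wdeg m) e.
  by rewrite -wm addrC (wcomp_id (whomogM hm hp)) (wcomp_id hm).
have e0 d' d'' r : whomog d' r -> d' != d'' -> wcomp d'' r = 0.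
  move=> hr dd; apply/mpolyP=> m'; rewrite mcoeff_wpart mcoeff0 /=.
  by case: eqP => // wd; apply/eqP/negPn/negP => /hr e'; rewrite -e' wd eqxx in dd.
rewrite (e0 _ _ _ hm wm) mul0r (e0 _ _ _ (whomogM hm hp)) //.
by apply: contra wm => /eqP; lia.
Qed.

Lemma wcomp_mderiv d p i : wcomp (d - w i) p^`M(i) = (wcomp d p)^`M(i).
Proof.
apply/mpolyP=> m; rewrite mcoeff_wpart !mcoeff_deriv mcoeff_wpart /= wdegD wdegU.
have -> : (wdeg m == d - w i) = (wdeg m + w i == d) by apply/eqP/eqP; lia.
by case: ifP; rewrite // mul0rn.
Qed.

Lemma wle_mderiv d p i : wle d p -> wle (d - w i) p^`M(i).
Proof.
move=> h m; rewrite mcoeff_deriv => pm.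
have := h (m + U_(i))%MM; rewrite wdegD wdegU => h'.
have : p@_(m + U_(i)) != 0 by apply: contraNneq pm => ->; rewrite mul0rn.
by move/h'; lia.
Qed.

Lemma wcomp_sum P (I : Type) (r : seq I) (F : I -> {mpoly K[n]}) :
  wpart P (\sum_(i <- r) F i) = \sum_(i <- r) wpart P (F i).
Proof.
apply: (big_morph (wpart P) (wpartD P)).
by apply/mpolyP=> m; rewrite mcoeff_wpart mcoeff0 if_same.
Qed.

Section Homogenize.
Variables (f : {mpoly K[n]}) (W : int).
Hypothesis fW : whomog W f.

Lemma divides_wcomp d p : divides f p -> divides f (wcomp d p).
Proof.
move=> [q ->]; exists (wcomp (d - W) q); rewrite -(wcomp_homogM _ _ fW).
by congr wpart; rewrite addrC subrK.
Qed.

Lemma divides_of_wcomp p : (forall d, divides f (wcomp d p)) -> divides f p.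
Proof.
move=> h; have -> : p = \sum_(d <- undup (map wdeg (msupp p))) wcomp d p.
  apply/mpolyP=> m; rewrite raddf_sum /=.
  under eq_bigr do rewrite mcoeff_wpart /=.
  have [ms|mNs] := boolP (m \in msupp p); last first.
    by rewrite (memN_msupp_eq0 mNs) big1 // => d _; rewrite if_same.
  rewrite (bigD1_seq (wdeg m)) ?undup_uniq ?mem_undup ?map_f //= eqxx.
  by rewrite big1 ?addr0 // => d; rewrite eq_sym => /negbTE ->.
by apply: divides_sum => d _; exact: h.
Qed.

Lemma wle_vder d e (p : 'I_n -> {mpoly K[n]}) g : (forall i, wle (w i + e)
  (p i)) -> wle d g ->
  wle (d + e) (vder p g) /\
  wcomp (d + e) (vder p g) = vder (fun i => wcomp (w i + e) (p i)) (wcomp d g).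
Proof.
move=> hp hg; have de i : d + e = (w i + e) + (d - w i) by lia.
split.
  by apply: wle_sum => i; rewrite (de i); apply: wleM => //; exact: wle_mderiv.
rewrite /vder wcomp_sum; apply: eq_bigr => i _.
by rewrite (de i) wcomp_wleM // ?wcomp_mderiv //; exact: wle_mderiv.
Qed.

Lemma wle_iter_vder N d e (p : 'I_n -> {mpoly K[n]}) g : (forall i, wle (w i + e)
  (p i)) -> wle d g ->
  wle (d + N%:Z * e) (iter N (vder p) g) /\
  wcomp (d + N%:Z * e) (iter N (vder p) g) =
    iter N (vder (fun i => wcomp (w i + e) (p i))) (wcomp d g).
Proof.
move=> hp hg; elim: N => [|N [IH1 IH2]]; first by rewrite mul0r addr0.
have -> : d + N.+1%:Z * e = d + N%:Z * e + e by lia.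
by have [h1 h2] := wle_vder hp IH1; split=> //=; rewrite h2 IH2.
Qed.

Lemma max_of_seq (s : seq int) x : x \in s ->
  exists2 y, y \in s & forall z, z \in s -> z <= y.
Proof.
elim: s x => // a s IH x _; case: s IH => [|b s] IH.
  by exists a; rewrite ?mem_head // => z; rewrite inE => /eqP ->.
have [y ys ymax] := IH b (mem_head _ _).
have [ay|ya] := leP a y.
  exists y; first by rewrite inE ys orbT.
  by move=> z; rewrite inE => /predU1P[->//|/ymax].
exists a; first exact: mem_head.
by move=> z; rewrite inE => /predU1P[->//|/ymax]; lia.
Qed.

Lemma wcomp_witness d g : ~ divides f (wcomp d g) ->
  exists2 m, m \in msupp g & wdeg m = d.
Proof.
move=> bd; have [[m]|no] := pselect (exists m, (wcomp d g)@_m != 0).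
  rewrite mcoeff_wpart /=; case: (wdeg m =P d) => [wm gm|]; last by rewrite eqxx.
  by exists m; rewrite ?mcoeff_msupp.
case: bd; have -> : wcomp d g = 0; last exact: divides0.
by apply/mpolyP=> m; rewrite mcoeff0; apply/eqP/negPn/negP => hm; case: no; exists m.
Qed.

Lemma wcomp_not_divides g : ~ divides f g -> exists d, ~ divides f (wcomp d g).
Proof.
move=> ng; apply: contrapT => no; apply: ng; apply: divides_of_wcomp => d.
by apply: contrapT => hd; apply: no; exists d.
Qed.

Definition truncation d g := wpart (fun d' => d' <= d) g.

Lemma wle_truncation d g : wle d (truncation d g).
Proof. by move=> m; rewrite mcoeff_wpart; case: ifP => // _; rewrite eqxx. Qed.

Lemma wcomp_truncation d g : wcomp d (truncation d g) = wcomp d g.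
Proof.
apply/mpolyP=> m; rewrite !mcoeff_wpart /=.
by case: eqP => // ->; rewrite lexx.
Qed.

Lemma divides_truncation d g :
  (forall d', d < d' -> divides f (wcomp d' g)) -> divides f (g - truncation d g).
Proof.
move=> high; apply: divides_of_wcomp => d'; have [dle|dgt] := leP d' d.
  have -> : wcomp d' (g - truncation d g) = 0; last exact: divides0.
  apply/mpolyP=> m; rewrite !(mcoeff_wpart, mcoeffB) /= mcoeff0.
  by case: eqP => // ->; rewrite dle subrr.
have -> : wcomp d' (g - truncation d g) = wcomp d' g; last exact: high.
apply/mpolyP=> m; rewrite !(mcoeff_wpart, mcoeffB) /=.
by case: eqP => // ->; rewrite leNgt dgt /= subr0.
Qed.

Lemma top_component g : ~ divides f g ->
  exists d g', [/\ divides f (g - g'), wle d g' & ~ divides f (wcomp d g')].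
Proof.
move=> ng; pose E := [seq d <- map wdeg (msupp g) | `[< ~ divides f (wcomp d g) >]].
have badE d : ~ divides f (wcomp d g) -> d \in E.
  move=> bd; rewrite mem_filter; apply/andP; split; first exact/asboolP.
  by have [m gm <-] := wcomp_witness bd; exact: map_f.
have [d0 bd0] := wcomp_not_divides ng.
have [d dE dmax] := max_of_seq (badE _ bd0).
have bd : ~ divides f (wcomp d g) by move: dE; rewrite mem_filter => /andP[/asboolP].
exists d, (truncation d g); split; last by rewrite wcomp_truncation.
  by apply: divides_truncation => d' dd'; apply: contrapT => /badE/dmax; lia.
exact: wle_truncation.
Qed.

(** Passing to the component of highest weight keeps a vector field nilpotent:
    the top component of an iterate is the iterate of the top component.  The
    components above the chosen weight vanish modulo f, so they are dropped
    first. *)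
Lemma homogenize_weight (p : 'I_n -> {mpoly K[n]}) : nilpotent_field f p ->
  exists e, nilpotent_field f (fun i => wcomp (w i + e) (p i)).
Proof.
case=> -[j pj] df nil.
pose bad e := exists i, ~ divides f (wcomp (w i + e) (p i)).
pose E := [seq e <- flatten [seq [seq wdeg m - w i | m <- msupp (p i)] | i : 'I_n]
          | `[< bad e >]].
have badE e : bad e -> e \in E.
  move=> be; rewrite mem_filter; apply/andP; split; first exact/asboolP.
  case: be => i bi; apply/flatten_mapP; exists i; first by rewrite mem_enum.
  by have [m gm wm] := wcomp_witness bi; apply/mapP; exists m; rewrite ?wm //; lia.
have [e0 be0] : exists e, bad e.
  have [d bd] := wcomp_not_divides pj; exists (d - w j), j.
  by rewrite addrC subrK.
have [e eE emax] := max_of_seq (badE _ be0).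
have be : bad e by move: eE; rewrite mem_filter => /andP[/asboolP].
exists e; pose p1 i := truncation (w i + e) (p i).
have p1le i : wle (w i + e) (p1 i) by exact: wle_truncation.
have pp1 i : divides f (p i - p1 i).
  apply: divides_truncation => d dgt; apply: contrapT => nd; have : bad (d - w i).
    by exists i; rewrite [w i + _]addrC subrK.
  by move/badE/emax; lia.
have e12 : (fun i => wcomp (w i + e) (p1 i)) = (fun i => wcomp (w i + e) (p i)).
  by apply: funext => i; exact: wcomp_truncation.
split; first exact: be.
  have [_] := wle_vder p1le (whomog_wle fW); rewrite (wcomp_id fW) e12 => <-.
  apply: divides_wcomp; apply: (@dividesBr _ _ _ (vder p f)) => //.
  by rewrite -opprB; apply: dividesN; exact: vder_congr.
move=> i; have [N dN] := nil i; exists N.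
have hX : whomog (w i) 'X_i.
  by move=> m; rewrite mcoeffX; case: (_ =P m) => [<-|]; rewrite ?wdegU // eqxx.
have [_] := wle_iter_vder N p1le (whomog_wle hX); rewrite (wcomp_id hX) e12 => <-.
apply: divides_wcomp; apply: (dividesBr _ dN).
by rewrite -opprB; apply: dividesN; exact: iter_vder_congr.
Qed.

End Homogenize.
End Weights.
Notation wcomp w d := (wpart w (pred1 d)).

(** The weights are treated one after the other: taking a component for one weight
    does not destroy homogeneity for the previous ones. *)
Lemma homogenize (K : comNzRingType) (n : nat) (f : {mpoly K[n]})
    (ws : seq {ffun 'I_n -> int}) p :
  (forall w, w \in ws -> exists W, whomog w W f) -> nilpotent_field f p ->
  exists2 p', nilpotent_field f p' &
    forall w, w \in ws -> exists e, forall i, whomog w (w i + e) (p' i).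
Proof.
move=> hw nil; elim: ws hw => [|w ws IH] hw; first by exists p.
have [w' w'ws|p1 nil1 hom1] := IH.
  by apply: hw; rewrite inE w'ws orbT.
have [W fW] := hw w (mem_head _ _).
have [e nil2] := homogenize_weight fW nil1.
eexists; first exact: nil2.
move=> w'; rewrite inE => /predU1P[->|w'ws].
  by exists e => i; exact: wcomp_homog.
have [e' he'] := hom1 w' w'ws; exists e' => i m.
by rewrite mcoeff_wpart; case: ifP => [_ /he' //|_]; rewrite eqxx.
Qed.

(** * Binary forms *)

Section BinaryForms.
Variables (K : closedFieldType) (R : comNzRingType) (phi : {rmorphism K -> R}).
Variables a b : R.

Definition bform m (p : {poly K}) : R :=
  \sum_(k < m.+1) phi p`_k * a ^+ k * b ^+ (m - k).

Lemma bform_mulX m p : bform m.+1 (p * 'X) = a * bform m p.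
Proof.
rewrite /bform big_ord_recl coefMX eqxx rmorph0 !mul0r add0r mulr_sumr.
apply: eq_bigr => k _; rewrite coefMX /= /bump /= add1n exprS subSS.
by set x := _ ^+ k; set y := _ ^+ _; set z := phi _; ring.
Qed.

Lemma bform_mul1 m (p : {poly K}) : p`_m.+1 = 0 -> bform m.+1 p = b * bform m p.
Proof.
move=> pm; rewrite /bform big_ord_recr /= pm rmorph0 !mul0r addr0 mulr_sumr.
apply: eq_bigr => k _; rewrite subSn ?exprS; last by rewrite -ltnS.
by set x := _ ^+ k; set y := _ ^+ _; set z := phi _; ring.
Qed.

Lemma bformD m p q : bform m (p + q) = bform m p + bform m q.
Proof.
rewrite /bform -big_split; apply: eq_bigr => k _ /=.
by rewrite coefD rmorphD !mulrDl.
Qed.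

Lemma bformZ m c p : bform m (c *: p) = phi c * bform m p.
Proof.
rewrite /bform mulr_sumr; apply: eq_bigr => k _.
by rewrite coefZ rmorphM /= !mulrA.
Qed.

Lemma bformXn m k : (k <= m)%N -> bform m 'X^k = a ^+ k * b ^+ (m - k).
Proof.
move=> km; rewrite /bform (bigD1 (Ordinal (km : (k < m.+1)%N))) //= coefXn eqxx.
rewrite rmorph1 mul1r big1 ?addr0 // => i ik; rewrite coefXn.
have /negbTE -> : nat_of_ord i != k by apply: contra ik => /eqP e; apply/eqP/val_inj.
by rewrite rmorph0 !mul0r.
Qed.

(** A root of the dehomogenized polynomial splits off a linear form; when the
    coefficient of the highest power of a is missing, b itself splits off. *)
Lemma bform_split m (p : {poly K}) : p != 0 -> (size p <= m.+1)%N ->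
  exists c (s : seq (K * K)), [/\ c != 0, size s = m,
    {in s, forall x, x != (0, 0)} &
    bform m p = phi c * \prod_(x <- s) (phi x.1 * a + phi x.2 * b)].
Proof.
elim: m p => [|m IH] p p0 sp /=.
  exists p`_0, [::]; split=> //.
    by apply: contra p0 => /eqP p00; rewrite (size1_polyC sp) p00 polyC0.
  by rewrite /bform big_ord1 big_nil expr0 !mulr1.
have [pm|pm] := eqVneq p`_m.+1 0.
  have [|c [s [c0 sz s0 e]]] := IH p p0.
    move: sp; rewrite leq_eqVlt => /predU1P[szp|//].
    by move: p0; rewrite -lead_coef_eq0 lead_coefE szp pm eqxx.
  exists c, ((0, 1) :: s); split=> //=; first by rewrite sz.
    by move=> x; rewrite inE => /predU1P[->|/s0 //]; rewrite xpair_eqE oner_eq0 andbF.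
  by rewrite bform_mul1 // e big_cons /= rmorph0 rmorph1 mul0r add0r mul1r mulrCA.
have szp : size p = m.+2.
  apply/eqP; rewrite eqn_leq sp ltnNge; apply: contra pm => h.
  by rewrite nth_default.
have [|r] := closed_rootP p _; first by rewrite szp.
move=> /factor_theorem[q pE]; have q0 : q != 0.
  by apply: contraNneq p0 => q0; rewrite pE q0 mul0r.
have szq : size q = m.+1.
  by move: szp; rewrite pE size_Mmonic ?monicXsubC // size_XsubC addn2 => -[].
have [|c [s [c0 sz s0 e]]] := IH q q0; first by rewrite szq.
exists c, ((1, - r) :: s); split=> //=; first by rewrite sz.
  by move=> x; rewrite inE => /predU1P[->|/s0 //]; rewrite xpair_eqE oner_eq0.
have -> : p = q * 'X + (- r) *: q by rewrite pE mulrBr -mul_polyC polyCN mulNr [r%:P *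
  _]mulrC.
rewrite bformD bformZ bform_mulX bform_mul1; last by rewrite nth_default ?szq.
by rewrite e big_cons /= rmorph1 mul1r; set P := \prod_(_ <- _) _; set t := phi (- r);
  ring.
Qed.

Definition is_form m (x : R) : Prop := exists2 p : {poly K},
  (size p <= m.+1)%N & x = bform m p.

Lemma is_form0 m : is_form m 0.
Proof.
exists 0; first by rewrite size_poly0.
by rewrite /bform big1 // => k _; rewrite coef0 rmorph0 !mul0r.
Qed.

Lemma is_formD m x y : is_form m x -> is_form m y -> is_form m (x + y).
Proof.
move=> [p sp ->] [q sq ->]; exists (p + q); last by rewrite bformD.
by apply: leq_trans (size_polyD _ _) _; rewrite geq_max sp.
Qed.

Lemma is_formZ m c x : is_form m x -> is_form m (phi c * x).
Proof.
move=> [p sp ->]; exists (c *: p); last by rewrite bformZ.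
exact: leq_trans (size_scale_leq _ _) sp.
Qed.

Lemma is_form_mula m x : is_form m x -> is_form m.+1 (a * x).
Proof.
move=> [p sp ->]; exists (p * 'X); last by rewrite bform_mulX.
have [->|p0] := eqVneq p 0; first by rewrite mul0r size_poly0.
by rewrite size_mulX.
Qed.

Lemma is_form_mulb m x : is_form m x -> is_form m.+1 (b * x).
Proof.
move=> [p sp ->]; exists p; first exact: leqW.
by rewrite bform_mul1 // nth_default.
Qed.

Lemma is_form_mulc m x c : c = - (a + b) -> is_form m x -> is_form m.+1 (c * x).
Proof.
move=> -> fx; have -> : - (a + b) * x = phi (-1) * (a * x) + phi (-1) * (b * x).
  by rewrite rmorphN1; ring.
by apply: is_formD; apply: is_formZ; [exact: is_form_mula|exact: is_form_mulb].
Qed.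

Lemma is_form1 : is_form 0 1.
Proof.
exists 1; first by rewrite size_poly1.
by rewrite /bform big_ord1 coef1 rmorph1 !mul1r.
Qed.

Lemma is_form_iter m k c x : (forall m x, is_form m x -> is_form m.+1 (c * x)) ->
  is_form m x -> is_form (k + m) (c ^+ k * x).
Proof.
move=> h fx; elim: k => [|k IH]; first by rewrite mul1r.
by rewrite exprS -mulrA; exact: h.
Qed.

End BinaryForms.

(** * Torus weights of a trinomial *)

Lemma big_ord3 (T : Type) (idx : T) (op : Monoid.law idx) (F : 'I_3 -> T) :
  \big[op/idx]_i F i = op (F 0) (op (F 1) (F 2)).
Proof.
rewrite !big_ord_recl big_ord0 Monoid.mulm1.
by congr (op _ (op _ _)); congr F; exact: val_inj.
Qed.

Lemma ord3_cases (i : 'I_3) : [\/ i = 0, i = 1 | i = 2].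
Proof.
by case: i => [[|[|[|//]]] hi]; [apply: Or31|apply: Or32|apply: Or33]; exact: val_inj.
Qed.

Lemma clear_denominators (u0 u1 u2 v0 v1 v2 L0 L1 L2 e0 e1 e2 : int) :
  e0 * v0 = u0 * L0 -> e1 * v1 = u1 * L1 -> e2 * v2 = u2 * L2 ->
  L0 * L1 * L2 != 0 -> e0 * (L1 * L2) + e1 * (L0 * L2) + e2 * (L0 * L1) = 0 ->
  u0 * (v1 * v2) + u1 * (v0 * v2) + u2 * (v0 * v1) = 0.
Proof.
move=> h0 h1 h2 L t; apply: (mulIf L); rewrite mul0r.
transitivity ((u0 * L0) * (v1 * v2 * L1 * L2) + (u1 * L1) * (v0 * v2 * L0 * L2)
   + (u2 * L2) * (v0 * v1 * L0 * L1)); first by ring.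
rewrite -h0 -h1 -h2.
transitivity (v0 * v1 * v2 * (e0 * (L1 * L2) + e1 * (L0 * L2) + e2 * (L0 * L1))).
  by ring.
by rewrite t mulr0.
Qed.

Section Trinomial.
Variables (K : closedFieldType) (n : nat).
Variables (grp : 'I_n -> 'I_3) (l : 'I_n -> nat).

Definition block (i : 'I_3) : 'X_{1..n} :=
  [multinom (if grp j == i then l j else 0%N) | j < n].

Definition trinom : {mpoly K[n]} := \sum_i 'X_[block i].

Lemma trinom_supp m : trinom@_m != 0 -> exists i, m = block i.
Proof.
move=> h; apply: contrapT => no; case/eqP: h.
rewrite /trinom raddf_sum /= big1 // => i _; rewrite mcoeffX.
by case: eqP => // e; case: no; exists i.
Qed.

Lemma mcoeff_mulXU (j : 'I_n) (q : {mpoly K[n]}) m :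
  ('X_j * q)@_m != 0 -> (0 < m j)%N.
Proof.
move=> /mcoeffM_neq0[a [b [-> + _]]]; rewrite mcoeffX.
by case: (_ =P a) => [<- _|_]; rewrite ?eqxx // mnmDE mnm1E eqxx.
Qed.

Lemma divXU (j : 'I_n) (p : {mpoly K[n]}) :
  (forall m, p@_m != 0 -> (0 < m j)%N) -> exists q, p = 'X_j * q.
Proof.
move=> h; exists (\sum_(m <- msupp p) p@_m *: 'X_[m - U_(j)]).
rewrite {1}[p]mpolyE mulr_sumr; apply: eq_big_seq => m.
rewrite mcoeff_msupp => /h mj; rewrite -scalerAr -mpolyXD addmC submK //.
by apply/mnm_lepP => i; rewrite mnm1E; case: eqP => [<-|].
Qed.

(** Pair weights leave all three terms at weight zero, triple weights give them
    the same positive weight.  Together they generate, over the rationals, all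
    weights for which the trinomial is homogeneous, that is, the one-parameter
    subgroups of the torus acting on the hypersurface. *)
Definition pair_weight (j j' : 'I_n) : {ffun 'I_n -> int} :=
  [ffun i => (i == j)%:Z * (l j')%:Z - (i == j')%:Z * (l j)%:Z].

Definition triple_weight (j0 j1 j2 : 'I_n) : {ffun 'I_n -> int} :=
  [ffun i => (i == j0)%:Z * (l j1 * l j2)%:Z + (i == j1)%:Z * (l j0 * l j2)%:Z
           + (i == j2)%:Z * (l j0 * l j1)%:Z].

Definition torus_weights : seq {ffun 'I_n -> int} :=
  [seq pair_weight x.1 x.2 | x <- enum {: 'I_n * 'I_n} & grp x.1 == grp x.2] ++
  [seq triple_weight x.1.1 x.1.2 x.2 | x <- enum {: 'I_n * 'I_n * 'I_n}
     & [&& grp x.1.1 == 0, grp x.1.2 == 1 & grp x.2 == 2]].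

Lemma pair_weight_in j j' : grp j = grp j' -> pair_weight j j' \in torus_weights.
Proof.
move=> e; rewrite mem_cat; apply/orP; left; apply/mapP.
by exists (j, j'); rewrite // mem_filter mem_enum /= e eqxx.
Qed.

Lemma triple_weight_in j0 j1 j2 : grp j0 = 0 -> grp j1 = 1 -> grp j2 = 2 ->
  triple_weight j0 j1 j2 \in torus_weights.
Proof.
move=> e0 e1 e2; rewrite mem_cat; apply/orP; right; apply/mapP.
by exists (j0, j1, j2); rewrite // mem_filter mem_enum /= e0 e1 e2.
Qed.

Lemma sum_pick (F : 'I_n -> int) (j : 'I_n) : \sum_i (i == j)%:Z * F i = F j.
Proof.
rewrite (bigD1 j) //= eqxx mul1r big1 ?addr0 // => i /negbTE ->.
by rewrite mul0r.
Qed.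

Lemma wdeg_pair j j' m :
  wdeg (pair_weight j j') m = (l j' * m j)%:Z - (l j * m j')%:Z.
Proof.
rewrite /wdeg; under eq_bigr do rewrite ffunE mulrBl -!mulrA.
by rewrite sumrB (sum_pick (fun i => (l j')%:Z * (m i)%:Z)) (sum_pick (fun i => (l
  j)%:Z * (m i)%:Z)) !PoszM.
Qed.

Lemma wdeg_triple j0 j1 j2 m :
  wdeg (triple_weight j0 j1 j2) m =
    (l j1 * l j2 * m j0)%:Z + (l j0 * l j2 * m j1)%:Z + (l j0 * l j1 * m j2)%:Z.
Proof.
rewrite /wdeg; under eq_bigr do rewrite ffunE !mulrDl -!mulrA.
rewrite !big_split /= (sum_pick (fun i => (l j1 * l j2)%:Z * (m i)%:Z)).
rewrite (sum_pick (fun i => (l j0 * l j2)%:Z * (m i)%:Z)).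
by rewrite (sum_pick (fun i => (l j0 * l j1)%:Z * (m i)%:Z)) -!PoszM.
Qed.

Lemma trinom_homog w W : (forall i, wdeg w (block i) = W) -> whomog w W trinom.
Proof. by move=> h m /trinom_supp[i ->]. Qed.

Lemma wdeg_triple_block j0 j1 j2 i : grp j0 = 0 -> grp j1 = 1 -> grp j2 = 2 ->
  wdeg (triple_weight j0 j1 j2) (block i) = (l j0 * l j1 * l j2)%:Z.
Proof.
move=> e0 e1 e2; rewrite wdeg_triple !mnmE e0 e1 e2.
by case: (ord3_cases i) => -> //=; rewrite !muln0; lia.
Qed.

Lemma torus_weights_homog w : w \in torus_weights ->
  exists W, whomog w W trinom.
Proof.
rewrite mem_cat => /orP[] /mapP[x]; rewrite mem_filter mem_enum andbT.
  move=> /eqP e ->; exists 0; apply: trinom_homog => i.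
  by rewrite wdeg_pair !mnmE e; case: eqP => _; lia.
move=> /and3P[/eqP e0 /eqP e1 /eqP e2] ->.
exists (l x.1.1 * l x.1.2 * l x.2)%:Z; apply: trinom_homog => i.
exact: wdeg_triple_block.
Qed.

Variable N : nat.
Hypothesis l_gt0 : forall j, (0 < l j)%N.
Hypothesis N_gt1 : (1 < N)%N.
Hypothesis lN : forall i, (\sum_(j | grp j == i) l j)%N = N.

Lemma mdeg_block i : mdeg (block i) = N.
Proof.
rewrite mdegE -(lN i) [RHS]big_mkcond; apply: eq_bigr => j _.
by rewrite mnmE.
Qed.

Lemma group_nonempty i : exists j, grp j = i.
Proof.
apply: contrapT => no; have := lN i; rewrite big_pred0;
  first by move: N_gt1 => /[swap] <-.
by move=> j; apply/negbTE/eqP => e; apply: no; exists j.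
Qed.

Lemma block_inj : injective block.
Proof.
move=> i i' /mnmP e; have [j gj] := group_nonempty i.
have := e j; rewrite !mnmE gj eqxx; case: eqP => // _ lj.
by have := l_gt0 j; rewrite lj.
Qed.

Lemma divides_low_degree p m : divides trinom p -> p@_m != 0 -> (N <= mdeg m)%N.
Proof.
move=> [q ->] /mcoeffM_neq0[a [b [-> _ /trinom_supp[i ->]]]].
by rewrite mdegD mdeg_block leq_addl.
Qed.

Definition same_degree (m m' : 'X_{1..n}) : Prop :=
  forall w, w \in torus_weights -> wdeg w m = wdeg w m'.

Definition pairwise_coprime_blocks : Prop := forall (d : nat) (i i' : 'I_3),
  i != i' -> (forall j, grp j = i \/ grp j = i' -> (d %| l j)%N) -> d = 1%N.

(** The coefficients k are a priori rational.  The denominator of each divides all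
    exponents of its block, so the denominators are pairwise coprime; as the
    coefficients add up to zero, each denominator divides the product of the
    other two, hence is one. *)
Lemma same_degree_diff m m' : pairwise_coprime_blocks -> same_degree m m' ->
  exists2 k : 'I_3 -> int, \sum_i k i = 0 &
    forall j, (m j)%:Z - (m' j)%:Z = k (grp j) * (l j)%:Z.
Proof.
move=> cop same; have /all_sig[g gE] i : {j | grp j = i} := cid (group_nonempty i).
pose e j : int := (m j)%:Z - (m' j)%:Z.
have pairs j : e j * (l (g (grp j)))%:Z = e (g (grp j)) * (l j)%:Z.
  have := same _ (pair_weight_in (etrans (gE (grp j)) (erefl _))).
  by rewrite !wdeg_pair /e; lia.
have triple : e (g 0) * (l (g 1) * l (g 2))%:Z + e (g 1) * (l (g 0) * l (g 2))%:Z +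
   e (g 2) * (l (g 0) * l (g 1))%:Z = 0.
  have := same _ (triple_weight_in (gE 0) (gE 1) (gE 2)).
  rewrite !wdeg_triple /e !PoszM; lia.
pose v i := `|denq ((e (g i))%:~R / (l (g i))%:R)|%N.
pose u i := numq ((e (g i))%:~R / (l (g i))%:R).
have uv i : e (g i) * (v i)%:Z = u i * (l (g i))%:Z.
  have lr0 : (l (g i))%:R != 0 :> rat by rewrite pnatr_eq0 -lt0n.
  have vr0 : (denq ((e (g i))%:~R / (l (g i))%:R))%:~R != 0 :> rat.
    by rewrite intr_eq0 denq_neq0.
  apply: (@intr_inj rat); rewrite !rmorphM /= gtz0_abs ?denq_gt0 //.
  have /(canRL (mulfVK vr0)) -> := divq_num_den ((e (g i))%:~R / (l (g i))%:R).
  by rewrite mulrAC mulfVK.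
have uvj j : e j * (v (grp j))%:Z = u (grp j) * (l j)%:Z.
  have := pairs j; have := uv (grp j); have := l_gt0 (g (grp j)).
  set L := l (g (grp j)) => L0 e1 e2.
  have : (L%:Z : int) != 0 by lia.
  move/mulIf; apply; rewrite mulrAC e2 mulrAC e1; lia.
have vdvd j : (v (grp j) %| l j)%N.
  have cvu : coprimez (v (grp j))%:Z (u (grp j)).
    by rewrite coprimezE absz_nat coprime_sym; exact: coprime_num_den.
  have : ((v (grp j))%:Z %| u (grp j) * (l j)%:Z)%Z.
    by apply/dvdzP; exists (e j); exact: esym.
  by rewrite Gauss_dvdzr.
have vcop i i' : i != i' -> coprime (v i) (v i').
  move=> ii; apply/eqP; apply: (cop _ i i' ii) => j [] <-.
    exact: dvdn_trans (dvdn_gcdl _ _) (vdvd j).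
  exact: dvdn_trans (dvdn_gcdr _ _) (vdvd j).
have usum : u 0 * ((v 1%R)%:Z * (v 2%R)%:Z) + u 1 * ((v 0%R)%:Z * (v 2%R)%:Z)
    + u 2 * ((v 0%R)%:Z * (v 1%R)%:Z) = 0.
  move: triple; rewrite !PoszM; apply: clear_denominators (uv 0) (uv 1) (uv 2) _.
  by have := l_gt0 (g 0); have := l_gt0 (g 1); have := l_gt0 (g 2); nia.
have dvd_one (x y : nat) (p q r : int) (z : nat) : p * (y%:Z * z%:Z) + q * (x%:Z *
  z%:Z) + r * (x%:Z * y%:Z) = 0 ->
    coprimez x%:Z p -> coprime x y -> coprime x z -> x = 1%N.
  move=> e0 xp xy xz.
  have : (x%:Z %| p * (y * z)%:Z)%Z.
    by apply/dvdzP; exists (- (q * z%:Z + r * y%:Z)); move: e0; rewrite !PoszM; lia.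
  rewrite Gauss_dvdzr // => /= d.
  have : (x %| y * z)%N by [].
  by rewrite Gauss_dvdr // => /gcdn_idPl; rewrite (eqP xz).
have v1 i : v i = 1%N.
  have uvc i' : coprimez (v i')%:Z (u i').
    by rewrite coprimezE absz_nat coprime_sym; exact: coprime_num_den.
  case: (ord3_cases i) => ->.
  - by apply: (dvd_one (v 0) (v 1) (u 0) (u 1) (u 2) (v 2)); rewrite ?vcop.
  - by apply: (dvd_one (v 1) (v 0) (u 1) (u 0) (u 2) (v 2)); rewrite ?vcop // -usum; ring.
  - by apply: (dvd_one (v 2) (v 0) (u 2) (u 0) (u 1) (v 1)); rewrite ?vcop // -usum; ring.
exists u; last by move=> j; rewrite -uvj v1 mulr1.
by move: usum; rewrite big_ord3 !v1 !mulr1 /= addrA.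
Qed.
End Trinomial.

(** * Rigidity of a factorial trinomial hypersurface *)

Section CoordinateRing.
Variables (K : closedFieldType) (n : nat).
Variables (grp : 'I_n -> 'I_3) (l : 'I_n -> nat) (N : nat).
Hypothesis l_gt0 : forall j, (0 < l j)%N.
Hypothesis N_gt1 : (1 < N)%N.
Hypothesis lN : forall i, (\sum_(j | grp j == i) l j)%N = N.
Notation block := (block grp l).
Notation trinom := (trinom K grp l).
Notation same_degree := (same_degree grp l).

Implicit Types m nu : 'X_{1..n}.

Lemma reduced_decomp m : exists (nu : 'X_{1..n}) (k : 'I_3 -> nat),
  (forall j, m j = nu j + k (grp j) * l j)%N /\ forall i, ~~ (block i <= nu)%MM.
Proof.
have [d] := ubnP (mdeg m); elim: d m => // d IH m md.
have [/existsP[i im]|/existsPn no] := boolP [exists i, (block i <= m)%MM]; last first.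
  by exists m, (fun=> 0%N); split=> // j; rewrite mul0n addn0.
have bi := mdeg_block lN i.
have [|nu [k [e red]]] := IH (m - block i)%MM.
  by move: md bi N_gt1; rewrite -{1}(submK im) mdegD; lia.
exists nu, (fun i' => k i' + (i' == i))%N; split=> // j.
have := e j; rewrite mnmBE mnmE; move/mnm_lepP/(_ j): im; rewrite mnmE.
by case: eqP => _; rewrite ?addn0 ?addn1 ?mulSn; lia.
Qed.

(** The monomial nu is what remains of m0 after dividing by the terms as often as
    possible.  A monomial of the same degree differs from m0 by a combination of
    the blocks, and none of its total multiplicities can be negative because no
    block divides nu. *)
Lemma same_degree_decomp m0 : pairwise_coprime_blocks grp l ->
  exists (nu : 'X_{1..n}) (k0 : 'I_3 -> nat),
  (forall j, m0 j = nu j + k0 (grp j) * l j)%N /\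
  forall m, same_degree m m0 -> exists2 k : 'I_3 -> nat,
    (\sum_i k i = \sum_i k0 i)%N & forall j, (m j = nu j + k (grp j) * l j)%N.
Proof.
move=> cop; have [nu [k0 [e0 red]]] := reduced_decomp m0.
exists nu, k0; split=> // m /(same_degree_diff l_gt0 N_gt1 lN cop)[k ksum ke].
have kpos i : 0 <= (k0 i)%:Z + k i.
  rewrite leNgt; apply/negP => kneg; case/negP: (red i); apply/mnm_lepP => j.
  rewrite mnmE; case: eqP => // gj.
  have := ke j; have := l_gt0 j; rewrite e0 gj; nia.
exists (fun i => absz ((k0 i)%:Z + k i)).
  apply/eqP; rewrite -eqz_nat !(big_morph _ PoszD (erefl _)); apply/eqP.
  under eq_bigr do rewrite gez0_abs ?kpos //.
  by rewrite big_split /= ksum addr0.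
move=> j; have := ke j; rewrite e0; have := kpos (grp j); nia.
Qed.

Lemma mpolyX_decomp (m nu : 'X_{1..n}) (k : 'I_3 -> nat) :
  (forall j, m j = nu j + k (grp j) * l j)%N ->
  'X_[K, m] = 'X_[nu] * \prod_i 'X_[block i] ^+ k i.
Proof.
move=> e; have -> : m = (nu + \sum_i block i *+ k i)%MM.
  apply/mnmP => j; rewrite e mnmDE mnm_sumE (bigD1 (grp j)) //= mulmnE mnmE eqxx.
  rewrite big1 => [|i]; first by rewrite addn0 mulnC.
  by rewrite mulmnE mnmE eq_sym => /negbTE ->.
by rewrite mpolyXD -mprodXnE.
Qed.

(** The coordinate ring enters only through a surjection from the polynomial ring
    with the right kernel. *)
Variables (R : comNzRingType) (pi : {rmorphism {mpoly K[n]} -> R}).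
Hypothesis pi_surj : forall x, exists p, pi p = x.
Hypothesis pi_ker : forall p, pi p = 0 <-> divides trinom p.
Hypothesis ufd : unique_factorization_domain R.

Notation T j := (pi 'X_j).
Notation a i := (pi 'X_[block i]).
Definition phi : {rmorphism K -> R} := GRing.RMorphism.clone _ _ (pi \o @mpolyC n K) _.

Lemma piZ c p : pi (c *: p) = phi c * pi p.
Proof. by rewrite -mul_mpolyC rmorphM. Qed.

Lemma pi_eq p q : pi p = pi q <-> divides trinom (p - q).
Proof.
rewrite -pi_ker rmorphB; split=> [->|/eqP]; first by rewrite subrr.
by rewrite subr_eq0 => /eqP.
Qed.

Lemma phi_eq0 c : (phi c == 0) = (c == 0).
Proof. exact: fmorph_eq0. Qed.

Lemma sum_terms : a 0 + a 1 + a 2 = 0.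
Proof.
have : pi trinom = 0 by apply/pi_ker; exists 1; rewrite mul1r.
by rewrite rmorph_sum big_ord3 /= addrA.
Qed.

Lemma low_degree_neq0 p m : p@_m != 0 -> (mdeg m < N)%N -> pi p <> 0.
Proof.
move=> pm mN /pi_ker/(divides_low_degree lN) h.
by move: (h _ pm); rewrite leqNgt mN.
Qed.

Lemma variable_dvd i j c : T i = T j * c -> i = j.
Proof.
have [q <-] := pi_surj c; rewrite -rmorphM; move/pi_eq/(divides_low_degree lN) => h.
apply/eqP/negPn/negP => ij; suff : (N <= 1)%N by rewrite leqNgt N_gt1.
rewrite -(mdeg1 i); apply: h; rewrite mcoeffB mcoeffX eqxx.
have -> : ('X_j * q)@_U_(i) = 0.
  apply/eqP/negPn/negP => /mcoeff_mulXU; rewrite mnm1E.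
  by rewrite (negbTE ij).
by rewrite subr0 oner_eq0.
Qed.

Lemma variable_nonunit j : ~ ring_unit (T j).
Proof.
move=> [c]; have [q <-] := pi_surj c; rewrite -rmorphM -(rmorph1 pi).
move/pi_eq/(divides_low_degree lN) => h;
  suff : (N <= mdeg (0%MM : 'X_{1..n}))%N by rewrite mdeg0; move: N_gt1; lia.
apply: h; rewrite mcoeffB mcoeff1 eqxx.
have -> : ('X_j * q)@_0%MM = 0.
  by apply/eqP/negPn/negP => /mcoeff_mulXU; rewrite mnm0E.
by rewrite sub0r oppr_eq0 oner_eq0.
Qed.

Lemma wdeg_const (m : 'X_{1..n}) : wdeg [ffun=> 1] m = (mdeg m)%:Z.
Proof.
rewrite /wdeg mdegE (big_morph _ PoszD (erefl _)); apply: eq_bigr => j _.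
by rewrite ffunE mul1r.
Qed.

(** A factorization of a variable can be taken with both factors reduced to top
    components that survive in the quotient; their degrees add up to one, so one
    of the factors is a constant. *)
Lemma variable_irreducible j : ring_irreducible (T j).
Proof.
split; last 2 first.
- exact: variable_nonunit.
- move=> x y; have [p <-] := pi_surj x; have [q <-] := pi_surj y => e.
  have fW : whomog [ffun=> 1] N%:Z trinom.
    by apply: trinom_homog => i; rewrite wdeg_const (mdeg_block lN).
  have T0 : T j <> 0.
    by apply: (@low_degree_neq0 _ U_(j)); rewrite ?mcoeffX ?eqxx ?oner_eq0 ?mdeg1.
  have [|dp [p' [pp' lp np]]] := @top_component _ _ [ffun=> 1] trinom p.
    by move/pi_ker => p0; apply: T0; rewrite e p0 mul0r.
  have [|dq [q' [qq' lq nq]]] := @top_component _ _ [ffun=> 1] trinom q.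
    by move/pi_ker => q0; apply: T0; rewrite e q0 mulr0.
  move/pi_eq: pp' => pp'; move/pi_eq: qq' => qq'.
  have unit0 g d : wle [ffun=> 1] d g -> d <= 0 -> pi g <> 0 -> ring_unit (pi g).
    move=> lg d0 g0; have gE : g = (g@_0)%:MP.
      apply/mpolyP => m; rewrite mcoeffC; have [->|m0] := eqVneq m 0%MM.
        by rewrite mulr1.
      rewrite mulr0; apply/eqP/negPn/negP => /lg; rewrite wdeg_const.
      by move: m0; rewrite -mdeg_eq0; lia.
    have c0 : g@_0 != 0 by apply: contra_notN g0 => /eqP c0;
      rewrite gE c0 mpolyC0 rmorph0.
    exists (phi (g@_0)^-1); rewrite {1}gE -[pi _]/(phi _) -rmorphM divff //.
    exact: rmorph1.
  have [dpq|dpq] := eqVneq (dp + dq) 1; last first.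
    have := wcomp_wleM lp lq => e2;
      case: (ufd_domain ufd (x := pi (wcomp [ffun=> 1] dp p')) (y :=
        pi (wcomp [ffun=> 1] dq q'))).
    + rewrite -rmorphM -e2; apply/pi_ker.
      have : divides trinom (p' * q' - 'X_j).
        by apply/pi_eq; rewrite rmorphM -pp' -qq' e.
      move/(divides_wcomp fW (dp + dq)); congr divides; apply/mpolyP => m.
      rewrite !mcoeff_wpart mcoeffB mcoeffX /=; case: (wdeg _ m =P _) => // wm.
      case: eqP => [mE|_]; last by rewrite subr0.
      by move: dpq; rewrite -wm -mE wdeg_const mdeg1.
    + by move/pi_ker/np.
    + by move/pi_ker/nq.
  have pq0 : pi p' * pi q' <> 0 by rewrite -pp' -qq' -e.
  have p0 : pi p' <> 0 by move=> h; rewrite h mul0r in pq0.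
  have q0 : pi q' <> 0 by move=> h; rewrite h mulr0 in pq0.
  rewrite pp' qq'; have [dp0|dp0] := leP dp 0; first by left; exact: unit0 lp dp0 p0.
  by right; apply: unit0 lq _ q0; lia.
- by apply: (@low_degree_neq0 _ U_(j)); rewrite ?mcoeffX ?eqxx ?oner_eq0 ?mdeg1.
Qed.

Lemma variable_prime j x y z : x * y = T j * z ->
  (exists c, x = T j * c) \/ (exists c, y = T j * c).
Proof. exact: irreducible_prime (variable_irreducible j). Qed.

Lemma variable_dvd_monomial j m c : pi 'X_[m] = T j * c -> (0 < m j)%N.
Proof.
have [d] := ubnP (mdeg m); elim: d m c => // d IH m c md e.
have [m0|m0] := eqVneq m 0%MM.
  by case: (@variable_nonunit j); exists c; rewrite -e m0 mpolyX0 rmorph1.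
have /existsP[i mi] : [exists i, 0 < m i]%N.
  apply: contraNT m0 => /existsPn no; apply/eqP/mnmP => i; rewrite mnm0E.
  by apply/eqP; rewrite -leqn0 leqNgt no.
have mE : m = (U_(i) + (m - U_(i)))%MM by rewrite addmC submK // lep1mP -lt0n.
rewrite mE mpolyXD rmorphM in e.
have [[c' e']|[c' e']] := variable_prime e.
  by rewrite (variable_dvd e') in mi.
have : (0 < (m - U_(i))%MM j)%N.
  by apply: IH e'; move: md; rewrite {1}mE mdegD mdeg1.
by rewrite mnmBE; lia.
Qed.

Lemma prime_dvd_prod j (I : eqType) (s : seq I) (F : I -> R) c :
  \prod_(x <- s) F x = T j * c -> exists2 x, x \in s & exists c', F x = T j * c'.
Proof.
elim: s c => [|x s IH] c; first by rewrite big_nil => e; case: (@variable_nonunit j);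
  exists c.
rewrite big_cons => /variable_prime[[c' e]|[c' /IH[y ys hy]]].
  by exists x; rewrite ?mem_head //; exists c'.
by exists y; rewrite // inE ys orbT.
Qed.

(** If an integer d > 1 divides the exponents of two terms A^d and B^d, then a
    variable of the third term, being prime, divides one of the linear factors
    of the form A^d + B^d.  That factor has degree less than N, so no relation
    of the ring can account for this. *)
Lemma ufd_coprime_blocks : pairwise_coprime_blocks grp l.
Proof.
move=> d i i' ii' ddvd; have [j gj] := group_nonempty N_gt1 lN i.
have d_gt0 : (0 < d)%N.
  have : (d %| l j)%N by apply: ddvd; left.
  by case: (d) => //; rewrite dvd0n; have := l_gt0 j; lia.
apply/eqP; rewrite eqn_leq d_gt0 andbT leqNgt; apply/negP => d_gt1.
pose r (i : 'I_3) : 'X_{1..n} := [multinom (block i j %/ d)%N | j < n].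
have rE i0 : i0 = i \/ i0 = i' -> block i0 = (r i0 *+ d)%MM.
  move=> hi; apply/mnmP => k; rewrite mulmnE !mnmE.
  case: eqP => [gk|]; last by rewrite div0n.
  by rewrite divnK //; apply: ddvd; case: hi => <-; [left|right].
have rdeg i0 : i0 = i \/ i0 = i' -> (mdeg (r i0) < N)%N.
  by move=> /rE e; have := mdeg_block lN i0; rewrite e mdegMn; nia.
have [i2 [i2i i2i' i2sum]] : exists i2, [/\ i2 != i, i2 != i' & a i2 = - (a i + a i')].
  have s := sum_terms; have c3 (x y z : R) : x + y + z = 0 -> z = - (x + y).
    by move/eqP; rewrite addr_eq0 => /eqP ->; rewrite opprK.
  by case: (ord3_cases i) (ord3_cases i') ii' => -> [] -> // _;
    [exists 2|exists 1|exists 2|exists 0|exists 1|exists 0];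
    split=> //; apply: c3; rewrite -s; ring.
have [j2 gj2] := group_nonempty N_gt1 lN i2.
have [q qE] : exists q, 'X_[K, block i2] = 'X_j2 * q.
  exists 'X_[block i2 - U_(j2)]; rewrite -mpolyXD addmC submK //.
  by rewrite lep1mP mnmE gj2 eqxx -lt0n.
have sz : size ('X^d + 1 : {poly K}) = d.+1 by rewrite -polyC1 size_XnaddC.
have [||c [s [c0 szs s0 e]]] := bform_split phi (pi 'X_[r i]) (pi 'X_[r i']) (m :=
  d) (p := 'X^d + 1).
- by rewrite -size_poly_eq0 sz.
- by rewrite sz.
have bE : bform phi (pi 'X_[r i]) (pi 'X_[r i']) d ('X^d + 1) = a i + a i'.
  rewrite (rE i (or_introl erefl)) (rE i' (or_intror erefl)).
  rewrite -!mpolyXn !rmorphXn bformD (bformXn _ _ _ (leqnn d)) subnn mulr1.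
  by rewrite -(expr0 'X) bformXn // subn0 mul1r.
have : \prod_(x <- s) (phi x.1 * pi 'X_[r i] + phi x.2 * pi 'X_[r i']) = T j2 * (phi (-
  c^-1) * pi q).
  have : phi c^-1 * (a i + a i') = phi c^-1 * (phi c * \prod_(x <- s) (phi x.1 * pi
    'X_[r i] + phi x.2 * pi 'X_[r i'])).
    by rewrite -bE e.
  rewrite [RHS]mulrA -rmorphM mulVf // rmorph1 mul1r => <-.
  have -> : a i + a i' = - (T j2 * pi q) by rewrite -rmorphM -qE i2sum opprK.
  by rewrite rmorphN; ring.
case/prime_dvd_prod => -[al be] /s0 /= ab [c' e'].
have [q' q'E] := pi_surj c'.
have rij i0 k : (i0 = i \/ i0 = i') -> grp k = i0 -> (0 < r i0 k)%N.
  move=> hi gk; rewrite !mnmE gk eqxx divn_gt0 //; apply: dvdn_leq => //.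
  by apply: ddvd; case: hi gk => <-; [left|right].
have rdiff : r i != r i'.
  apply: contraNneq ii' => /mnmP/(_ j); have := rij i j (or_introl erefl) gj.
  by rewrite !mnmE gj; case: (i =P i') => // _; rewrite div0n => + e0; rewrite e0.
have nodvd m : m = r i \/ m = r i' -> ('X_j2 * q')@_m = 0.
  move=> hm; apply/eqP/negPn/negP => /mcoeff_mulXU.
  by case: hm => ->; rewrite !mnmE gj2 ?(negbTE i2i) ?(negbTE i2i') div0n.
have : divides trinom (al *: 'X_[r i] + be *: 'X_[r i'] - 'X_j2 * q').
  by apply/pi_eq; rewrite rmorphD rmorphM !piZ q'E.
move/(divides_low_degree lN) => h.
have {}h m : (m = r i \/ m = r i') -> (al *: 'X_[r i] + be *: 'X_[r i'])@_m = 0.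
  move=> hm; apply/eqP/negPn/negP => hm0.
  have mN : (mdeg m < N)%N by case: hm => ->; apply: rdeg; [left|right].
  by have := h m; rewrite mcoeffB nodvd // subr0 leqNgt mN => /(_ hm0).
case/negP: ab; rewrite xpair_eqE; apply/andP; split.
  have := h _ (or_introl erefl); rewrite mcoeffD !mcoeffZ !mcoeffX eqxx eq_sym (negbTE
    rdiff).
  by rewrite mulr1 mulr0 addr0 => ->.
have := h _ (or_intror erefl); rewrite mcoeffD !mcoeffZ !mcoeffX eqxx (negbTE rdiff).
by rewrite mulr1 mulr0 add0r => ->.
Qed.

Variable p : 'I_n -> {mpoly K[n]}.
Hypothesis charK : [pchar K] =i pred0.
Hypothesis l_gt1 : forall j, (1 < l j)%N.
Hypothesis nilp : nilpotent_field trinom p.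
Hypothesis p_homog : forall w, w \in torus_weights grp l ->
  exists e, forall i, whomog w (w i + e) (p i).

Definition induced_der (x : R) : R := pi (vder p (sval (cid (pi_surj x)))).
Notation D := induced_der.

Lemma D_pi g : D (pi g) = pi (vder p g).
Proof.
rewrite /induced_der; case: cid => h /= e; apply/pi_eq; rewrite -vderB.
by apply: vder_divides; [by case: nilp|exact/pi_eq].
Qed.

Lemma D_add : {morph D : x y / x + y}.
Proof.
move=> x y; have [g <-] := pi_surj x; have [h <-] := pi_surj y.
by rewrite -rmorphD !D_pi vderD rmorphD.
Qed.

Lemma D_mul x y : D (x * y) = D x * y + x * D y.
Proof.
have [g <-] := pi_surj x; have [h <-] := pi_surj y.
by rewrite -rmorphM !D_pi vderM rmorphD !rmorphM.
Qed.

Lemma D_phi c : D (phi c) = 0.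
Proof. by rewrite /phi /= D_pi vderC rmorph0. Qed.

Lemma iter_D_pi k g : iter k D (pi g) = pi (iter k (vder p) g).
Proof. by elim: k => //= k ->; rewrite D_pi. Qed.

Lemma D_variable j : D (T j) = pi (p j).
Proof. by rewrite D_pi vderX. Qed.

Lemma charR k : k.+1%:R != 0 :> R.
Proof.
by rewrite -(rmorph_nat phi) phi_eq0; have /pcharf0P -> := charK.
Qed.

Lemma D_nilpotent x : exists k, iter k D x = 0.
Proof.
have [g <-] := pi_surj x; elim/mpolyind: g => [|c m g _ _ [k2 e2]].
  by exists 0%N; rewrite /= rmorph0.
suff [k1 e1] : exists k, iter k D (pi (c *: 'X_[m])) = 0.
  exists (maxn k1 k2); rewrite rmorphD iter_derD; last exact: D_add.
  rewrite (iter_der_le D_add e1 (leq_maxl _ _)).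
  by rewrite (iter_der_le D_add e2 (leq_maxr _ _)) addr0.
have mulnil x1 x2 : (exists k, iter k D x1 = 0) -> (exists k, iter k D x2 = 0) ->
    exists k, iter k D (x1 * x2) = 0.
  move=> [k1 e1] [k3 e3].
  have e1' := iter_der_le D_add e1 (leqnSn k1).
  have e3' := iter_der_le D_add e3 (leqnSn k3).
  by have [z _] := iter_der_mul D_add D_mul e1' e3'; exists (k1 + k3).+1.
rewrite piZ; apply: (mulnil); first by exists 1%N; exact: D_phi.
rewrite mpolyXE_id rmorph_prod;
  apply: (big_ind (fun x => exists k, iter k D x = 0)) => //.
  by exists 1%N; rewrite /= -(rmorph1 phi) D_phi.
move=> j _; rewrite rmorphXn; elim: (m j) => [|k IH].
  by exists 1%N; rewrite /= expr0 -(rmorph1 phi) D_phi.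
rewrite exprS; apply: (mulnil) => //.
have [_ _ /(_ j)[k' /pi_ker e]] := nilp; exists k'.
by rewrite iter_D_pi.
Qed.

Let domR := ufd_domain ufd.
Notation nilindex := (nilindex D_nilpotent).
Notation D_factor := (der_factor domR charR D_add D_mul D_nilpotent).
Notation D_dvd := (der_dvd domR charR D_add D_mul D_nilpotent).

Lemma monomial_neq0 m : pi 'X_[m] != 0.
Proof.
rewrite mpolyXE_id rmorph_prod; apply: (big_ind (fun x => x != 0)) => [|x y|j _].
- exact: oner_neq0.
- exact: mulR_neq0.
rewrite rmorphXn; have T0 : T j != 0 by have [/eqP] := variable_irreducible j.
elim: (m j) => [|k IH]; first by rewrite oner_neq0.
by rewrite exprS; exact: mulR_neq0.
Qed.

Lemma D_monomial m : (forall j, (0 < m j)%N -> D (T j) = 0) -> D (pi 'X_[m]) = 0.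
Proof.
move=> h; rewrite mpolyXE_id rmorph_prod;
  apply: (big_ind (fun x => D x = 0)) => [|x y ex ey|j _].
- by rewrite -(rmorph1 phi) D_phi.
- by rewrite D_mul ex ey mul0r mulr0 addr0.
rewrite rmorphXn; have := h j; case: (m j) => [_|k /(_ isT) Tj].
  by rewrite expr0 -(rmorph1 phi) D_phi.
by rewrite (derX D_mul) Tj mulr0.
Qed.

Lemma D_monomial_factor m j : D (pi 'X_[m]) = 0 -> (0 < m j)%N -> D (T j) = 0.
Proof.
move=> e mj; have mE : m = (U_(j) + (m - U_(j)))%MM by rewrite addmC submK // lep1mP
  -lt0n.
apply: (@D_factor _ (pi 'X_[m - U_(j)])); rewrite -rmorphM -mpolyXD -mE //.
exact: monomial_neq0.
Qed.

(** Weights of opposite signs on two variables of a term: according to the sign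
    of the degree of the derivation, one of the two variables divides its own
    derivative. *)
Lemma kernel_in_group j j' : j != j' -> grp j = grp j' -> D (T j) = 0 \/ D (T j') = 0.
Proof.
move=> jj' e; have [d hd] := p_homog (pair_weight_in l e).
have wj : pair_weight l j j' j = (l j')%:Z.
  by rewrite ffunE eqxx (negbTE jj') mul1r mul0r subr0.
have wj' : pair_weight l j j' j' = - (l j)%:Z.
  by rewrite ffunE eqxx eq_sym (negbTE jj') mul1r mul0r sub0r.
have self i q : p i = 'X_i * q -> D (T i) = 0.
  by move=> pE; apply: (@D_dvd _ (pi q)); rewrite -rmorphM -pE D_variable.
have := l_gt0 j; have := l_gt0 j' => lj' lj.
have [d0|d0] := leP 0 d; [left|right].
  have [|q] := divXU (j := j) (p := p j); last exact: self.
  by move=> m /hd; rewrite wdeg_pair wj; nia.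
have [|q] := divXU (j := j') (p := p j'); last exact: self.
by move=> m /hd; rewrite wdeg_pair wj'; nia.
Qed.

Lemma kernel_terms : ~ (forall i, D (a i) = 0).
Proof.
move=> h; have [[j nj] _ _] := nilp; apply: nj; apply/pi_ker.
rewrite -D_variable; apply: D_monomial_factor (h (grp j)) _.
by rewrite mnmE eqxx.
Qed.

(** At most one variable of a term is outside the kernel; the remaining ones are
    collected in u. *)
Lemma term_form i : D (a i) <> 0 -> exists j (u : 'X_{1..n}),
  [/\ grp j = i, D (T j) <> 0, D (pi 'X_[u]) = 0,
      (forall j', grp j' <> i -> u j' = 0%N) & a i = T j ^+ (l j) * pi 'X_[u]].
Proof.
move=> Da; have [[j [gj Dj]]|no] := pselect (exists j, grp j = i /\ D (T j) <> 0);
  last first.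
  case: Da; apply: D_monomial => j; rewrite mnmE; case: eqP => // gj _.
  by apply: contrapT => Dj; apply: no; exists j.
pose u := (block i - U_(j) *+ l j)%MM; exists j, u.
have uE j' : u j' = if (grp j' == i) && (j' != j) then l j' else 0%N.
  rewrite mnmBE mulmnE !mnmE; case: (j =P j') => [<-|jj'].
    by rewrite gj !eqxx mul1n subnn.
  by rewrite mul0n subn0; case: (j' =P j) => [e|_]; [case: jj'|rewrite andbT].
split=> //.
- apply: D_monomial => j'; rewrite uE; case: ifP => // /andP[/eqP gj' jj'] _.
  by have [//|/Dj //] := kernel_in_group jj' (etrans gj' (esym gj)).
- by move=> j' /eqP/negbTE gj'; rewrite uE gj'.
rewrite -rmorphXn -rmorphM mpolyXn -mpolyXD addmC submK //.
apply/mnm_lepP => j'; rewrite mulmnE !mnmE; case: (j =P j') => // <-.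
by rewrite gj eqxx mul1n.
Qed.

Lemma D_phi_mul c x : D (phi c * x) = phi c * D x.
Proof. by rewrite D_mul D_phi mul0r add0r. Qed.

Lemma phi_cancel c x : c != 0 -> phi c * x = 0 -> x = 0.
Proof.
move=> c0 /domR[/eqP|//]; by rewrite phi_eq0 (negbTE c0).
Qed.

(** Otherwise the two terms are x^p u and y^q v with u, v in the kernel and x, y
    outside.  Differentiating the relation and using that p and q are at least
    two and that x and y are prime, x divides D y and y divides D x; then each of
    x and y has smaller degree with respect to D than the other. *)
Lemma pencil_two al be i i' : i != i' -> al != 0 -> be != 0 ->
  D (phi al * a i + phi be * a i') = 0 -> D (a i) = 0 \/ D (a i') = 0.
Proof.
move=> ii' al0 be0 e.
have [|/term_form[x [u [gx Dx Du ux aE]]]] := pselect (D (a i) = 0); first by left.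
have [|/term_form[y [v [gy Dy Dv vy bE]]]] := pselect (D (a i') = 0); first by right.
exfalso.
have key x1 y1 (u1 v1 : 'X_{1..n}) (c1 c2 : K) : c1 != 0 -> c2 != 0 -> x1 != y1 ->
    D (pi 'X_[u1]) = 0 -> D (pi 'X_[v1]) = 0 -> D (T x1) <> 0 -> u1 y1 = 0%N ->
    phi c1 * D (T x1 ^+ l x1 * pi 'X_[u1]) + phi c2 * D (T y1 ^+ l y1 * pi 'X_[v1]) = 0 ->
    (nilindex (T y1) <= (nilindex (T x1)).-1)%N.
  move=> c10 c20 xy Du1 Dv1 Dx1 u1y.
  have [b bE'] : exists b, l y1 = b.+2 by exists (l y1).-2; have := l_gt1 y1; lia.
  have [b' bE''] : exists b, l x1 = b.+1 by exists (l x1).-1; have := l_gt1 x1; lia.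
  rewrite !D_mul Du1 Dv1 !mulr0 !addr0 bE' bE'' !(derX D_mul) => e1.
  have dv : pi 'X_[U_(x1) *+ b' + u1] * (phi (c1 *+ b'.+1) * D (T x1)) =
     T y1 * (- phi (c2 *+ b.+2) * T y1 ^+ b * D (T y1) * pi 'X_[v1]).
    rewrite mpolyXD rmorphM -mpolyXn rmorphXn.
    rewrite -(mulr_natl c1) -(mulr_natl c2) !rmorphM !rmorph_nat.
    apply/eqP; rewrite -subr_eq0; apply/eqP; rewrite -[RHS]e1 exprS.
    set q1 := T x1 ^+ b'; set q2 := T y1 ^+ b; set d1 := D (T x1); set d2 := D (T y1).
    set n1 := b'.+1%:R; set n2 := b.+2%:R; set w1 := pi 'X_[u1]; set w2 := pi 'X_[v1].
    ring.
  have [[c]|[c cE]] := variable_prime dv.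
    move/variable_dvd_monomial; rewrite mnmDE mulmnE mnm1E (negbTE xy) u1y.
    by rewrite mul0n.
  have k0 : c1 *+ b'.+1 != 0.
    by rewrite -mulr_natl mulf_neq0 //; have /pcharf0P -> := charK.
  have DE : D (T x1) = T y1 * (phi (c1 *+ b'.+1)^-1 * c).
    rewrite mulrCA -cE mulrA -rmorphM mulVf // rmorph1 mul1r //.
  rewrite -(nilindex_der D_add D_nilpotent).
  apply: (nilindex_dvd domR charR D_add D_mul _ _ DE); exact/eqP.
have xy : x != y by apply: contra ii' => /eqP xy; rewrite -gx -gy xy.
have yx : y != x by rewrite eq_sym.
have uy : u y = 0%N by apply: ux; rewrite gy => /eqP; rewrite eq_sym (negbTE ii').
have vx : v x = 0%N by apply: vy; rewrite gx => /eqP; rewrite (negbTE ii').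
move: e; rewrite D_add !D_phi_mul aE bE => e.
have h1 := key x y u v al be al0 be0 xy Du Dv Dx uy e.
have h2 := key y x v u be al be0 al0 yx Dv Du Dy vx (etrans (addrC _ _) e).
have := introN eqP Dx; have := introN eqP Dy.
rewrite -!(nilindex_le1 D_add D_nilpotent); lia.
Qed.

(** If one term is in the kernel, so is the sum of the other two; then the
    preceding lemma puts all three terms, hence all variables, into the
    kernel. *)
Lemma term_not_kernel i : D (a i) <> 0.
Proof.
have two i1 i2 i3 : i2 != i3 -> a i1 + a i2 + a i3 = 0 ->
    (forall k, [|| k == i1, k == i2 | k == i3]) -> D (a i1) <> 0.
  move=> ne s cov Di; have s' : D (a i2) + D (a i3) = 0.
    rewrite -D_add; have -> : a i2 + a i3 = - a i1.
      by apply/eqP; rewrite -addr_eq0 addrC addrA s.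
    by rewrite (derN D_add) Di oppr0.
  have [h|h] : D (a i2) = 0 \/ D (a i3) = 0.
  - by apply: (@pencil_two 1 1); rewrite ?oner_neq0 // !rmorph1 !mul1r D_add.
  - apply: kernel_terms => k; have /or3P[/eqP->|/eqP->|/eqP->] // := cov k.
    by move: s'; rewrite h add0r.
  - apply: kernel_terms => k; have /or3P[/eqP->|/eqP->|/eqP->] // := cov k.
    by move: s'; rewrite h addr0.
have s := sum_terms; case: (ord3_cases i) => ->.
- by apply: (two 0 1 2) => // k; case: (ord3_cases k) => ->.
- by apply: (two 1 0 2) => // [|k]; [rewrite -s; ring|case: (ord3_cases k) => ->].
- by apply: (two 2 0 1) => // [|k]; [rewrite -s; ring|case: (ord3_cases k) => ->].
Qed.

Lemma pencil_not_kernel al be : (al, be) != (0, 0) ->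
  D (phi al * a 0 + phi be * a 1) <> 0.
Proof.
rewrite xpair_eqE negb_and; have [->|al0] := eqVneq al 0.
  rewrite /= => be0; rewrite rmorph0 mul0r add0r D_phi_mul => /(phi_cancel be0).
  exact: term_not_kernel.
have [->|be0] := eqVneq be 0.
  move=> _; rewrite rmorph0 mul0r addr0 D_phi_mul => /(phi_cancel al0).
  exact: term_not_kernel.
by move=> _ /(pencil_two (isT : 0 != 1 :> 'I_3) al0 be0)[]; exact: term_not_kernel.
Qed.

Lemma whomog_iter w e k d g : (forall i, whomog w (w i + e) (p i)) ->
  whomog w d g -> whomog w (d + k%:Z * e) (iter k (vder p) g).
Proof.
move=> hp hg; have [_] := wle_iter_vder k (fun i => whomog_wle (hp i)) (whomog_wle hg).
have -> : (fun i => wcomp w (w i + e) (p i)) = p by apply: funext => i; exact: wcomp_id.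
by rewrite (wcomp_id hg) => <-; exact: wcomp_homog.
Qed.

Lemma wdeg_block w i i' : w \in torus_weights grp l -> wdeg w (block i) = wdeg w
  (block i').
Proof.
move=> ww; have [W hW] := @torus_weights_homog K n grp l w ww;
  have c1 i0 : trinom@_(block i0) != 0.
  rewrite /trinom raddf_sum (bigD1 i0) //= mcoeffX eqxx big1 ?addr0 ?oner_eq0 // => i1.
  by rewrite mcoeffX (inj_eq (block_inj l_gt0 N_gt1 lN)) => /negbTE ->.
by rewrite (hW _ (c1 i)) (hW _ (c1 i')).
Qed.

(** A homogeneous element is a monomial times a binary form in the first two terms.
    The form is a product of members of their pencil, and factors of a kernel
    element are in the kernel, where there is no member of the pencil. *)
Lemma kernel_homog g : pi g != 0 -> D (pi g) = 0 ->
  (forall m m', g@_m != 0 -> g@_m' != 0 -> same_degree m m') ->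
  exists c m, [/\ g@_m != 0, pi g = phi c * pi 'X_[m] & D (pi 'X_[m]) = 0].
Proof.
move=> g0 Dg same; have [m0 gm0] : exists m0, g@_m0 != 0.
  apply: contrapT => no; case/eqP: g0; rewrite (_ : g = 0) ?rmorph0 //.
  by apply/mpolyP => m; rewrite mcoeff0; apply/eqP/negPn/negP => hm; case: no; exists m.
have [nu [k0 [e0 dec]]] := same_degree_decomp m0 ufd_coprime_blocks.
set M := (\sum_i k0 i)%N in dec.
have [F [fF gE]] : exists F, is_form phi (a 0) (a 1) M F /\ pi g = pi 'X_[nu] * F.
  rewrite [g]mpolyE rmorph_sum big_seq; apply: (big_ind
    (fun x => exists F, is_form phi (a 0) (a 1) M F /\ x = pi 'X_[nu] * F)).
  - by exists 0; rewrite mulr0; split=> //; exact: is_form0.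
  - move=> x y [F1 [f1 ->]] [F2 [f2 ->]]; exists (F1 + F2); rewrite mulrDr.
    by split=> //; exact: is_formD.
  move=> m; rewrite mcoeff_msupp => gm.
  have [k kM mE] := dec m (same m m0 gm gm0).
  exists (phi (g@_m) * (a 0 ^+ k 0 * (a 1 ^+ k 1 * (a 2 ^+ k 2 * 1)))); split.
    apply: is_formZ; have <- : (k 0%R + (k 1%R + (k 2%R + 0)))%N = M.
      by rewrite -kM big_ord3 /= addn0.
    apply: is_form_iter; first exact: is_form_mula.
    apply: is_form_iter; first exact: is_form_mulb.
    apply: is_form_iter; last exact: is_form1.
    move=> m' x; apply: is_form_mulc.
    by apply/eqP; rewrite -addr_eq0 addrC sum_terms.
  rewrite piZ (mpolyX_decomp mE) rmorphM big_ord3 /= !rmorphM !rmorphXn !mulr1.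
  by rewrite mulrCA.
have F0 : F != 0 by apply: contraNneq g0 => F0; rewrite gE F0 mulr0.
rewrite gE in g0 Dg.
have Dnu := D_factor g0 Dg; rewrite mulrC in g0 Dg; have DF := D_factor g0 Dg.
case: fF => q szq FE; have q0 : q != 0.
  apply: contraNneq F0 => q0; rewrite FE q0 /bform big1 // => i _.
  by rewrite coef0 rmorph0 !mul0r.
have [c [s [c0 szs s0 sE]]] := bform_split phi (a 0) (a 1) q0 szq.
case: s szs s0 sE => [|x s] szs s0 sE; last first.
  case: (@pencil_not_kernel x.1 x.2); first by rewrite -surjective_pairing s0 ?mem_head.
  rewrite FE sE big_cons mulrCA in DF F0; exact: D_factor F0 DF.
have m0nu : m0 = nu.
  apply/mnmP => j; rewrite e0; have := szs; rewrite /M (bigD1 (grp j)) //=.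
  by case: (k0 (grp j)) => // _; rewrite mul0n addn0.
exists c, m0; split=> //; last by rewrite m0nu.
by rewrite m0nu gE FE sE big_nil mulr1 mulrC.
Qed.

(** Each term has exactly one variable x i outside the kernel; let om be the weight
    carried by these three variables.  The last nonzero iterate of D on a member
    h of the pencil is a monomial in kernel variables, so it has om-weight zero,
    and the number k of steps needed is the same for all h.  The last iterates on
    the first two terms are then monomials of equal degree in kernel variables,
    hence proportional, and a combination of the two terms dies earlier. *)
Theorem no_homogeneous_field : False.
Proof.
have /all_sig2[x gx Dx] i : {j | grp j = i & D (T j) <> 0}.
  by apply/cid2; have [j [u [gj Dj _ _ _]]] := term_form (@term_not_kernel i); exists j.
have Dx0 m i : D (pi 'X_[m]) = 0 -> m (x i) = 0%N.
  by move=> Dm; apply/eqP; rewrite -leqn0 leqNgt;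
    apply/negP => /(D_monomial_factor Dm); exact: Dx.
have last_der al be : (al, be) != (0, 0) ->
    exists k c m, let h := phi al * a 0 + phi be * a 1 in
    [/\ iter k D h = phi c * pi 'X_[m], c != 0, D (pi 'X_[m]) = 0 &
      forall w e, w \in torus_weights grp l -> (forall i, whomog w (w i + e) (p i)) ->
        wdeg w m = wdeg w (block 0) + k%:Z * e].
  move=> ab; set h := phi al * a 0 + phi be * a 1; have Dh := pencil_not_kernel ab.
  pose G : {mpoly K[n]} := al *: 'X_[block 0] + be *: 'X_[block 1].
  have hG : pi G = h by rewrite rmorphD !piZ.
  pose k := (nilindex h).-1.
  have h0 : h != 0 by apply/eqP => h0; apply: Dh; rewrite -/h h0; exact: der0 D_add.
  have kE : nilindex h = k.+1 by rewrite /k prednK // (nilindex_gt0 D_add).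
  have hk : iter k D h != 0 by rewrite (nilindexP D_add D_nilpotent) kE ltnn.
  have hk1 : D (iter k D h) = 0 by apply/eqP;
    rewrite -iterS (nilindexP D_add D_nilpotent) kE.
  have Ghom w e : w \in torus_weights grp l -> (forall i, whomog w (w i + e) (p i)) ->
      whomog w (wdeg w (block 0) + k%:Z * e) (iter k (vder p) G).
    move=> ww he; apply: whomog_iter => // m; rewrite mcoeffD !mcoeffZ !mcoeffX.
    case: (block 0 =P m) => [<- //|_]; case: (block 1 =P m) => [<- _|_].
      exact: wdeg_block.
    by rewrite !mulr0 addr0 eqxx.
  rewrite -hG iter_D_pi in hk hk1.
  have [|c [m [gm gE Dm]]] := kernel_homog hk hk1.
    move=> m m' hm hm' w ww; have [e he] := p_homog ww.
    by rewrite (Ghom w e ww he m) // (Ghom w e ww he m').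
  exists k, c, m; split=> //; first by rewrite -hG iter_D_pi.
    by apply: contraNneq hk => c0; rewrite gE c0 rmorph0 mul0r.
  by move=> w e ww he; exact: Ghom.
(* the weight of the terms is L, and each application of D adds e *)
pose om := triple_weight l (x 0) (x 1) (x 2).
have omw : om \in torus_weights grp l by exact: triple_weight_in.
have [e he] := p_homog omw.
pose L := (l (x 0%R) * l (x 1%R) * l (x 2%R))%N.
have L_gt0 : (0 < L)%N by rewrite !muln_gt0 !l_gt0.
have kL k m : D (pi 'X_[m]) = 0 -> wdeg om m = wdeg om (block 0) + k%:Z * e ->
    L%:Z + k%:Z * e = 0.
  move=> Dm; rewrite wdeg_triple_block // wdeg_triple !(Dx0 m) // !muln0 => <- //.
have [|k0 [c0 [m0 [E0 c00 Dm0 H0]]]] := @last_der 1 0.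
  by rewrite xpair_eqE oner_eq0.
have [|k1 [c1 [m1 [E1 c10 Dm1 H1]]]] := @last_der 0 1.
  by rewrite xpair_eqE oner_eq0 andbF.
rewrite rmorph1 rmorph0 mul1r mul0r addr0 in E0.
rewrite rmorph1 rmorph0 mul1r mul0r add0r in E1.
have [|k2 [c2 [m2 [E2 c20 Dm2 H2]]]] := @last_der c1 (- c0).
  by rewrite xpair_eqE (negbTE c10).
have K0 := kL _ _ Dm0 (H0 _ _ omw he).
have K1 := kL _ _ Dm1 (H1 _ _ omw he).
have K2 := kL _ _ Dm2 (H2 _ _ omw he).
have k10 : k1 = k0 by nia.
have k20 : k2 = k0 by nia.
have m10 : m1 = m0.
  have [|kk _ kkE] := same_degree_diff l_gt0 N_gt1 lN ufd_coprime_blocks (m :=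
    m1) (m' := m0).
    by move=> w ww; have [e' he'] := p_homog ww; rewrite (H0 w e') // (H1 w e') // k10.
  apply/mnmP => j; have := kkE j; have := kkE (x (grp j)).
  rewrite !Dx0 // gx subrr => /esym/eqP; rewrite mulf_eq0 => /orP[/eqP -> |].
    by rewrite mul0r; lia.
  by have := l_gt0 (x (grp j)); lia.
case/eqP: (monomial_neq0 m2); apply: (phi_cancel c20); rewrite -E2 k20.
rewrite iter_derD ?iter_der_mull //; try exact: D_add; try exact: D_mul; try exact: D_phi.
rewrite E0 -{1}k10 E1 m10 rmorphN; ring.
Qed.

End CoordinateRing.

(** * Polynomial curves *)

Section PolynomialCurves.
Variables (K : closedFieldType) (n : nat).
Hypothesis charK : [pchar K] =i pred0.
Implicit Types (p q r : {mpoly K[n]}) (v : 'I_n -> K) (g : 'I_n -> {poly K}).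

Lemma mpoly_ring_ind (P : {mpoly K[n]} -> Prop) :
  (forall c, P c%:MP) -> (forall i, P 'X_i) ->
  (forall p q, P p -> P q -> P (p + q)) -> (forall p q, P p -> P q -> P (p * q)) ->
  forall p, P p.
Proof.
move=> PC PX PD PM p; rewrite [p]mpolyE.
apply: big_ind => [|//|m _]; first by rewrite -(mpolyC0 n).
rewrite -mul_mpolyC mpolyXE_id; apply: (PM) => //.
apply: big_ind => [|//|i _]; first by rewrite -(mpolyC1 n).
elim: (m i) => [|k IH]; first by rewrite expr0 -(mpolyC1 n).
by rewrite exprS; exact: PM.
Qed.

Lemma natr_neq0 k : k.+1%:R != 0 :> K.
Proof. by have /pcharf0P -> := charK. Qed.

Lemma poly_vanish (q : {poly K}) : (forall x, q.[x] = 0) -> q = 0.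
Proof.
move=> h; apply/eqP/negPn/negP => q0.
have us : uniq [seq i%:R : K | i <- iota 0 (size q)].
  rewrite map_inj_uniq ?iota_uniq // => i j.
  wlog ij : i j / (i <= j)%N.
    by move=> W; case: (leqP i j) => [/W//|/ltnW ji e]; apply/esym/W.
  move/esym/eqP; rewrite -subr_eq0 -natrB //; have /pcharf0P -> := charK.
  by rewrite subn_eq0 => ji; apply/eqP; rewrite eqn_leq ij.
have ar : all (root q) [seq i%:R : K | i <- iota 0 (size q)].
  by apply/allP => x _; apply/rootP.
by have := max_poly_roots q0 ar us; rewrite size_map size_iota ltnn.
Qed.

Lemma poly_vanish_off (b q : {poly K}) : b != 0 ->
  (forall x, b.[x] != 0 -> q.[x] = 0) -> q = 0.
Proof.
move=> b0 h; have /eqP : b * q = 0.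
  apply: poly_vanish => x; rewrite hornerM.
  by have [->|/h ->] := eqVneq b.[x] 0; rewrite ?mul0r ?mulr0.
by rewrite mulf_eq0 (negbTE b0) => /eqP.
Qed.

Lemma deriv_eq0 (q : {poly K}) : q^`() = 0 -> q = (q`_0)%:P.
Proof.
move=> h; apply/polyP => -[|k]; rewrite coefC //=.
have := coef_deriv q k; rewrite h coef0 => /esym/eqP.
by rewrite -mulr_natr mulf_eq0 (negbTE (natr_neq0 k)) orbF => /eqP.
Qed.

Definition along g p : {poly K} := mmap (@polyC K) g p.

Lemma alongD g : {morph along g : p q / p + q}.
Proof. exact: mmapD. Qed.

Lemma alongM g : {morph along g : p q / p * q}.
Proof. exact: rmorphM. Qed.

Lemma alongC g c : along g c%:MP = c%:P.
Proof. exact: mmapC. Qed.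

Lemma alongX g i : along g 'X_i = g i.
Proof. by rewrite /along mmapX mmap1U. Qed.

Lemma horner_along g p x : (along g p).[x] = p.@[fun i => (g i).[x]].
Proof.
elim/mpoly_ring_ind: p => [c|i|p q hp hq|p q hp hq].
- by rewrite alongC mevalC hornerC.
- by rewrite alongX mevalXU.
- by rewrite alongD mevalD hornerD hp hq.
- by rewrite alongM mevalM hornerM hp hq.
Qed.

Lemma deriv_along g p :
  (along g p)^`() = \sum_i along g p^`M(i) * (g i)^`().
Proof.
elim/mpoly_ring_ind: p => [c|i|p q hp hq|p q hp hq].
- by rewrite alongC derivC big1 // => i _; rewrite mderivC alongC mul0r.
- rewrite alongX (bigD1 i) //= big1 ?addr0 => [|j ji]; rewrite mderivX mnm1E.
    rewrite eqxx scale1r -{1}[U_(i)%MM]add0m addmK mpolyX0.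
    by rewrite -(mpolyC1 n) alongC mul1r.
  by rewrite eq_sym (negbTE ji) scale0r -(mpolyC0 n) alongC mul0r.
- rewrite alongD derivD hp hq -big_split; apply: eq_bigr => i _.
  by rewrite mderivD alongD mulrDl.
- rewrite alongM derivM hp hq mulr_suml mulr_sumr -big_split; apply: eq_bigr => i _ /=.
  by rewrite mderivM alongD !alongM; ring.
Qed.

Lemma horner_deriv_along g p x : (along g p)^`().[x] =
  \sum_i p^`M(i).@[fun i => (g i).[x]] * (g i)^`().[x].
Proof.
rewrite deriv_along horner_sum; apply: eq_bigr => i _.
by rewrite hornerM horner_along.
Qed.

Lemma meval_zero p : p.@[fun=> 0] = p@_0%MM.
Proof.
elim/mpolyind: p => [|c m p _ _ IH]; first by rewrite meval0 mcoeff0.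
rewrite mevalD mevalZ IH mcoeffD mcoeffZ mcoeffX mevalX; congr (_ * _ + _).
have [->|m0] := eqVneq m 0%MM; first by rewrite big1 // => i _; rewrite mnm0E.
have /existsP[i mi] : [exists i, m i != 0%N].
  apply: contraNT m0 => /existsPn no; apply/eqP/mnmP => i; rewrite mnm0E.
  by apply/eqP; move: (no i); rewrite negbK.
by rewrite (bigD1 i) //= expr0n (negbTE mi) mul0r.
Qed.

(** In characteristic zero, if a polynomial vanishes everywhere, so do its
    partial derivatives, and hence its Taylor coefficients at the origin. *)
Lemma mpoly_vanish p : (forall v, p.@[v] = 0) -> p = 0.
Proof.
move=> h; apply/mpolyP => m; rewrite mcoeff0.
have [d] := ubnP (mdeg m); elim: d m p h => // d IH m p h md.
have [->|m0] := eqVneq m 0%MM; first by rewrite -meval_zero.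
have /existsP[i mi] : [exists i, m i != 0%N].
  apply: contraNT m0 => /existsPn no; apply/eqP/mnmP => i; rewrite mnm0E.
  by apply/eqP; move: (no i); rewrite negbK.
have mE : m = ((m - U_(i)) + U_(i))%MM by rewrite submK // lep1mP.
have : p^`M(i)@_(m - U_(i)) = 0.
  apply: IH => [v|]; last by move: md; rewrite {1}mE mdegD mdeg1; lia.
  pose g j : {poly K} := (v j)%:P + (j == i)%:R *: 'X.
  have : along g p = 0 by apply: poly_vanish => x; rewrite horner_along.
  move/(congr1 (fun q : {poly K} => q^`().[0]));
    rewrite horner_deriv_along deriv0 horner0.
  rewrite (bigD1 i) //= big1 ?addr0 => [|j ji];
    rewrite /g derivD derivC derivZ derivX add0r.
    rewrite eqxx scale1r hornerC mulr1 => <-; apply: meval_eq => j.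
    by rewrite hornerD hornerC hornerZ hornerX mulr0 addr0.
  by rewrite (negbTE ji) scale0r horner0 mulr0.
rewrite mcoeff_deriv -mE => /eqP; rewrite -mulr_natr mulf_eq0 (negbTE (natr_neq0 _)) orbF.
by move/eqP.
Qed.

Definition upd v j x : 'I_n -> K := fun i => if i == j then x else v i.

Lemma meval_upd p v j x : (forall m, p@_m != 0 -> m j = 0%N) ->
  p.@[upd v j x] = p.@[v].
Proof.
move=> h; rewrite !mevalE; apply: eq_big_seq => m; rewrite mcoeff_msupp => /h mj.
congr (_ * _); apply: eq_bigr => i _; rewrite /upd.
by case: (i =P j) => // ->; rewrite mj !expr0.
Qed.

Lemma distinct_roots k (c : K) : c != 0 -> exists s : seq K,
  [/\ uniq s, size s = k.+1 & {in s, forall y, y ^+ k.+1 = c}].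
Proof.
move=> c0; have [|y yc] := closed_rootP ('X^(k.+1) - c%:P : {poly K}) _.
  by rewrite size_XnsubC.
move: yc; rewrite rootE !hornerE subr_eq0 => /eqP yc.
have y0 : y != 0 by apply: contraNneq c0 => y0; rewrite -yc y0 expr0n.
have [s sE] := closed_field_poly_normal ('X^(k.+1) - 1 : {poly K}).
have lc : lead_coef ('X^(k.+1) - 1 : {poly K}) = 1 by apply/eqP/monicXnsubC.
rewrite lc scale1r in sE.
have us : uniq s.
  by rewrite -separable_prod_XsubC -sE separable_Xn_sub_1 // natr_neq0.
exists [seq y * z | z <- s]; split.
- by rewrite map_inj_uniq // => a b /(mulfI y0).
- have := size_XnsubC (1 : K) (ltn0Sn k);
  rewrite size_map polyC1 sE size_prod_XsubC => -[].
  by [].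
move=> _ /mapP[z zs ->]; rewrite exprMn yc.
have : root ('X^(k.+1) - 1) z by rewrite sE root_prod_XsubC.
by rewrite rootE !hornerE subr_eq0 => /eqP ->; rewrite mulr1.
Qed.

End PolynomialCurves.

(** * The Nullstellensatz for a trinomial *)

Section Nullstellensatz.
Variables (K : closedFieldType) (n : nat).
Hypothesis charK : [pchar K] =i pred0.
Variables (grp : 'I_n -> 'I_3) (l : 'I_n -> nat) (N : nat).
Hypothesis l_gt0 : forall j, (0 < l j)%N.
Hypothesis N_gt1 : (1 < N)%N.
Hypothesis lN : forall i, (\sum_(j | grp j == i) l j)%N = N.
Notation block := (block grp l).
Notation f := (trinom K grp l).
Hypothesis f_prime : forall p q, divides f (p * q) -> divides f p \/ divides f q.
Implicit Types (p q r : {mpoly K[n]}) (m : 'X_{1..n}).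

(** A variable x of the third term is eliminated down to degree less than its
    exponent k, at the cost of a power of its cofactor u; over a point where u
    and the sum of the other two terms do not vanish there are k values of x on
    the hypersurface, so the remainder vanishes there. *)
Lemma trinom_nullstellensatz p :
  (forall v, f.@[v] = 0 -> p.@[v] = 0) -> divides f p.
Proof.
move=> pX; have [x gx] := group_nonempty N_gt1 lN 2.
pose k := l x; pose mu := (block 2 - U_(x) *+ k)%MM.
pose u : {mpoly K[n]} := 'X_[mu]; pose b : {mpoly K[n]} := 'X_[block 0] + 'X_[block 1].
have muE : block 2 = (U_(x) *+ k + mu)%MM.
  rewrite addmC submK //; apply/mnm_lepP => j; rewrite mulmnE !mnmE.
  by case: (x =P j) => // <-; rewrite gx mul1n.
have fE : f = 'X_x ^+ k * u + b.
  by rewrite /trinom big_ord3 /= /u mpolyXn -mpolyXD -muE /b addrA addrC.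
have mux : mu x = 0%N by rewrite mnmBE mulmnE !mnmE gx !eqxx mul1n subnn.
have b0x : block 0 x = 0%N by rewrite mnmE gx.
have b1x : block 1 x = 0%N by rewrite mnmE gx.
pose red q := exists e r, divides f (u ^+ e * q - r) /\ forall m, r@_m != 0 ->
  (m x < k)%N.
have ux e q : (forall m, q@_m != 0 -> (m x < k)%N) ->
    forall m, (u ^+ e * q)@_m != 0 -> (m x < k)%N.
  move=> hq m; rewrite /u mpolyXn => /mcoeffM_neq0[m1 [m2 [-> + /hq]]].
  rewrite mcoeffX; case: (_ =P m1) => [<- _|_]; last by rewrite eqxx.
  by rewrite mnmDE mulmnE mux.
have redD q1 q2 : red q1 -> red q2 -> red (q1 + q2).
  move=> [e1 [r1 [d1 s1]]] [e2 [r2 [d2 s2]]].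
  exists (e1 + e2)%N, (u ^+ e2 * r1 + u ^+ e1 * r2); split.
    have -> : u ^+ (e1 + e2) * (q1 + q2) - (u ^+ e2 * r1 + u ^+ e1 * r2) =
      u ^+ e2 * (u ^+ e1 * q1 - r1) + u ^+ e1 * (u ^+ e2 * q2 - r2).
      by rewrite exprD; ring.
    by apply: dividesD; apply: dividesMl.
  move=> m; rewrite mcoeffD; have [->|h1 _] := eqVneq (u ^+ e2 * r1)@_m 0.
    by rewrite add0r; exact: (ux _ _ s2).
  exact: (ux _ _ s1 _ h1).
have redZ c q : red q -> red (c *: q).
  move=> [e [r [d s]]]; exists e, (c *: r); split.
    rewrite -scalerAr -scalerBr -mul_mpolyC; exact: dividesMl.
  move=> m; rewrite mcoeffZ mulf_eq0 negb_or => /andP[_]; exact: s.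
have redX m : red 'X_[m].
  have [d] := ubnP (m x); elim: d m => // d IH m md.
  have [mk|mk] := ltnP (m x) k.
    exists 0%N, 'X_[m]; rewrite mul1r subrr; split; first exact: divides0.
    by move=> m'; rewrite mcoeffX; case: (m =P m') => [<-|_] //; rewrite eqxx.
  pose m' := (m - U_(x) *+ k)%MM.
  have m'x : m' x = (m x - k)%N by rewrite mnmBE mulmnE mnmE eqxx mul1n.
  have mE : m = (U_(x) *+ k + m')%MM.
    rewrite addmC submK //; apply/mnm_lepP => j; rewrite mulmnE !mnmE.
    by case: (x =P j) => // <-; rewrite mul1n.
  have [e [r [dr sr]]] : red (b * 'X_[m']).
    rewrite mulrDl -!mpolyXD; apply: (redD); apply: IH; rewrite mnmDE.
      by rewrite b0x m'x; have := l_gt0 x; rewrite -/k; lia.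
    by rewrite b1x m'x; have := l_gt0 x; rewrite -/k; lia.
  exists e.+1, (- r); split; last by move=> m0; rewrite mcoeffN oppr_eq0; exact: sr.
  have -> : u ^+ e.+1 * 'X_[m] - (- r) = u ^+ e * 'X_[m'] * f - (u ^+ e * (b * 'X_[m'])
    - r).
    by rewrite mE mpolyXD -mpolyXn fE exprS; ring.
  by apply: dividesB => //; exists (u ^+ e * 'X_[m']).
have red0 : red 0.
  exists 0%N, 0; rewrite mulr0 subrr; split; first exact: divides0.
  by move=> m; rewrite mcoeff0 eqxx.
have [e [r [dr sr]]] : red p.
  rewrite [p]mpolyE; apply: (big_ind red) => // m _; apply: (redZ); exact: redX.
have u0 : u != 0 by rewrite -msupp_eq0 msuppX.
have b0 : b != 0.
  have b01 : block 1 != block 0 by rewrite (inj_eq (block_inj l_gt0 N_gt1 lN)).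
  apply/negP => /eqP/(congr1 (mcoeff (block 0))); rewrite mcoeffD !mcoeffX eqxx.
  by rewrite (negbTE b01) addr0 mcoeff0 => /eqP; rewrite oner_eq0.
(* at a point with u and b nonzero, r is a polynomial of degree less than k in x
   with the k roots of the trinomial *)
have ub : r * (u * b) = 0.
  apply: mpoly_vanish => // v; rewrite !mevalM.
  have [->|uv0] := eqVneq u.@[v] 0; first by rewrite mul0r mulr0.
  have [->|bv0] := eqVneq b.@[v] 0; first by rewrite !mulr0.
  have c0 : - b.@[v] / u.@[v] != 0 by rewrite mulf_neq0 ?oppr_eq0 ?invr_eq0.
  have [s [us szs sc]] := distinct_roots charK k.-1 c0.
  rewrite prednK in szs sc; last exact: l_gt0.
  pose g i : {poly K} := if i == x then 'X else (v i)%:P.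
  have gE y : (fun i => (g i).[y]) =1 upd v x y.
    by move=> i; rewrite /g /upd; case: eqP => _; rewrite ?hornerX ?hornerC.
  pose q := along g r.
  have qs : (size q <= k)%N.
    rewrite /q /along /mmap; apply: leq_trans (size_sum _ _ _) _.
    apply/bigmax_leqP_seq => m; rewrite mcoeff_msupp => /sr mk _.
    rewrite /mmap1 (bigD1 x) //= /g eqxx mul_polyC.
    apply: leq_trans (size_scale_leq _ _) _.
    have -> : \prod_(i < n | i != x) (if i == x then 'X else (v i)%:P) ^+ m i =
       (\prod_(i < n | i != x) v i ^+ m i)%:P :> {poly K}.
      rewrite rmorph_prod; apply: eq_bigr => i /negbTE ->.
      by rewrite rmorphXn.
    rewrite mulrC mul_polyC; apply: leq_trans (size_scale_leq _ _) _.
    by rewrite size_polyXn.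
  have q0 : q = 0.
    apply/eqP/negPn/negP => q0; have ar : all (root q) s.
      apply/allP => y /sc yc; apply/rootP; rewrite horner_along (meval_eq _ (gE y)).
      have fy : f.@[upd v x y] = 0.
        have ubx : u.@[upd v x y] = u.@[v] /\ b.@[upd v x y] = b.@[v].
          split; apply: meval_upd => m; rewrite ?mcoeffD !mcoeffX.
            by case: (mu =P m) => [<-|]; rewrite ?eqxx.
          case: (block 0 =P m) => [<- //|_]; case: (block 1 =P m) => [<- //|_].
          by rewrite addr0 eqxx.
        rewrite fE mevalD mevalM rmorphXn /= mevalXU {1}/upd eqxx yc !ubx.1 ubx.2.
        by rewrite mulfVK // addNr.
      have [h hE] := dr; have := congr1 (meval (upd v x y)) hE.
      rewrite mevalB !mevalM (pX _ fy) fy !mulr0 sub0r => /eqP.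
      by rewrite oppr_eq0 => /eqP.
    by have := max_poly_roots q0 ar us; rewrite szs ltnNge qs.
  have := congr1 (fun q : {poly K} => q.[v x]) q0; rewrite horner_along horner0.
  rewrite (meval_eq _ (gE _)) (meval_eq _ (v2 := v)) => [->|i]; first by rewrite mul0r.
  by rewrite /upd; case: eqP => // ->.
have r0 : r = 0.
  by move/eqP: ub; rewrite !mulf_eq0 (negbTE u0) (negbTE b0) !orbF => /eqP.
rewrite r0 subr0 in dr.
have nu : ~ divides f u.
  move=> fu; have : u@_mu != 0 by rewrite mcoeffX eqxx oner_eq0.
  move/(divides_low_degree lN fu).
  have := mdeg_block lN 2; rewrite muE mdegD mdegMn mdeg1 mul1n.
  by have := l_gt0 x; rewrite -/k; lia.
elim: e dr => [|e IH]; first by rewrite mul1r.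
by rewrite exprS -mulrA => /f_prime[/nu|/IH].
Qed.

End Nullstellensatz.

(** * Points of projective space and polynomial vectors *)

Lemma meval_homog (K : fieldType) n d (p : {mpoly K[n]}) (c : K) (v : 'rV[K]_n) :
  p \is d.-homog -> p.@[(c *: v) ord0] = c ^+ d * p.@[v ord0].
Proof.
move=> /dhomogP h; rewrite !mevalE mulr_sumr; apply: eq_big_seq => m ms.
have hd : mdeg m = d := h m ms.
rewrite mulrCA; congr (_ * _); rewrite -hd mdegE expr_sum -big_split.
by apply: eq_bigr => i _ /=; rewrite mxE exprMn.
Qed.

Section Lines.
Variables (K : fieldType) (n : nat) (L0 : proj_point K n).

(** L0 is a default value, used at the origin. *)
Definition line_of (v : 'rV[K]_n) : proj_point K n := insubd
  (L0 : {L : {vspace 'rV[K]_n} | \dim L == 1%N}) <[v]>%VS.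

Lemma val_line_of v : v != 0 -> val (line_of v) = <[v]>%VS.
Proof. by move=> v0; rewrite val_insubd dim_vline v0. Qed.

Lemma mem_line_of v : v != 0 -> v \in val (line_of v).
Proof. by move=> v0; rewrite val_line_of // memv_line. Qed.

Lemma line_of_uniq v (L : proj_point K n) : v != 0 -> v \in val L -> line_of v = L.
Proof.
move=> v0 vL; apply: val_inj; rewrite val_line_of //; apply/eqP.
by rewrite eqEdim -memvE vL dim_vline v0 (eqP (valP L)).
Qed.

Lemma line_point (L : proj_point K n) : exists2 v, v != 0 & v \in val L.
Proof.
exists (vpick (val L)); last exact: memv_pick.
by rewrite vpick0 -dimv_eq0 (eqP (valP L)).
Qed.

Lemma line_prop v w (L : proj_point K n) : v != 0 -> v \in val L -> w \in val L ->
  exists c, w = c *: v.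
Proof. by move=> v0 vL; rewrite -(line_of_uniq v0 vL) val_line_of // => /vlineP. Qed.

Lemma line_of_scale c v : c != 0 -> v != 0 -> line_of (c *: v) = line_of v.
Proof.
move=> c0 v0; apply: line_of_uniq; first by rewrite scaler_eq0 negb_or c0.
by apply: memvZ; exact: mem_line_of.
Qed.

End Lines.

Lemma homog_mem (K : fieldType) n (p : {mpoly K[n]}) (L : proj_point K n) (v : 'rV[K]_n) :
  homogeneous_poly p -> v != 0 -> v \in val L ->
  (forall w : 'rV_n, w \in val L -> p.@[w ord0] = 0) <-> p.@[v ord0] = 0.
Proof.
move=> [d hp] v0 vL; split=> [|e w /(line_prop L v0 vL)[c ->]]; first by apply.
by rewrite (meval_homog _ _ hp) e mulr0.
Qed.

Section PolynomialVectors.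
Variables (K : closedFieldType) (n : nat).
Implicit Types (P g : 'I_n -> {poly K}).

Definition point_at g t : 'rV[K]_n := \row_i (g i).[t].

Lemma at_neq0 g t : point_at g t != 0 <-> exists i, (g i).[t] != 0.
Proof.
split=> [h|[i gi]].
  apply: contrapT => no; case/eqP: h; apply/rowP => i; rewrite !mxE.
  by apply/eqP/negPn/negP => gi; apply: no; exists i.
by apply: contraNneq gi => /rowP/(_ i); rewrite !mxE => ->.
Qed.

Lemma coprime_part P j : P j != 0 -> exists mu g,
  [/\ forall i, P i = mu * g i & forall t, point_at g t != 0].
Proof.
have [N] := ubnP (size (P j)); elim: N P => // N IH P PN Pj.
have [[t ht]|no] := pselect (exists t, forall i, (P i).[t] = 0); last first.
  exists 1, P; split=> [i|t]; first by rewrite mul1r.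
  apply/at_neq0; apply: contrapT => h; apply: no; exists t => i.
  by apply/eqP/negPn/negP => Pi; apply: h; exists i.
have /choice[P' P'E] : forall i, exists q, P i = q * ('X - t%:P).
  by move=> i; apply/factor_theorem/rootP.
have P'j : P' j != 0 by apply: contraNneq Pj; rewrite P'E => ->; rewrite mul0r.
have [|mu [g [e ng]]] := IH P' _ P'j.
  by move: PN; rewrite P'E size_Mmonic ?monicXsubC // size_XsubC addn2.
by exists (('X - t%:P) * mu), g; split=> // i; rewrite P'E e mulrC mulrA.
Qed.

(** At a root of g i some other component of g survives, so by proportionality
    the root is also one of P i; the roots of g i are cancelled one by one. *)
Lemma proportional g P : (forall t, point_at g t != 0) ->
  (forall i j, g i * P j = g j * P i) -> exists mu, forall i, P i = mu * g i.
Proof.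
move=> ng e; have [i gi] : exists i, g i != 0.
  have /at_neq0[i gi] := ng 0; exists i.
  by apply: contraNneq gi => ->; rewrite horner0.
have key N (D M : {poly K}) : (size D < N)%N -> D != 0 ->
    (forall j, D * P j = g j * M) -> exists mu, M = D * mu.
  elim: N D M => // N IH D M DN D0 h.
  have [D1|D1] := eqVneq (size D) 1%N.
    move/eqP/size_poly1P: D1 => [c c0 ->]; exists ((c^-1)%:P * M).
    by rewrite mulrA -polyCM divff // mul1r.
  have [t /rootP Dt] := closed_rootP D D1; have /at_neq0[j gj] := ng t.
  have Mt : M.[t] = 0.
    have := congr1 (fun q : {poly K} => q.[t]) (h j); rewrite /= !hornerM Dt mul0r.
    by move/esym/eqP; rewrite mulf_eq0 (negbTE gj) => /eqP.
  have /factor_theorem[D' DE] : root D t by apply/rootP.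
  have /factor_theorem[M' ME] : root M t by apply/rootP.
  have X0 : 'X - t%:P != 0 :> {poly K} by rewrite polyXsubC_eq0.
  have [|||mu muE] := IH D' M'.
  - by move: DN; rewrite DE size_Mmonic ?monicXsubC // ?size_XsubC ?addn2 //;
    apply: contraNneq D0; rewrite DE => ->; rewrite mul0r.
  - by apply: contraNneq D0; rewrite DE => ->; rewrite mul0r.
  - by move=> a; apply: (mulIf X0); rewrite mulrAC -DE h ME mulrA.
  by exists mu; rewrite ME muE DE mulrAC.
have [mu muE] := key _ _ _ (ltnSn _) gi (fun j => e i j).
by exists mu => j; apply: (mulfI gi); rewrite e muE; ring.
Qed.

Lemma nowhere_zero_const (q : {poly K}) : (forall t, q.[t] != 0) -> q = (q.[0])%:P.
Proof.
move=> h; have [s1|s1] := leqP (size q) 1.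
  by rewrite {1}(size1_polyC s1) [q in q.[0]](size1_polyC s1) hornerC.
have [|t /rootP qt] := closed_rootP q _; first by rewrite gtn_eqF.
by move: (h t); rewrite qt eqxx.
Qed.

Lemma zero_free_monomial (q : {poly K}) : (forall t, t != 0 -> q.[t] != 0) ->
  exists k c, q = c *: 'X^k.
Proof.
have [N] := ubnP (size q); elim: N q => // N IH q qN h.
have [q0|q0] := eqVneq q.[0] 0; last first.
  exists 0%N, q.[0]; rewrite expr0 alg_polyC; apply: nowhere_zero_const => t.
  by have [->|/h] := eqVneq t 0.
have /factor_theorem[q' qE] : root q 0 by apply/rootP.
rewrite subr0 in qE; have q'0 : q' != 0.
  by apply: contraTneq (h 1 (oner_neq0 _)) => q'0; rewrite qE q'0 mul0r horner0 eqxx.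
have [||k [c cE]] := IH q'; first by move: qN; rewrite qE size_mulX.
  by move=> t t0; apply: contraNneq (h t t0); rewrite qE hornerM => ->; rewrite mul0r.
by exists k.+1, c; rewrite qE cE -scalerAl exprSr.
Qed.

Lemma size_along (g : 'I_n -> {poly K}) (p : {mpoly K[n]}) :
  (forall i, size (g i) <= 2)%N -> (size (along g p) <= msize p)%N.
Proof.
move=> h; rewrite /along /mmap; apply: leq_trans (size_sum _ _ _) _.
apply/bigmax_leqP_seq => m mp _; rewrite mul_polyC.
apply: leq_trans (size_scale_leq _ _) _; apply: leq_trans (msize_mdeg_lt mp).
have mulS (q q' : {poly K}) a b : (size q <= a.+1 -> size q' <= b.+1 ->
  size (q * q')%R <= (a + b).+1)%N.
  by move=> h1 h2; apply: leq_trans (size_polyMleq _ _) _; lia.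
rewrite mdegE /mmap1; apply: (big_ind2 (fun (q : {poly K}) a => (size q <= a.+1)%N)).
- by rewrite size_poly1.
- by move=> q a q' b; exact: mulS.
move=> i _; elim: (m i) => [|k IH]; first by rewrite expr0 size_poly1.
by rewrite exprS; exact: (mulS _ _ 1%N k).
Qed.

End PolynomialVectors.

(** * The vector field of a cylinder *)

Section Cylinder.
Local Open Scope classical_set_scope.
Variables (K : closedFieldType) (n : nat) (f : {mpoly K[n]}).
Hypothesis charK : [pchar K] =i pred0.
Hypothesis f_homog : homogeneous_poly f.
Hypothesis nullstellensatz : forall p : {mpoly K[n]},
  (forall v, f.@[v] = 0 -> p.@[v] = 0) -> divides f p.
Variables (R : comNzRingType) (pi : {rmorphism {mpoly K[n]} -> R}).
Hypothesis pi_surj : forall x, exists p, pi p = x.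
Hypothesis pi_ker : forall p, pi p = 0 <-> divides f p.
Hypothesis ufd : unique_factorization_domain R.

Let Q : set (proj_space K n) := proj_hypersurface f.
Variables (S : set {mpoly K[n]}) (m : nat) (Z : set (affine_space K m)).
Let U : set (proj_space K n) := Q `\` proj_zeros S.
Let Y : set (affine_space K (m + 1)) := times_line Z.
Variables (h : proj_space K n -> affine_space K (m + 1))
  (k : affine_space K (m + 1) -> proj_space K n).
Hypothesis S_homog : forall p, S p -> homogeneous_poly p.
Hypothesis h_mor : morphism U Y h.
Hypothesis k_mor : morphism Y U k.
Hypothesis hk : forall x, U x -> k (h x) = x.
Hypothesis kh : forall y, Y y -> h (k y) = y.
Variable y0 : affine_space K (m + 1).
Hypothesis Yy0 : Y y0.

Implicit Types (p q G H : {mpoly K[n]}) (v : 'rV[K]_n) (y : 'rV[K]_(m + 1)).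
Notation ev p v := (meval ((v : 'rV_ _) ord0) p).
Notation line_of := (line_of (k y0)).

(** The punctured affine cone over the open set U. *)
Definition cone v : Prop := v != 0 /\ U (line_of v).

Lemma coneE v : cone v <-> [/\ v != 0, ev f v = 0 & exists2 s, S s & ev s v != 0].
Proof.
split=> [[v0 [Qv Cv]]|[v0 fv [s Ss sv]]].
  split=> //; first by apply: (Qv f erefl); exact: mem_line_of.
  apply: contrapT => no; apply: Cv => s Ss.
  apply/(homog_mem (S_homog Ss) v0 (mem_line_of _ v0)).
  by apply/eqP/negPn/negP => sv; apply: no; exists s.
split=> //; split=> [p -> | Cv].
  exact/(homog_mem f_homog v0 (mem_line_of _ v0)).
by case/eqP: sv; apply: Cv (mem_line_of _ v0).
Qed.

Lemma cone_open v : cone v -> exists2 q, ev q v != 0 &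
  forall w, ev f w = 0 -> ev q w != 0 -> cone w.
Proof.
move=> /coneE[v0 fv [s Ss sv]]; have [i vi] : exists i, v ord0 i != 0.
  apply: contrapT => no; case/eqP: v0; apply/rowP => i; rewrite mxE.
  by apply/eqP/negPn/negP => vi; apply: no; exists i.
exists (s * 'X_i); first by rewrite mevalM mevalXU mulf_neq0.
move=> w fw; rewrite mevalM mevalXU mulf_eq0 negb_or => /andP[sw wi].
by apply/coneE; split=> //; [apply: contraNneq wi => ->; rewrite mxE|exists s].
Qed.

Lemma cone_scale c v : c != 0 -> cone v -> cone (c *: v).
Proof.
move=> c0 [v0 Uv]; split; first by rewrite scaler_eq0 negb_or c0.
by rewrite line_of_scale.
Qed.

Lemma f_prime p q : divides f (p * q) -> divides f p \/ divides f q.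
Proof.
by move/pi_ker; rewrite rmorphM => /(ufd_domain ufd)[] /pi_ker; [left|right].
Qed.

Lemma not_divides v p : cone v -> ev p v != 0 -> ~ divides f p.
Proof.
move=> /coneE[_ fv _] pv [q e]; case/eqP: pv.
by rewrite e mevalM fv mulr0.
Qed.

(** The hypersurface is irreducible, so its nonempty open subsets meet every other one. *)
Lemma cone_dense v0 H p : cone v0 -> ev H v0 != 0 ->
  (forall v, cone v -> ev H v != 0 -> ev p v = 0) -> divides f p.
Proof.
move=> cv0 Hv0 pH; have [q qv0 qopen] := cone_open cv0.
have : divides f (q * (H * p)).
  apply: nullstellensatz => v fv; rewrite !mevalM.
  pose w : 'rV_n := \row_i v i; have wE : w ord0 =1 v by move=> i; rewrite mxE.
  rewrite -!(meval_eq _ wE) in fv *.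
  have [->|qw] := eqVneq (ev q w) 0; first by rewrite mul0r.
  have [->|Hw] := eqVneq (ev H w) 0; first by rewrite mul0r mulr0.
  by rewrite pH ?mulr0 //; exact: qopen.
case/f_prime => [/(not_divides cv0 qv0)//|/f_prime[/(not_divides cv0 Hv0)//|//]].
Qed.

(** Functions on the cone that are a fraction of polynomials near a point;
    restricting to the open set where the denominator does not vanish loses no
    generality. *)
Definition frac_at v0 (psi : 'rV[K]_n -> K) : Prop := exists G H, ev H v0 != 0 /\
  forall v, cone v -> ev H v != 0 -> psi v = ev G v / ev H v.

Lemma frac_poly v0 p : frac_at v0 (fun v => ev p v).
Proof.
by exists p, 1; rewrite meval1 oner_neq0; split=> // v _ _; rewrite meval1 divr1.
Qed.

Lemma frac_cst v0 c : frac_at v0 (fun=> c).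
Proof.
by exists c%:MP, 1; rewrite meval1 oner_neq0; split=> // v _ _;
  rewrite mevalC meval1 divr1.
Qed.

Lemma frac_add v0 psi chi : frac_at v0 psi -> frac_at v0 chi ->
  frac_at v0 (fun v => psi v + chi v).
Proof.
move=> [G [H [H0 e]]] [G' [H' [H0' e']]]; exists (G * H' + G' * H), (H * H').
rewrite mevalM mulf_neq0 //; split=> // v cv.
rewrite mevalM mulf_eq0 negb_or => /andP[Hv Hv'].
by rewrite e // e' // mevalD !mevalM addf_div.
Qed.

Lemma frac_mul v0 psi chi : frac_at v0 psi -> frac_at v0 chi ->
  frac_at v0 (fun v => psi v * chi v).
Proof.
move=> [G [H [H0 e]]] [G' [H' [H0' e']]]; exists (G * G'), (H * H').
rewrite mevalM mulf_neq0 //; split=> // v cv.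
rewrite mevalM mulf_eq0 negb_or => /andP[Hv Hv'].
by rewrite e // e' // !mevalM mulf_div.
Qed.

Lemma frac_opp v0 psi : frac_at v0 psi -> frac_at v0 (fun v => - psi v).
Proof.
move=> [G [H [H0 e]]]; exists (- G), H; split=> // v cv Hv.
by rewrite e // mevalN mulNr.
Qed.

Lemma frac_inv v0 psi : cone v0 -> frac_at v0 psi -> psi v0 != 0 ->
  frac_at v0 (fun v => (psi v)^-1).
Proof.
move=> cv0 [G [H [H0 e]]] p0; exists (H * H), (G * H).
have G0 : ev G v0 != 0 by apply: contraNneq p0; rewrite e // => ->; rewrite mul0r.
rewrite !mevalM mulf_neq0 //; split=> // v cv.
rewrite mevalM mulf_eq0 negb_or => /andP[Gv Hv].
by rewrite e // invf_div mevalM -mulf_div divff // mulr1.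
Qed.

Lemma frac_sum v0 (I : Type) (r : seq I) (psi : I -> 'rV[K]_n -> K) :
  (forall i, frac_at v0 (psi i)) -> frac_at v0 (fun v => \sum_(i <- r) psi i v).
Proof.
move=> hpsi; elim: r => [|i r IH].
  by under eq_fun do rewrite big_nil; exact: frac_cst.
by under eq_fun do rewrite big_cons; exact: frac_add.
Qed.

Lemma frac_near v0 chi psi psi' : cone v0 -> frac_at v0 chi -> chi v0 != 0 ->
  (forall v, cone v -> chi v != 0 -> psi v = psi' v) -> frac_at v0 psi' -> frac_at v0 psi.
Proof.
move=> cv0 [A [B [B0 eAB]]] chi0 e [G [H [H0 eGH]]].
have A0 : ev A v0 != 0 by apply: contraNneq chi0; rewrite eAB // => ->; rewrite mul0r.
exists (G * (A * B)), (H * (A * B)); rewrite !mevalM !mulf_neq0 //; split=> // v cv.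
rewrite !mevalM !mulf_eq0 !negb_or => /and3P[Hv Av Bv].
rewrite e // ?eGH // ?eAB ?mulf_neq0 ?invr_eq0 //.
by rewrite -mulf_div divff ?mulr1 // mulf_neq0.
Qed.

Lemma frac_comp v0 (c : 'I_(m + 1) -> 'rV[K]_n -> K) (F : {mpoly K[m + 1]}) :
  (forall i, frac_at v0 (c i)) -> frac_at v0 (fun v => F.@[fun i => c i v]).
Proof.
move=> hc; elim/mpoly_ring_ind: F => [a|i|F F' hF hF'|F F' hF hF'].
- by under eq_fun do rewrite mevalC; exact: frac_cst.
- by under eq_fun do rewrite mevalXU; exact: hc.
- by under eq_fun do rewrite mevalD; exact: frac_add.
- by under eq_fun do rewrite mevalM; exact: frac_mul.
Qed.

(** In lowest terms, which exist by unique factorization, the denominator of one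
    local fraction divides those of all the others, hence vanishes nowhere. *)
Lemma frac_global v0 psi : cone v0 -> (forall v, cone v -> frac_at v psi) ->
  exists G H, forall v, cone v -> ev H v != 0 /\ psi v = ev G v / ev H v.
Proof.
move=> cv0 loc; have [G1 [H1 [H10 e1]]] := loc v0 cv0.
have nH1 := not_divides cv0 H10.
have [|gR [hR [hR0 eR low]]] := lowest_terms ufd (pi G1) (H := pi H1);
  first by move/pi_ker.
have [G GE] := pi_surj gR; have [H HE] := pi_surj hR.
have mulI := @ufd_mulfI _ ufd.
have H1R : pi H1 <> 0 by move/pi_ker.
exists G, H => v cv; have [G' [H' [H'v e']]] := loc v cv.
have HR : pi H' <> 0 by move/pi_ker; exact: not_divides cv H'v.
have e2 : pi (G1 * H') = pi (G' * H1).
  have /pi_ker : divides f (H1 * (H' * (G1 * H' - G' * H1))).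
    apply: (cone_dense cv0 (H := 1)); rewrite ?meval1 ?oner_neq0 // => w cw _.
    rewrite !mevalM mevalB !mevalM.
    have [->|Hw1] := eqVneq (ev H1 w) 0; first by rewrite mul0r.
    have [->|Hw'] := eqVneq (ev H' w) 0; first by rewrite mul0r mulr0.
    have := e1 w cw Hw1; rewrite e' // => /eqP; rewrite eqr_div // => /eqP ->.
    by rewrite subrr !mulr0.
  rewrite !rmorphM => /(ufd_domain ufd)[//|/(ufd_domain ufd)[//|/eqP]].
  by rewrite rmorphB subr_eq0 !rmorphM => /eqP.
have e3 : gR * pi H' = pi G' * hR.
  apply: (mulI _ H1R); rewrite mulrA [pi H1 * gR]mulrC -eR mulrAC -rmorphM e2 rmorphM.
  by rewrite -mulrA mulrCA.
have fv : ev f v = 0 by case/coneE: cv.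
have ev_eq p q : pi p = pi q -> ev p v = ev q v.
  move=> e; have [r rE] : divides f (p - q) by apply/pi_ker; rewrite rmorphB e subrr.
  by apply/eqP; rewrite -subr_eq0 -mevalB rE mevalM fv mulr0.
have Hv : ev H v != 0.
  have [c cE] := low _ _ e3; have [c' c'E] := pi_surj c.
  apply: contraNneq H'v => Hv0; rewrite (@ev_eq H' (c' * H));
    first by rewrite mevalM Hv0 mulr0.
  by rewrite rmorphM c'E HE.
split=> //; rewrite e' //; apply/eqP; rewrite eqr_div // -!mevalM; apply/eqP.
by apply: ev_eq; rewrite !rmorphM GE HE e3.
Qed.

Lemma frac_regular (phi : proj_space K n -> K) v : regular_on U phi -> cone v ->
  frac_at v (fun w => phi (line_of w)).
Proof.
move=> reg cv; have [v0 Uv] := cv.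
have [V [[C [S' S'h ->] ->] [Uv' Cv] [d [G [H [Gh Hh GH]]]]]] := reg _ Uv.
have [s S's sv] : exists2 s, S' s & ev s v != 0.
  apply: contrapT => no; apply: Cv => s S's.
  apply/(homog_mem (S'h _ S's) v0 (mem_line_of _ v0)).
  by apply/eqP/negPn/negP => sv; apply: no; exists s.
have inV w : cone w -> ev s w != 0 -> (U `\` proj_zeros S') (line_of w).
  move=> [w0 Uw] sw; split=> // Cw; case/eqP: sw.
  exact: Cw S's _ (mem_line_of _ w0).
have Hv : ev H v != 0 by case: (GH _ (inV v cv sv) v (mem_line_of _ v0) v0).
exists (G * s), (H * s); rewrite mevalM mulf_neq0 //; split=> // w cw.
rewrite !mevalM mulf_eq0 negb_or => /andP[Hw sw].
have [w0 _] := cw; have [_ ->] := GH _ (inV w cw sw) w (mem_line_of _ w0) w0.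
by rewrite -mulf_div divff // mulr1.
Qed.

Definition line_dir : 'rV[K]_(m + 1) := row_mx 0 1.

Lemma Y_line y t : Y y -> Y (y + t *: line_dir).
Proof.
rewrite /Y /times_line /= => Zy; have -> : lsubmx (y + t *: line_dir) = lsubmx y;
  last by [].
by rewrite linearD linearZ /= /line_dir row_mxKl scaler0 addr0.
Qed.

Definition last_coord : 'I_(m + 1) := rshift m ord0.

Lemma line_dir_last : line_dir ord0 last_coord = 1.
Proof. by rewrite /line_dir row_mxEr mxE eqxx. Qed.

Definition cylinder_coord i v : K := (h (line_of v) : 'rV_(m + 1)) ord0 i.

Lemma YhU v : cone v -> Y (h (line_of v)).
Proof. by case=> _ Uv; case: h_mor => hY _; exact: hY. Qed.

Lemma frac_coord v i : cone v -> frac_at v (cylinder_coord i).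
Proof.
move=> cv; pose ci (y : affine_space K (m + 1)) : K := (y : 'rV_(m + 1)) ord0 i.
have Yopen : open_in Y Y.
  exists set0; last by rewrite setD0.
  exists [set 1]; apply/esym; rewrite -subset0 => y /(_ 1 erefl)/eqP.
  by rewrite meval1 oner_eq0.
have creg : regular_on Y ci.
  move=> y Yy; exists Y; split=> //; exists 'X_i, 1 => z _.
  by rewrite meval1 oner_neq0 mevalXU divr1.
have [hY /(_ Y Yopen)[_ /(_ ci creg)]] := h_mor.
have -> : U `&` h @^-1` Y = U.
  by apply/seteqP; split=> [x []|x Ux] //; split=> //; exact: hY.
by move=> reg; exact: (@frac_regular (ci \o h)).
Qed.


Lemma proj_open_refl (A : set (proj_space K n)) : open_in A A.
Proof.
exists set0; last by rewrite setD0.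
exists [set 1] => [p ->|]; first by exists 0%N; exact: dhomog1.
apply/esym; rewrite -subset0 => L /(_ 1 erefl _ (memv_pick _))/eqP.
by rewrite meval1 oner_eq0.
Qed.

Lemma affine_zerosN (T : set {mpoly K[m + 1]}) y :
  ~ affine_zeros T y -> exists2 s, T s & ev s y != 0.
Proof.
move=> nT; apply: contrapT => no; apply: nT => s Ts.
by apply/eqP/negPn/negP => sy; apply: no; exists s.
Qed.

(** Homogeneous coordinates for k near a point: the quotients of the coordinate
    functions by one that does not vanish there pull back to fractions. *)
Lemma k_local y : Y y -> exists (G : 'I_n -> {mpoly K[m + 1]}) j,
  ev (G j) y != 0 /\
  forall z, Y z -> ev (G j) z != 0 -> (\row_i ev (G i) z) \in val (k z).
Proof.
move=> Yy; have [kU kopen] := k_mor; have Uy := kU y Yy.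
have [v v0 vL] := line_point (k y).
have [j vj] : exists j, v ord0 j != 0.
  apply: contrapT => no; case/eqP: v0; apply/rowP => i; rewrite mxE.
  by apply/eqP/negPn/negP => vi; apply: no; exists i.
have Xh : homogeneous_poly ('X_j : {mpoly K[n]}).
  by exists 1%N; rewrite dhomogX; apply/eqP; exact: mdeg1.
pose W : set (proj_space K n) := U `\` proj_zeros [set 'X_j].
have Wopen : open_in U W.
  by exists (proj_zeros [set 'X_j]) => //; exists [set 'X_j] => // p ->.
have Wj L w : W L -> w != 0 -> w \in val (L : proj_point K n) -> w ord0 j != 0.
  move=> [_ nW] w0 wL; apply: contra_notN nW => /eqP wj p -> .
  by apply/(homog_mem Xh w0 wL); rewrite mevalXU.
have Wy : W (k y).
  split=> // /(_ _ erefl v vL)/eqP; rewrite mevalXU; exact/negP.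
pose phi i (L : proj_space K n) : K :=
  vpick (val (L : proj_point K n)) ord0 i / vpick (val (L : proj_point K n)) ord0 j.
have pick0 (L : proj_point K n) : vpick (val L) != 0.
  by rewrite vpick0 -dimv_eq0 (eqP (valP L)).
have phireg i : regular_on W (phi i).
  move=> L WL; exists W; split=> //; first exact: proj_open_refl.
  exists 1%N, 'X_i, 'X_j; split; rewrite ?dhomogX; try by apply/eqP; exact: mdeg1.
  move=> M WM w wM w0; rewrite !mevalXU; split; first exact: Wj WM w0 wM.
  have [c cE] := line_prop M (pick0 M) (memv_pick _) wM.
  have c0 : c != 0 by apply: contraNneq w0 => c0; rewrite cE c0 scale0r.
  by rewrite cE !mxE -mulf_div divff // mul1r.
have [[C0 [S0 ->] W'E] pull] := kopen W Wopen.
have W'y : (Y `&` k @^-1` W) y by [].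
have [s0 S0s0 s0y] : exists2 s, S0 s & ev s y != 0.
  by apply: affine_zerosN; move: W'y; rewrite W'E => -[].
have inW' z : Y z -> ev s0 z != 0 -> W (k z).
  move=> Yz s0z; suff : (Y `&` k @^-1` W) z by case.
  by rewrite W'E; split=> // /(_ _ S0s0)/eqP; exact/negP.
have loc i : exists GH : {mpoly K[m + 1]} * {mpoly K[m + 1]}, ev GH.2 y != 0 /\
    forall z, Y z -> ev s0 z != 0 -> ev GH.2 z != 0 ->
      phi i (k z) = ev GH.1 z / ev GH.2 z.
  have [V [[C [T ->] ->] [_ Vy] [G [H GH]]]] := pull _ (phireg i) y W'y.
  have [s Ts sy] := affine_zerosN Vy.
  have Hy : ev H y != 0 by case: (GH y).
  exists (G * s, H * s); rewrite /= mevalM mulf_neq0 //; split=> // z Yz s0z.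
  rewrite !mevalM mulf_eq0 negb_or => /andP[Hz sz].
  have [|_ e] := GH z.
    split; first by split=> //; exact: inW'.
    by move=> /(_ _ Ts)/eqP; exact/negP.
  by rewrite -mulf_div divff // mulr1 -e.
have [gh ghE] := choice loc.
pose H := s0 * \prod_i (gh i).2.
pose G i := if i == j then H else s0 * (\prod_(i' | i' != i) (gh i').2) * (gh i).1.
have Gj : G j = H by rewrite /G eqxx.
exists G, j; rewrite Gj; split.
  rewrite /H mevalM mulf_neq0 // rmorph_prod; apply/prodf_neq0 => i _.
  by case: (ghE i).
move=> z Yz Hz; have [s0z Pz] : ev s0 z != 0 /\ forall i, ev (gh i).2 z != 0.
  move: Hz; rewrite /H mevalM mulf_eq0 negb_or => /andP[? ] /=.
  rewrite rmorph_prod => /prodf_neq0 hP; split=> // i; exact: hP.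
have Wz := inW' z Yz s0z.
pose w := vpick (val (k z : proj_point K n)).
have wj : w ord0 j != 0 by apply: Wj Wz (pick0 _) (memv_pick _).
have -> : (\row_i ev (G i) z) = (ev H z / w ord0 j) *: w.
  apply/rowP => i; rewrite !mxE /G; case: (i =P j) => [->|_].
    by rewrite mulfVK.
  have [_ /(_ z Yz s0z (Pz i)) e] := ghE i.
  have -> : ev H z / w ord0 j * w ord0 i = ev H z * phi i (k z) by rewrite mulrAC mulrA.
  rewrite e /H !mevalM !rmorph_prod [in RHS](bigD1 i) //=.
  set P := \prod_(_ < _ | _) _; set b := ev (gh i).2 z; set c := ev (gh i).1 z.
  have b0 : b != 0 by exact: Pz.
  by field.
by apply: memvZ; exact: memv_pick.
Qed.

Definition cylinder_ray y : 'I_(m + 1) -> {poly K} := fun a =>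
  (y ord0 a)%:P + line_dir ord0 a *: 'X.

Lemma horner_cylinder_ray (F : {mpoly K[m + 1]}) y t : (along
  (cylinder_ray y) F).[t] = ev F (y + t *: line_dir).
Proof.
rewrite horner_along; apply: meval_eq => a.
by rewrite hornerD hornerC hornerZ hornerX !mxE mulrC.
Qed.

Lemma at_inj_prop (L : proj_point K n) v w i a : v != 0 -> v \in val L -> w \in val L ->
  v ord0 i * w ord0 a = v ord0 a * w ord0 i.
Proof. by move=> v0 vL /(line_prop L v0 vL)[c ->]; rewrite !mxE; ring. Qed.

(** Local homogeneous coordinates along the line, cleared of common factors, have no
    common zero; they remain valid at every parameter because any two local
    parametrizations are proportional. *)
Lemma curve_exists y : Y y -> exists g : 'I_n -> {poly K},
  forall t, point_at g t != 0 /\ point_at g t \in val (k (y + t *: line_dir)).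
Proof.
move=> Yy; have [G [j [Gj Gk]]] := k_local Yy.
pose P i := along (cylinder_ray y) (G i).
have Pt i t : (P i).[t] = ev (G i) (y + t *: line_dir) by exact: horner_cylinder_ray.
have Pj : P j != 0.
  by apply: contraNneq Gj => P0; have := Pt j 0; rewrite P0 horner0 scale0r addr0 => <-.
have [mu [g [Pg ng]]] := coprime_part Pj.
have mu0 : mu != 0 by apply: contraNneq Pj => mu0; rewrite Pg mu0 mul0r.
exists g => t1; split=> //.
have [G1 [j1 [G1j G1k]]] := k_local (Y_line t1 Yy).
pose P1 i := along (cylinder_ray y) (G1 i).
have P1t i t : (P1 i).[t] = ev (G1 i) (y + t *: line_dir) by exact: horner_cylinder_ray.
have P1j : P1 j1 != 0.
  by apply: contraNneq G1j => P0; rewrite -P1t P0 horner0.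
have prop i a : P i * P1 a = P a * P1 i.
  apply/eqP; rewrite -subr_eq0; apply/eqP;
    apply: (poly_vanish_off charK (mulf_neq0 Pj P1j)).
  move=> t; rewrite hornerM mulf_eq0 negb_or Pt P1t => /andP[h1 h2].
  have := at_inj_prop i a _ (Gk _ (Y_line t Yy) h1) (G1k _ (Y_line t Yy) h2).
  rewrite !mxE hornerD hornerN !hornerM !Pt !P1t => ->; first by rewrite subrr.
  by apply: contraNneq h1 => /rowP/(_ j); rewrite !mxE => ->.
have gprop i a : g i * P1 a = g a * P1 i.
  by apply: (mulfI mu0); rewrite !mulrA -!Pg.
have P1j1 : (P1 j1).[t1] != 0 by rewrite P1t.
have -> : point_at g t1 = ((g j1).[t1] / (P1 j1).[t1]) *: \row_i ev (G1 i) (y + t1 *: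
  line_dir).
  apply/rowP => i; rewrite !mxE -P1t mulrAC -hornerM -gprop hornerM mulfK //.
by apply: memvZ; exact: G1k (Y_line t1 Yy) G1j.
Qed.

Definition is_curve v (g : 'I_n -> {poly K}) : Prop := point_at g 0 = v /\
  forall t, point_at g t != 0 /\ point_at g t \in val (k (h (line_of v) + t *: line_dir)).

Lemma curve_at v : cone v -> exists g, is_curve v g.
Proof.
move=> cv; have [v0 Uv] := cv; have [g gE] := curve_exists (YhU cv).
have [g0 gk] := gE 0; rewrite scale0r addr0 hk // in gk.
have [c cE] := line_prop (k y0) g0 gk (mem_line_of _ v0).
have c0 : c != 0 by apply: contraNneq v0 => c0; rewrite cE c0 scale0r.
have atE t : point_at (fun i => c *: g i) t = c *: point_at g t.
  by apply/rowP => i; rewrite !mxE hornerZ.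
exists (fun i => c *: g i); split; first by rewrite atE -cE.
move=> t; rewrite atE; have [gt gtk] := gE t; split; last exact: memvZ.
by rewrite scaler_eq0 negb_or c0.
Qed.

Lemma curve_prop v g t : cone v -> is_curve v g ->
  [/\ cone (point_at g t), line_of (point_at g t) = k (h (line_of v) + t *: line_dir) &
      h (line_of (point_at g t)) = h (line_of v) + t *: line_dir].
Proof.
move=> cv [_ /(_ t)[gt gk]]; have Yt := Y_line t (YhU cv).
have e := line_of_uniq (k y0) gt gk.
by split; rewrite /cone e //; [split=> //; case: k_mor => kU _; exact: kU|exact: kh].
Qed.

(** Two lifts are proportional, and the factor is a polynomial without zeros, that
    is, a constant; at the starting point it is one. *)
Lemma curve_uniq v g g' : cone v -> is_curve v g -> is_curve v g' -> g' =1 g.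
Proof.
move=> cv [g0 gk] [g'0 g'k]; have [||mu muE] := @proportional _ _ g g'.
- by move=> t; case: (gk t).
- move=> i a; apply/eqP; rewrite -subr_eq0; apply/eqP; apply: (poly_vanish charK) => t.
  have [gt gkt] := gk t; have [_ gkt'] := g'k t.
  have := at_inj_prop i a gt gkt gkt'; rewrite !mxE hornerD hornerN !hornerM => ->.
  by rewrite subrr.
have mut t : mu.[t] != 0.
  have [/at_neq0[i gi] _] := g'k t; apply: contraNneq gi => mu0.
  by rewrite muE hornerM mu0 mul0r.
have [v0 _] := cv; have /at_neq0[i gi] : point_at g 0 != 0 by rewrite g0.
have mu1 : mu.[0] = 1.
  apply: (mulIf gi); rewrite mul1r -hornerM -muE.
  by move/rowP/(_ i): g'0; rewrite -g0 !mxE.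
by move=> a; rewrite muE (nowhere_zero_const mut) mu1 mul1r.
Qed.

Definition base_point v : 'rV[K]_(m + 1) := h (line_of v).

Lemma cone_nonempty : exists v, cone v.
Proof.
have [v v0 vy] := line_point (k y0); exists v; split=> //.
by rewrite (line_of_uniq _ v0 vy); case: k_mor => kU _; exact: kU.
Qed.

(** The coordinate along the cylinder is a nonconstant function on the cone; its
    denominator in lowest terms is a nowhere vanishing function H.  On every
    line of the cone H is a nonvanishing polynomial off the origin, hence a
    monomial, so H satisfies Euler's relation with an exponent that is constant
    by irreducibility.  If the exponent were zero, the coordinate would be
    constant. *)
Lemma euler_denominator : exists H (kappa : nat), (0 < kappa)%N /\
  forall v, cone v -> ev H v != 0 /\
    \sum_i v ord0 i * ev H^`M(i) v = kappa%:R * ev H v.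
Proof.
have [v0 cv0] := cone_nonempty.
have [G [H GH]] := frac_global cv0 (fun v cv => frac_coord last_coord cv).
pose lin v i : {poly K} := v ord0 i *: 'X.
have linE p v c : (along (lin v) p).[c] = ev p (c *: v).
  rewrite horner_along; apply: meval_eq => i.
  by rewrite /lin hornerZ hornerX mxE mulrC.
have lin_size p v : (size (along (lin v) p) <= msize p)%N.
  apply: size_along => i; apply: leq_trans (size_scale_leq _ _) _.
  by rewrite size_polyX.
(* The exponent on the line through v may depend on v; being bounded, it is
   constant because the product of the relations E = kap H vanishes on the
   cone. *)
pose E := \sum_i 'X_i * H^`M(i).
have EE v : ev E v = \sum_i v ord0 i * ev H^`M(i) v.
  by rewrite raddf_sum /=; apply: eq_bigr => i _; rewrite mevalM mevalXU.
have mono v : cone v -> exists2 kap : nat, (kap < msize H)%N &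
    (forall c, ev H (c *: v) = ev H v * c ^+ kap) /\ ev E v = kap%:R * ev H v.
  move=> cv; have [|kap [a aE]] := @zero_free_monomial _ (along (lin v) H).
    by move=> c c0; rewrite linE; case: (GH _ (cone_scale c0 cv)).
  have aH : a = ev H v.
    by rewrite -[v in RHS]scale1r -linE aE hornerZ hornerXn expr1n mulr1.
  have Hv : ev H v != 0 by case: (GH v cv).
  exists kap.
    apply: leq_trans (lin_size H v); rewrite aE size_scale ?size_polyXn //.
    by rewrite aH.
  split=> [c|]; first by rewrite -linE aE hornerZ hornerXn aH.
  have := horner_deriv_along (lin v) H 1;
    rewrite aE derivZ derivXn hornerZ hornerMn hornerXn expr1n.
  rewrite aH mulr_natr mulr_natl => ->; rewrite EE; apply: eq_bigr => i _.
  rewrite /lin derivZ derivX hornerZ hornerC mulr1 mulrC; congr (_ * _).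
  by apply: meval_eq => j; rewrite hornerZ hornerX mulr1.
have irr B : (forall v, cone v ->
  exists2 kap : nat, (kap < B)%N & ev E v = kap%:R * ev H v) ->
    exists kap : nat, divides f (E - kap%:R * H).
  move=> hB; have : divides f (\prod_(kap < B) (E - (kap : nat)%:R * H)).
    apply: (cone_dense cv0 (H := 1)); first by rewrite meval1 oner_neq0.
    move=> v cv _; have [kap kB e] := hB v cv.
    rewrite rmorph_prod (bigD1 (Ordinal kB)) //= mevalB mevalM rmorph_nat e subrr.
    by rewrite mul0r.
  elim: B {hB} => [|B IH]; first by rewrite big_ord0 => /(not_divides cv0);
    rewrite meval1 oner_neq0 => /(_ isT).
  by rewrite big_ord_recr => /f_prime[/IH//|d]; exists B.
have [kap [q qE]] := irr (msize H) (fun v cv => let: ex_intro2 kap kB (conj _ e) :=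
  mono v cv in ex_intro2 _ _ kap kB e).
have Ek v : cone v -> ev E v = kap%:R * ev H v.
  move=> /coneE[_ fv _]; apply/eqP; rewrite -subr_eq0.
  have := congr1 (fun p => ev p v) qE; rewrite /= mevalB !mevalM rmorph_nat fv mulr0.
  by move=> ->.
exists H, kap; split; last first.
  by move=> v cv; rewrite -EE Ek //; case: (GH v cv).
rewrite lt0n; apply/negP => /eqP kap0.
have Hconst v : cone v -> forall c, ev H (c *: v) = ev H v.
  move=> cv c; have [j _ [jH jE]] := mono v cv.
  have Hv : ev H v != 0 by case: (GH v cv).
  move: jE; rewrite Ek // kap0 mul0r => /esym/eqP; rewrite mulf_eq0 (negbTE Hv) orbF.
  have /pcharf0P -> := charK; move=> /eqP j0; by rewrite jH j0 expr0 mulr1.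
have Gconst v : cone v -> forall c, ev G (c *: v) = ev G v.
  move=> cv c; have [v_neq0 _] := cv.
  have : along (lin v) G - (ev G v)%:P = 0.
    apply: (poly_vanish_off charK (b := 'X)); first by rewrite polyX_eq0.
    move=> t; rewrite hornerX => t0; rewrite hornerD hornerN hornerC linE.
    have [Hv e1] := GH v cv; have [Htv e2] := GH _ (cone_scale t0 cv).
    move: e2; rewrite /cylinder_coord line_of_scale // -/(cylinder_coord last_coord v)
      e1 Hconst //.
    by move/(mulIf (invr_neq0 Hv)) ->; rewrite subrr.
  move/eqP; rewrite subr_eq0 => /eqP e.
  by rewrite -linE e hornerC.
have tau_const v : cone v -> cylinder_coord last_coord v = ev G 0 / ev H 0.
  move=> cv; have [_ ->] := GH v cv.
  by rewrite -(Gconst v cv 0) -(Hconst v cv 0) scale0r.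
have [g gE] := curve_at cv0; have [cv1 _ e1] := curve_prop 1 cv0 gE.
have := tau_const _ cv1; rewrite /cylinder_coord e1 -(tau_const _ cv0) /cylinder_coord
  scale1r mxE line_dir_last.
by move/eqP; rewrite -[X in _ == X]addr0 (inj_eq (addrI _)) oner_eq0.
Qed.

Lemma mem_line_coord_neq0 v w (L : proj_point K n) j : v != 0 -> v \in val L ->
  w \in val L ->
  w ord0 j != 0 -> v ord0 j != 0.
Proof.
move=> v0 vL wL; apply: contraNneq => vj.
by have [c ->] := line_prop L v0 vL wL; rewrite mxE vj mulr0.
Qed.

Lemma frac_base_point v0 (F : {mpoly K[m + 1]}) : cone v0 -> frac_at v0 (fun v => ev F
  (base_point v)).
Proof.
move=> cv0; exact: (@frac_comp v0 cylinder_coord F (fun i => frac_coord i cv0)).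
Qed.

Lemma curve_along_local v g (G : 'I_n -> {mpoly K[m + 1]}) j : cone v -> is_curve v g ->
  (forall z, Y z -> ev (G j) z != 0 -> (\row_i ev (G i) z) \in val (k z)) ->
  ev (G j) (base_point v) != 0 ->
  forall a b, g a * along (cylinder_ray (base_point v)) (G b) = g b * along
    (cylinder_ray (base_point v)) (G a).
Proof.
move=> cv [_ gk] Gk Gj a b; have Lt := fun i => horner_cylinder_ray (G i) (base_point v).
have Lj : along (cylinder_ray (base_point v)) (G j) != 0.
  by apply: contraNneq Gj => Lj; have := Lt j 0; rewrite Lj horner0 scale0r addr0 => <-.
apply/eqP; rewrite -subr_eq0; apply/eqP; apply: (poly_vanish_off charK Lj) => t.
rewrite Lt => h1; have [gt gkt] := gk t.
have := at_inj_prop a b gt gkt (Gk _ (Y_line t (YhU cv)) h1).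
by rewrite !mxE hornerD hornerN !hornerM !Lt => ->; rewrite subrr.
Qed.

(** Differentiating the proportionality of the curve with the local coordinates
    determines the velocity up to a multiple of v, and differentiating the
    constant H along the curve determines this multiple, both rationally. *)
Lemma frac_velocity (H : {mpoly K[n]}) (kappa : nat)
  (g : 'rV[K]_n -> 'I_n -> {poly K}) i v0 :
  (0 < kappa)%N ->
  (forall v, cone v -> ev H v != 0 /\
    \sum_i v ord0 i * ev H^`M(i) v = kappa%:R * ev H v) ->
  (forall v, cone v -> is_curve v (g v)) ->
  cone v0 -> frac_at v0 (fun v => (g v i)^`().[0]).
Proof.
move=> kap0 Heuler gE cv0; have [G [j [Gj Gk]]] := k_local (YhU cv0).
(* P and dP are the values at v of the local coordinates and of their derivatives
   along the cylinder; w a is the velocity up to a multiple of the vector v,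
   which is fixed by requiring that the derivative of H vanishes *)
pose P a v := ev (G a) (base_point v).
pose dP a v := \sum_b ev (G a)^`M(b) (base_point v) * line_dir ord0 b.
pose w a v := v ord0 j * dP a v - v ord0 a * dP j v.
pose s v := \sum_a ev H^`M(a) v * w a v.
have kapR : kappa%:R != 0 :> K by rewrite -(prednK kap0); exact: natr_neq0.
have fv a : frac_at v0 (fun v => v ord0 a).
  have := frac_poly v0 'X_a; congr frac_at; apply: funext => v; exact: mevalXU.
have fP a : frac_at v0 (P a) by exact: frac_base_point.
have fdP a : frac_at v0 (dP a).
  by apply: frac_sum => b; apply: frac_mul; [exact: frac_base_point|exact: frac_cst].
have fw a : frac_at v0 (w a).
  by apply: frac_add; [|apply: frac_opp]; apply: frac_mul.
have fs : frac_at v0 s.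
  by apply: frac_sum => a; apply: frac_mul; [exact: frac_poly|exact: fw].
apply: (frac_near (chi := P j)
  (psi' := fun v => (w i v + - (v ord0 i * (s v * (kappa%:R * ev H v)^-1))) * (P j
    v)^-1)) => //; last first.
  apply: frac_mul; last exact: frac_inv.
  apply: frac_add; first exact: fw.
  apply: frac_opp; apply: frac_mul => //; apply: frac_mul => //.
  apply: frac_inv => //; first by apply: frac_mul; [exact: frac_cst|exact: frac_poly].
  by rewrite mulf_neq0 //; case: (Heuler v0 cv0).
move=> v cv Pj; have [g0 gk] := gE v cv; have Yv := YhU cv.
pose L a := along (cylinder_ray (base_point v)) (G a).
have Lt a t : (L a).[t] = ev (G a) (base_point v + t *: line_dir) by exact:
  horner_cylinder_ray.
have L0 a : (L a).[0] = P a v by rewrite Lt scale0r addr0.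
have prop a : g v a * L j = g v j * L a by exact: curve_along_local cv (gE v cv) Gk Pj
  a j.
have dL a : (L a)^`().[0] = dP a v.
  rewrite horner_deriv_along; apply: eq_bigr => b _; congr (_ * _).
    by apply: meval_eq => c; rewrite hornerD hornerC hornerZ hornerX mulr0 addr0.
  by rewrite derivD derivC derivZ derivX add0r hornerZ hornerC mulr1.
have gv a : (g v a).[0] = v ord0 a by rewrite -[in RHS]g0 mxE.
have [v_neq0 Uv] := cv; have vj : v ord0 j != 0.
  have Pjr : (\row_a ev (G a) (base_point v)) ord0 j != 0 by rewrite mxE.
  have := Gk _ Yv Pj; rewrite hk // => hG.
  exact: mem_line_coord_neq0 v_neq0 (mem_line_of _ v_neq0) hG Pjr.
pose x a := (g v a)^`().[0].
have e1 a : x a * P j v + v ord0 a * dP j v = x j * P a v + v ord0 j * dP a v.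
  have := congr1 (fun q : {poly K} => q^`().[0]) (prop a).
  by rewrite /= !derivM !hornerD !hornerM !dL !L0 !gv.
have e2 a : v ord0 a * P j v = v ord0 j * P a v.
  have := congr1 (fun q : {poly K} => q.[0]) (prop a).
  by rewrite /= !hornerM !L0 !gv.
have e3 : \sum_a ev H^`M(a) v * x a = 0.
  have Hnz t : (along (g v) H).[t] != 0.
    rewrite horner_along; have [cgt _ _] := curve_prop t cv (gE v cv).
    have [+ _] := Heuler _ cgt; congr (_ != 0); apply: meval_eq => a.
    by rewrite mxE.
  have := congr1 (fun q : {poly K} => q^`().[0]) (nowhere_zero_const Hnz).
  rewrite /= derivC horner0 horner_deriv_along => e; rewrite -[RHS]e;
    apply: eq_bigr => a _.
  by congr (_ * _); apply: meval_eq => b; rewrite gv.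
have e4 a : x a * (P j v * v ord0 j) = x j * v ord0 a * P j v + v ord0 j * w a v.
  have -> : x a * (P j v * v ord0 j) = v ord0 j * (x a * P j v + v ord0 a * dP j v) - v
    ord0 j * v ord0 a * dP j v.
    by ring.
  rewrite e1 /w -[x j * _ * P j v]mulrA e2; ring.
have [Hv euler] := Heuler v cv.
have e5 : x j * P j v * (kappa%:R * ev H v) + v ord0 j * s v = 0.
  transitivity ((P j v * v ord0 j) * \sum_a ev H^`M(a) v * x a); last by rewrite e3 mulr0.
  rewrite -euler /s; move: (P j v) e4 => z e4.
  rewrite !mulr_sumr -big_split; apply: eq_bigr => a _ /=.
  transitivity (ev H^`M(a) v * (x a * (z * v ord0 j))); last by ring.
  by rewrite e4; ring.
set c := kappa%:R * ev H v in e5 *; have c0 : c != 0 by rewrite mulf_neq0.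
have e6 : x j * P j v = - (v ord0 j * s v) / c.
  by apply: (mulIf c0); rewrite mulfVK //; apply/eqP; rewrite -addr_eq0 e5.
apply: (mulIf (mulf_neq0 Pj vj)); rewrite -/(x i) e4.
move: (P j v) (w i v) (s v) (x j) Pj e6 => z z' z'' x' z0 e6.
transitivity (v ord0 i * (x' * z) + v ord0 j * z'); first by ring.
by rewrite e6; clearbody c; field; rewrite c0 z0.
Qed.

(** Clearing denominators in the velocity gives a polynomial vector field whose
    common denominator s, having no zero on the cone, is constant along each
    curve; restricted to a curve, the vector field is differentiation up to this
    constant, so it is nilpotent once the degrees of the curves are bounded, and
    it is enough to bound them over a nonempty open set. *)
Lemma cylinder_field : exists p : 'I_n -> {mpoly K[n]}, nilpotent_field f p.
Proof.
have [H [kap [kap0 euler]]] := euler_denominator.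
have [v0 cv0] := cone_nonempty.
have /choice[g gE] : forall v, exists g, cone v -> is_curve v g.
  move=> v; have [cv|ncv] := pselect (cone v); last by exists (fun=> 0).
  by have [g gE] := curve_at cv; exists g.
pose psi i v := (g v i)^`().[0].
have /choice[GH GHE] : forall i, exists GH : {mpoly K[n]} * {mpoly K[n]},
    forall v, cone v -> ev GH.2 v != 0 /\ psi i v = ev GH.1 v / ev GH.2 v.
  move=> i; have [G [H' GH']] := frac_global cv0 (fun v cv => frac_velocity i kap0
    euler gE cv).
  by exists (G, H').
pose s := \prod_i (GH i).2.
pose p i := (GH i).1 * \prod_(i' | i' != i) (GH i').2.
have s_neq0 v : cone v -> ev s v != 0.
  by move=> cv; rewrite rmorph_prod; apply/prodf_neq0 => i _; case: (GHE i v cv).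
have pE i v : cone v -> ev (p i) v = ev s v * psi i v.
  move=> cv; have [Hv ->] := GHE i v cv.
  rewrite /s /p mevalM !rmorph_prod [in RHS](bigD1 i) //=.
  by set P := \prod_(_ < _ | _) _; field.
have shift v t i : cone v -> psi i (point_at (g v) t) = (g v i)^`().[t].
  move=> cv; have [cw _ hw] := curve_prop t cv (gE v cv).
  have c2 : is_curve (point_at (g v) t) (fun a => g v a \Po ('X + t%:P)).
    have atE r : point_at (fun a => g v a \Po ('X + t%:P)) r = point_at (g v) (r + t).
      by apply/rowP => a; rewrite !mxE horner_comp hornerD hornerX hornerC.
    split=> [|r]; first by rewrite atE add0r.
    rewrite atE hw -addrA -scalerDl [t + r]addrC.
    by have [_ gk] := gE v cv; exact: gk.
  rewrite /psi -(curve_uniq cw (gE _ cw) c2 i) deriv_comp derivD derivX derivC addr0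
    mulr1.
  by rewrite horner_comp hornerD hornerX hornerC add0r.
have along_s v : cone v -> forall t, ev s (point_at (g v) t) = ev s v.
  move=> cv t; have [g0 _] := gE v cv.
  have alE r : (along (g v) s).[r] = ev s (point_at (g v) r).
    by rewrite horner_along; apply: meval_eq => a; rewrite mxE.
  have nz r : (along (g v) s).[r] != 0.
    by rewrite alE; apply: s_neq0; case: (curve_prop r cv (gE v cv)).
  by rewrite -alE (nowhere_zero_const nz) hornerC alE g0.
have alongE v (F : {mpoly K[n]}) : cone v ->
    along (g v) (vder p F) = ev s v *: (along (g v) F)^`().
  move=> cv; apply/eqP; rewrite -subr_eq0; apply/eqP; apply: (poly_vanish charK) => t.
  have [cw _ _] := curve_prop t cv (gE v cv).
  have atE q : q.@[fun a => (g v a).[t]] = ev q (point_at (g v) t).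
    by apply: meval_eq => a; rewrite mxE.
  rewrite hornerD hornerN hornerZ horner_deriv_along horner_along atE /vder raddf_sum /=.
  rewrite mulr_sumr -sumrB big1 // => i _.
  by rewrite mevalM pE // along_s // shift // atE; ring.
have alongE_iter v (F : {mpoly K[n]}) N : cone v ->
    along (g v) (iter N (vder p) F) = ev s v ^+ N *: (along (g v) F)^`(N).
  move=> cv; elim: N => [|N IH]; first by rewrite scale1r.
  by rewrite iterS alongE // IH derivZ scalerA -exprS derivnS.
have at0 v q : cone v -> (along (g v) q).[0] = ev q v.
  move=> cv; have [g0 _] := gE v cv; rewrite horner_along.
  by rewrite -[in RHS]g0; apply: meval_eq => a; rewrite mxE.
have one0 : ev 1 v0 != 0 by rewrite meval1 oner_neq0.
have f_along v : cone v -> along (g v) f = 0.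
  move=> cv; apply: (poly_vanish charK) => t; rewrite horner_along.
  have [/coneE[_ fw _] _ _] := curve_prop t cv (gE v cv).
  by rewrite -[RHS]fw; apply: meval_eq => a; rewrite mxE.
exists p; split.
- apply: contrapT => no; have pdiv i : divides f (p i).
    by apply: contrapT => ni; apply: no; exists i.
  have [g0 gk] := gE v0 cv0; have [_ _ h1] := curve_prop 1 cv0 (gE v0 cv0).
  have dg i : (g v0 i)^`() = 0.
    have := alongE v0 'X_i cv0; rewrite vderX alongX.
    have [q ->] := pdiv i; rewrite alongM f_along // mulr0 => /esym/eqP.
    by rewrite scaler_eq0 (negbTE (s_neq0 v0 cv0)) => /eqP.
  have : point_at (g v0) 1 = v0.
    rewrite -[RHS]g0; apply/rowP => i; rewrite !mxE.
    by rewrite (deriv_eq0 charK (dg i)) !hornerC.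
  move=> e; move: h1; rewrite e scale1r => /eqP.
  rewrite -[X in X == _]addr0 (inj_eq (addrI _)) => /eqP/(congr1 (fun y : 'rV_(m + 1)
    => y ord0 last_coord)).
  by rewrite line_dir_last mxE => /eqP; rewrite eq_sym oner_eq0.
- apply: (cone_dense cv0 one0) => v cv _.
  by rewrite -at0 // alongE // f_along // deriv0 scaler0 horner0.
move=> i; have [G [j [Gj Gk]]] := k_local (YhU cv0).
have [A [B [B0 AB]]] := frac_base_point (G j) cv0.
have A0 : ev A v0 != 0.
  apply: contraNneq Gj => A0; have := AB v0 cv0 B0; rewrite A0 mul0r => <-.
  by [].
(* where G j does not vanish, the curve divides the vector G, whose degree along
   the cylinder is at most its total degree *)
pose N := msize (G i); exists N; apply: (cone_dense cv0 (H := A * B)).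
  by rewrite mevalM mulf_neq0.
move=> v cv; rewrite mevalM mulf_eq0 negb_or => /andP[Av Bv].
have Gjv : ev (G j) (base_point v) != 0 by rewrite AB // mulf_neq0 // invr_eq0.
have [g0 gk] := gE v cv; pose L a := along (cylinder_ray (base_point v)) (G a).
have Lt a t : (L a).[t] = ev (G a) (base_point v + t *: line_dir) by exact:
  horner_cylinder_ray.
have Lj : L j != 0.
  by apply: contraNneq Gjv => Lj; have := Lt j 0; rewrite Lj horner0 scale0r addr0 => <-.
have prop a b : g v a * L b = g v b * L a by exact: curve_along_local cv (gE v cv) Gk
  Gjv a b.
have [|mu muE] := proportional _ prop; first by move=> t; case: (gk t).
have mu0 : mu != 0 by apply: contraNneq Lj => mu0; rewrite muE mu0 mul0r.
have szg : (size (g v i) <= N)%N.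
  have szL : (size (L i) <= N)%N.
    apply: size_along => a; apply: leq_trans (size_polyD _ _) _; rewrite geq_max.
    rewrite (leq_trans (size_polyC_leq1 _)) //=.
    by apply: leq_trans (size_scale_leq _ _) _; rewrite size_polyX.
  have [->|gi0] := eqVneq (g v i) 0; first by rewrite size_poly0.
  apply: leq_trans szL; rewrite muE size_mul // -(prednK (_ : 0 < size mu)%N)
    ?size_poly_gt0 //.
  by rewrite addSn /= leq_addl.
rewrite -at0 // alongE_iter // alongX derivn_poly0 //; last first.
by rewrite scaler0 horner0.
Qed.

End Cylinder.

(** * A cylinder from a variable of exponent one *)

Section Morphisms.
Local Open Scope classical_set_scope.
Variables (K : closedFieldType) (n M : nat).

Notation ev p v := (meval ((v : 'rV_ _) ord0) p).

Lemma morphism_to_proj (A : set (affine_space K M)) (B : set (proj_space K n))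
    (k : affine_space K M -> proj_space K n) (c : 'I_n -> {mpoly K[M]}) :
  (forall y, A y -> B (k y)) ->
  (forall y, A y -> \row_i ev (c i) y != 0 /\ \row_i ev (c i) y \in val (k y)) ->
  morphism A B k.
Proof.
move=> AB ck; pose comp (p : {mpoly K[n]}) := p \mPo [tuple c i | i < n].
have compE p (y : affine_space K M) : ev (comp p) y = ev p (\row_i ev (c i) y).
  rewrite /comp comp_mpoly_meval; apply: meval_eq => i.
  by rewrite tnth_mktuple mxE.
have mem S y : (forall p, S p -> homogeneous_poly p) -> A y ->
    proj_zeros S (k y) <-> affine_zeros [set comp p | p in S] y.
  move=> hS Ay; have [c0 ckL] := ck y Ay; split=> [z _ [p Sp <-]|z p Sp].
    by rewrite compE; exact: z Sp _ ckL.
  by apply/(homog_mem (hS _ Sp) c0 ckL); rewrite -compE; apply: z; exists p.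
split=> // W [C [S hS ->] ->].
have openE : A `&` k @^-1` (B `\` proj_zeros S) = A `\` affine_zeros [set comp p | p in
  S].
  apply/seteqP; split=> y [Ay].
    by move=> [_ nC]; split=> // /(mem _ _ hS Ay).
  by move=> nC; split=> //; split; [exact: AB|move/(mem _ _ hS Ay)].
split; first by rewrite openE; eexists; last reflexivity; eexists.
move=> phi reg y [Ay Wy]; have [V [[C' [S' hS' ->] ->] [_ Vy] [d [G [H [_ _ GH]]]]]] :=
  reg _ Wy.
exists ((A `&` k @^-1` (B `\` proj_zeros S)) `\` affine_zeros [set comp p | p in S']);
  split.
- by eexists; last reflexivity; eexists.
- by split=> // /(mem _ _ hS' Ay).
exists (comp G), (comp H) => z [[Az Wz] nz]; have [c0 ckL] := ck z Az.
rewrite !compE; apply: GH => //; split=> //.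
by move/(mem _ _ hS' Az).
Qed.

Lemma fraction_polynomial (A : set (proj_space K n))
  (h : proj_space K n -> affine_space K M)
    (F : {mpoly K[M]}) :
  (forall a, fraction_on A (fun L => (h L : 'rV_M) ord0 a)) ->
  fraction_on A (fun L => ev F (h L)).
Proof.
move=> frac; elim/mpoly_ring_ind: F => [c|a|p q hp hq|p q hp hq].
- exists 0%N, c%:MP, 1; split; last 1 first.
  + by move=> L _ v _ _; rewrite meval1 !mevalC oner_neq0 divr1.
  + by rewrite -[c%:MP]mulr1 mul_mpolyC; apply: dhomogZ; exact: dhomog1.
  + exact: dhomog1.
- have [d [G [H [hG hH GH]]]] := frac a; exists d, G, H; split=> // L AL v vL v0.
  by rewrite mevalXU; exact: GH.
- have [d [G [H [hG hH GH]]]] := hp; have [d' [G' [H' [hG' hH' GH']]]] := hq.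
  exists (d + d')%N, (G * H' + G' * H), (H * H'); split.
  + apply: dhomogD; first exact: dhomogM.
    by rewrite addnC; exact: dhomogM.
  + exact: dhomogM.
  move=> L AL v vL v0; have [Hv e] := GH L AL v vL v0; have [Hv' e'] := GH' L AL v vL v0.
  by rewrite mevalM mulf_neq0 // mevalD e e' mevalD !mevalM addf_div.
have [d [G [H [hG hH GH]]]] := hp; have [d' [G' [H' [hG' hH' GH']]]] := hq.
exists (d + d')%N, (G * G'), (H * H'); split; try exact: dhomogM.
move=> L AL v vL v0; have [Hv e] := GH L AL v vL v0; have [Hv' e'] := GH' L AL v vL v0.
by rewrite !mevalM mulf_neq0 // e e' mulf_div.
Qed.

(** The inverse image of a closed set is cut out by all the numerators of the
    pulled back equations. *)
Lemma morphism_to_affine (A : set (proj_space K n)) (B : set (affine_space K M))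
    (h : proj_space K n -> affine_space K M) :
  (forall L, A L -> B (h L)) ->
  (forall a, fraction_on A (fun L => (h L : 'rV_M) ord0 a)) ->
  morphism A B h.
Proof.
move=> AB frac.
pose num (S : set {mpoly K[M]}) : set {mpoly K[n]} := [set G | exists d s H,
  [/\ S s, G \is d.-homog, H \is d.-homog & forall L, A L -> forall v : 'rV_n,
      v \in val (L : proj_point K n) -> v != 0 ->
        ev H v != 0 /\ ev s (h L) = ev G v / ev H v]].
have numh S p : num S p -> homogeneous_poly p by move=> [d [s [H [_ hp _ _]]]]; exists d.
have mem S L : A L -> proj_zeros (num S) L <-> affine_zeros S (h L).
  move=> AL; have [v v0 vL] := line_point L; split=> [z s Ss|z G nG].
    have [d [G [H [hG hH GH]]]] := fraction_polynomial s frac.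
    have [Hv e] := GH L AL v vL v0.
    have /z/(_ v vL) G0 : num S G by exists d, s, H.
    by rewrite e G0 mul0r.
  apply/(homog_mem (numh _ _ nG) v0 vL); case: nG => [d [s [H [Ss _ _ GH]]]].
  have [Hv] := GH L AL v vL v0; rewrite (z s Ss) => /esym/eqP.
  by rewrite mulf_eq0 invr_eq0 (negbTE Hv) orbF => /eqP.
split=> // W [C [S ->] ->].
have openE : A `&` h @^-1` (B `\` affine_zeros S) = A `\` proj_zeros (num S).
  apply/seteqP; split=> L [AL].
    by move=> [_ nC]; split=> // /(mem _ _ AL).
  by move=> nC; split=> //; split; [exact: AB|move/(mem _ _ AL)].
split.
  rewrite openE; exists (proj_zeros (num S)) => //.
  by exists (num S) => //; exact: numh.
move=> phi reg L [AL WL]; have [V [[C' [S' ->] ->] [_ VL] [G [H GH]]]] := reg _ WL.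
exists ((A `&` h @^-1` (B `\` affine_zeros S)) `\` proj_zeros (num S')); split.
- exists (proj_zeros (num S')) => //; exists (num S') => //; exact: numh.
- by split=> // /(mem _ _ AL).
have [d1 [G1 [H1 [hG1 hH1 GH1]]]] := fraction_polynomial G frac.
have [d2 [G2 [H2 [hG2 hH2 GH2]]]] := fraction_polynomial H frac.
exists (d1 + d2)%N, (G1 * H2), (H1 * G2); split; try exact: dhomogM.
move=> L' [[AL' WL'] nL'] v vL v0.
have [Hv e] := GH1 L' AL' v vL v0; have [Hv2 e2] := GH2 L' AL' v vL v0.
have [|H0 e3] := GH (h L'); first by split=> // /(mem _ _ AL').
have G2v : ev G2 v != 0 by apply: contraNneq H0; rewrite e2 => ->; rewrite mul0r.
by rewrite !mevalM mulf_neq0 //= e3 e e2 invf_div mulf_div.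
Qed.

End Morphisms.

Section LinearVariable.
Local Open Scope classical_set_scope.
Variables (K : closedFieldType) (n : nat).
Variables (grp : 'I_n -> 'I_3) (l : 'I_n -> nat) (N : nat).
Hypothesis l_gt0 : forall j, (0 < l j)%N.
Hypothesis N_gt1 : (1 < N)%N.
Hypothesis lN : forall i, (\sum_(j | grp j == i) l j)%N = N.
Notation block := (block grp l).
Notation f := (trinom K grp l).
Notation ev p v := (meval ((v : 'rV_ _) ord0) p).

Lemma meval_supp (p : {mpoly K[n]}) (v w : 'I_n -> K) :
  (forall m i, p@_m != 0 -> m i != 0%N -> v i = w i) -> p.@[v] = p.@[w].
Proof.
move=> h; rewrite !mevalE; apply: eq_big_seq => m; rewrite mcoeff_msupp => pm.
congr (_ * _); apply: eq_bigr => i _.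
by have [->|mi] := eqVneq (m i) 0%N; rewrite ?expr0 // (h m i).
Qed.

Lemma second_variable j : l j = 1%N -> exists2 j', j' != j & grp j' = grp j.
Proof.
move=> lj; apply: contrapT => no; have := lN (grp j).
rewrite (bigD1 j) //= lj big_pred0 => [e|j'].
  by move: N_gt1; rewrite -e.
by apply/negbTE/negP => /andP[/eqP gj jj]; apply: no; exists j'.
Qed.

(** If the variable x_j occurs linearly, with cofactor u, then where u does not
    vanish the equation determines x_j by the other variables.  Another variable
    x_j' of the same term is normalized to one, and a variable x_b of a different
    term, which occurs neither in u nor in the normalization, is the coordinate
    along the affine line.  In the affine model, x_j is replaced by the inverse
    of u and x_b by zero. *)
Lemma linear_variable_cylinder j : l j = 1%N -> contains_cylinder (proj_hypersurface f).
Proof.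
move=> lj; have [j' jj' gj'] := second_variable lj.
have [b gb] : exists b, grp b != grp j.
  have [i ij] : exists i, i != grp j.
    by case: (ord3_cases (grp j)) => ->; [exists 1|exists 0|exists 0].
  by have [b gb] := group_nonempty N_gt1 lN i; exists b; rewrite gb.
have bj : b != j by apply: contraNneq gb => ->.
have bj' : b != j' by apply: contraNneq gb => ->; rewrite gj'.
pose mu := (block (grp j) - U_(j))%MM; pose u : {mpoly K[n]} := 'X_[mu].
pose r : {mpoly K[n]} := \sum_(i | i != grp j) 'X_[block i].
have muE : block (grp j) = (U_(j) + mu)%MM.
  by rewrite addmC submK // lep1mP mnmE eqxx lj.
have fE : f = 'X_j * u + r by rewrite /trinom (bigD1 (grp j)) //= muE mpolyXD.
have muj : mu j = 0%N by rewrite mnmBE mnmE eqxx mnm1E eqxx lj.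
have mub : mu b = 0%N by rewrite mnmBE mnmE eq_sym [grp j == _]eq_sym (negbTE gb).
have muj' : (0 < mu j')%N.
  by rewrite mnmBE mnmE gj' eqxx mnm1E eq_sym (negbTE jj') subn0 l_gt0.
have r_supp (m : 'X_{1..n}) : r@_m != 0 -> exists2 i, i != grp j & m = block i.
  move=> rm; apply: contrapT => no; case/eqP: rm.
  rewrite raddf_sum big1 //= => i ij; rewrite mcoeffX.
  by case: (block i =P m) => // e; case: no; exists i.
have u_eq (v w : 'I_n -> K) : (forall i, i != j -> i != b -> v i = w i) ->
  u.@[v] = u.@[w].
  move=> h; apply: meval_supp => m i; rewrite mcoeffX.
  case: (mu =P m) => [<- _ mi|]; last by rewrite eqxx.
  by apply: h; apply: contraNneq mi => ->; rewrite ?muj ?mub.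
have r_eq (v w : 'I_n -> K) : (forall i, i != j -> v i = w i) -> r.@[v] = r.@[w].
  move=> h; apply: meval_supp => m i /r_supp[i0 i0j ->] mi; apply: h.
  by apply: contraNneq mi => ->; rewrite mnmE [grp j == i0]eq_sym (negbTE i0j).
have u_homog : u \is (mdeg mu).-homog by rewrite dhomogX; exact: eqxx.
have u_neq0 (v : 'I_n -> K) : u.@[v] != 0 -> v j' != 0.
  apply: contraNneq => vj'; rewrite mevalX (bigD1 j') //= vj' expr0n.
  by rewrite gtn_eqF // mul0r.
pose Zs : set {mpoly K[n]} := [set 'X_j' - 1; 'X_b; 'X_j * u - 1].
pose Z : set (affine_space K n) := affine_zeros Zs.
pose U : set (proj_space K n) := proj_hypersurface f `\` proj_zeros [set u].
have ZE (x : 'rV[K]_n) : Z x <-> [/\ x ord0 j' = 1, x ord0 b = 0 & x ord0 j * ev u x = 1].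
  split=> [z|[e1 e2 e3] p [[]|] ->].
  - split.
    + have : ev ('X_j' - 1) x = 0 by apply: z; left; left.
      by rewrite mevalB mevalXU meval1 => /eqP; rewrite subr_eq0 => /eqP.
    + by rewrite -(mevalXU (x ord0)); apply: z; left; right.
    + have : ev ('X_j * u - 1) x = 0 by apply: z; right.
      by rewrite mevalB mevalM mevalXU meval1 => /eqP; rewrite subr_eq0 => /eqP.
  - by rewrite mevalB mevalXU meval1 e1 subrr.
  - by rewrite mevalXU.
  - by rewrite mevalB mevalM mevalXU meval1 e3 subrr.
pose xi i : {mpoly K[n + 1]} := if i == b then 'X_(rshift n ord0) else 'X_(lshift 1 i).
pose c i : {mpoly K[n + 1]} :=
  if i == j then - (r \mPo [tuple xi a | a < n]) * 'X_(lshift 1 j) else xi i.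
pose k1 w : 'rV[K]_n := \row_i ev (c i) w.
pose h1 (v : 'rV[K]_n) : 'rV[K]_(n + 1) := row_mx
  (\row_i (if i == j then (ev u v)^-1 else if i == b then 0 else v ord0 i)) (\row__ v
    ord0 b).
have xi_l (w : 'rV[K]_(n + 1)) i : i != b -> ev (xi i) w = lsubmx w ord0 i.
  by move=> ib; rewrite /xi (negbTE ib) mevalXU mxE.
have c_l (w : 'rV[K]_(n + 1)) i : i != b -> i != j -> k1 w ord0 i = lsubmx w ord0 i.
  by move=> ib ij; rewrite mxE /c (negbTE ij) xi_l.
have c_b (w : 'rV[K]_(n + 1)) : k1 w ord0 b = w ord0 (rshift n ord0).
  by rewrite mxE /c (negbTE bj) /xi eqxx mevalXU.
have c_j (w : 'rV[K]_(n + 1)) : k1 w ord0 j = - ev r (k1 w) * lsubmx w ord0 j.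
  rewrite mxE /c eqxx mevalM mevalN comp_mpoly_meval mevalXU !mxE; congr (- _ * _).
  by apply: r_eq => i ij; rewrite tnth_mktuple mxE /c (negbTE ij).
have u_k1 (w : 'rV[K]_(n + 1)) : ev u (k1 w) = ev u (lsubmx w).
  by apply: u_eq => i ij ib; exact: c_l.
have kf (w : 'rV[K]_(n + 1)) : Z (lsubmx w) ->
    [/\ k1 w ord0 j' = 1, ev u (k1 w) != 0 & ev f (k1 w) = 0].
  have j'b : j' != b by rewrite eq_sym.
  move=> /ZE[e1 e2 e3]; rewrite c_l // e1 u_k1; split=> //.
    by apply: contra_eq_neq e3 => ->; rewrite mulr0 eq_sym oner_eq0.
  by rewrite fE mevalD mevalM mevalXU c_j u_k1 -mulrA e3 mulr1 addNr.
have hkE (w : 'rV[K]_(n + 1)) : Z (lsubmx w) -> h1 (k1 w) = w.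
  move=> Zw; have [e1 e2 e3] := (ZE _).1 Zw; rewrite -[RHS]hsubmxK; congr row_mx.
    apply/rowP => i; rewrite [LHS]mxE; case: (eqVneq i j) => [->|ij].
      rewrite u_k1; have u0 : ev u (lsubmx w) != 0.
        by apply: contra_eq_neq e3 => ->; rewrite mulr0 eq_sym oner_eq0.
      by apply: (mulIf u0); rewrite mulVf.
    by case: (eqVneq i b) => [->|ib]; rewrite ?e2 // c_l.
  by apply/rowP => i; rewrite [LHS]mxE c_b [RHS]mxE [i]ord1.
have h1l v : lsubmx (h1 v) = \row_i (if i == j then (ev u v)^-1 else if i == b then 0
  else v ord0 i).
  by rewrite /h1 row_mxKl.
have h1Z (v : 'rV[K]_n) : v ord0 j' = 1 -> ev u v != 0 -> Z (lsubmx (h1 v)).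
  move=> vj' uv; apply/ZE; rewrite h1l !mxE eqxx (negbTE jj') (negbTE bj) eqxx.
  rewrite eq_sym (negbTE bj') vj'; split=> //.
  rewrite -[X in _ * X = _](u_eq (v ord0)) ?mulVf // => i ij ib.
  by rewrite mxE (negbTE ij) (negbTE ib).
have khE (v : 'rV[K]_n) : v ord0 j' = 1 -> ev u v != 0 -> ev f v = 0 -> k1 (h1 v) = v.
  move=> vj' uv fv; have kb i : i != j -> k1 (h1 v) ord0 i = v ord0 i.
    move=> ij; have [->|ib] := eqVneq i b; last first.
      by rewrite c_l // h1l mxE (negbTE ij) (negbTE ib).
    by rewrite c_b /h1 row_mxEr mxE.
  apply/rowP => i; have [->|/kb //] := eqVneq i j.
  rewrite c_j (r_eq _ (v ord0)) // h1l mxE eqxx; apply: (mulIf uv).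
  rewrite mulfVK //; apply/eqP; rewrite eq_sym -addr_eq0.
  by move: fv; rewrite fE mevalD mevalM mevalXU => ->.
pose nv (L : proj_space K n) : 'rV[K]_n :=
  (vpick (val (L : proj_point K n)) ord0 j')^-1 *: vpick (val (L : proj_point K n)).
have [L0 _] : exists L0 : proj_point K n, True.
  pose one : 'rV[K]_n := const_mx 1.
  have n0 : \dim <[one]>%VS == 1%N.
    rewrite dim_vline (_ : one != 0) //; apply/negP => /eqP/rowP/(_ j)/eqP.
    by rewrite !mxE oner_eq0.
  by exists (exist (fun L : {vspace 'rV[K]_n} => \dim L == 1%N) _ n0).
have Uu L v : U L -> v != 0 -> v \in val (L : proj_point K n) -> ev u v != 0.
  move=> [_ nL] v0 vL; apply: contra_notN nL => /eqP uv p ->.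
  by apply/(homog_mem _ v0 vL) => //; exists (mdeg mu).
have f_hom : homogeneous_poly f.
  exists N; apply: rpred_sum => i _; rewrite dhomogX; apply/eqP; exact: mdeg_block.
have pick0 (L : proj_point K n) : vpick (val L) != 0.
  by rewrite vpick0 -dimv_eq0 (eqP (valP L)).
have nvE L v : U L -> v != 0 -> v \in val (L : proj_point K n) ->
    nv L = (v ord0 j')^-1 *: v.
  move=> UL v0 vL; have [a aE] := line_prop L0 v0 vL (memv_pick (val (L : proj_point K
    n))).
  have a0 : a != 0 by apply: contraNneq (pick0 L) => a0; rewrite aE a0 scale0r.
  by rewrite /nv aE mxE invfM scalerA mulrAC mulVf // mul1r.
have nvP L : U L -> [/\ nv L ord0 j' = 1, ev u (nv L) != 0, ev f (nv L) = 0, nv L != 0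
    & nv L \in val (L : proj_point K n)].
  move=> UL; have vL := memv_pick (val (L : proj_point K n)).
  have vj' := u_neq0 _ (Uu L _ UL (pick0 L) vL).
  have nL : nv L \in val (L : proj_point K n) by exact: memvZ.
  have n0 : nv L != 0 by rewrite scaler_eq0 negb_or invr_eq0 vj' pick0.
  split=> //; first by rewrite mxE mulVf.
    exact: Uu UL n0 nL.
  by case: UL => fL _; exact: (fL f erefl).
pose k w : proj_space K n := line_of L0 (k1 w).
pose h L := h1 (nv L).
have k1_neq0 (w : 'rV[K]_(n + 1)) : Z (lsubmx w) -> k1 w != 0.
  by move=> /kf[e _ _]; apply: contraTneq (oner_neq0 K) => k0; rewrite -e k0 mxE eqxx.
have kU (w : 'rV[K]_(n + 1)) : Z (lsubmx w) -> U (k w).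
  move=> Zw; have [_ uk fk] := kf w Zw; have kn := k1_neq0 w Zw.
  split=> [p ->|/(_ u erefl _ (mem_line_of L0 kn))/eqP]; last exact/negP.
  exact/(homog_mem f_hom kn (mem_line_of L0 kn)).
exists U; split.
  exists (proj_zeros [set u]) => //; exists [set u] => // p ->.
  by exists (mdeg mu).
exists n, Z; split; first by exists Zs.
  exists (\row_i (if i == b then 0 else 1)); apply/ZE; rewrite !mxE eqxx.
  rewrite [j' == b]eq_sym [j == b]eq_sym (negbTE bj) (negbTE bj') mul1r; split=> //.
  rewrite (u_eq _ (fun=> 1)) => [|i _ ib]; last by rewrite mxE (negbTE ib).
  by rewrite mevalX big1 // => i _; rewrite expr1n.
have hY L : U L -> times_line Z (h L).
  by move=> /nvP[e1 e2 _ _ _]; exact: h1Z.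
exists h, k; split.
- apply: morphism_to_affine => // a.
  have ratio (i : 'I_n) : fraction_on U (fun L => nv L ord0 i).
    exists 1%N, 'X_i, 'X_j'; split; rewrite ?dhomogX; try by apply/eqP; exact: mdeg1.
    move=> L UL v vL v0; rewrite !mevalXU; split; first exact: u_neq0 (Uu L v UL v0 vL).
    by rewrite (nvE L v UL v0 vL) mxE mulrC.
  case: (split_ordP a) => i ->; last first.
    by have := ratio b; congr fraction_on; apply: funext => L;
      rewrite /h /h1 row_mxEr [RHS]mxE.
  have hE L : (h L : 'rV_(n + 1)) ord0 (lshift 1 i) =
      if i == j then (ev u (nv L))^-1 else if i == b then 0 else nv L ord0 i.
    by rewrite /h /h1 row_mxEl [LHS]mxE.
  have -> : (fun L => (h L : 'rV_(n + 1)) ord0 (lshift 1 i)) = (fun L =>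
      if i == j then (ev u (nv L))^-1 else if i == b then 0 else nv L ord0 i).
    exact: funext.
  have [_|ij] := eqVneq i j; last have [_|ib] := eqVneq i b.
  + exists (mdeg mu), ('X_j' ^+ mdeg mu), u; split=> //.
      have X1 : ('X_j' : {mpoly K[n]}) \is 1.-homog by rewrite dhomogX; apply/eqP;
        exact: mdeg1.
      by have := dhomogMn (mdeg mu) X1; rewrite mul1n.
    move=> L UL v vL v0; have uv := Uu L v UL v0 vL; split=> //.
    rewrite (nvE L v UL v0 vL) (meval_homog _ _ u_homog) rmorphXn /= mevalXU.
    by rewrite exprVn invfM invrK.
  + exists 0%N, 0, 1; split; rewrite ?dhomog0 ?dhomog1 // => L UL v vL v0.
    by rewrite meval1 oner_neq0 meval0 mul0r.
  exact: ratio.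
- apply: (morphism_to_proj (c := c)) => // w Zw; have kn := k1_neq0 w Zw.
  by split=> //; exact: mem_line_of.
- move=> L /nvP[e1 e2 e3 e4 e5]; rewrite /k /h khE //.
  exact: line_of_uniq.
move=> w Zw; rewrite /h (nvE _ (k1 w)) ?k1_neq0 //; last 2 first.
- exact: kU.
- by apply: mem_line_of; exact: k1_neq0.
have [-> _ _] := kf w Zw; rewrite invr1 scale1r; exact: hkE.
Qed.

End LinearVariable.

(** * The criterion *)

(** The equality test of the quotient ring is membership in the ideal. *)
Lemma quotient_presentation (K : fieldType) (n : nat) (f : {mpoly K[n]})
  (hf : nonunit_poly f) :
  exists pi : {rmorphism {mpoly K[n]} -> hypersurface_ring hf},
    (forall x, exists p, pi p = x) /\ (forall p, pi p = 0 <-> divides f p).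
Proof.
pose I : idealr {mpoly K[n]} := principal_ideal hf.
pose pi : {rmorphism {mpoly K[n]} -> hypersurface_ring hf} := (\pi_({ideal_quot I}))%qT.
exists pi; split=> [x|p]; first by exists (repr x); exact: reprK.
have -> : (pi p = 0) <-> p \in I.
  rewrite -(rmorph0 pi); split=> [/eqP|pI].
    by rewrite -Quotient.idealrBE subr0.
  by apply/eqP; rewrite -Quotient.idealrBE subr0.
by split=> [/asboolP|h]; last exact/asboolP.
Qed.

Section Criterion.
Variables (K : closedFieldType) (n : nat).
Hypothesis charK : [pchar K] =i pred0.
Variables (grp : 'I_n -> 'I_3) (l : 'I_n -> nat) (N : nat).
Hypothesis l_gt0 : forall j, (0 < l j)%N.
Hypothesis N_gt1 : (1 < N)%N.
Hypothesis lN : forall i, (\sum_(j | grp j == i) l j)%N = N.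

Lemma factorial_no_field (p : 'I_n -> {mpoly K[n]}) :
  factorial_hypersurface (trinom K grp l) -> (forall j, (1 < l j)%N) ->
  ~ nilpotent_field (trinom K grp l) p.
Proof.
move=> [hf ufd] l2 nil; have [pi [surj ker]] := quotient_presentation hf.
have [p' nil' hom] := homogenize (@torus_weights_homog K n grp l) nil.
exact: (no_homogeneous_field l_gt0 N_gt1 lN surj ker ufd charK l2 nil' hom).
Qed.

Theorem cylinder_criterion : factorial_hypersurface (trinom K grp l) ->
  ~ contains_cylinder (proj_hypersurface (trinom K grp l)) <-> forall j, (1 < l j)%N.
Proof.
move=> fact; split=> [ncyl j|l2].
  rewrite ltnNge; apply/negP => lj; apply: ncyl.
  apply: (@linear_variable_cylinder _ _ _ _ _ l_gt0 N_gt1 lN j).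
  by have := l_gt0 j; lia.
move=> [U [[C [S hS ->] ->] [m [Z [Zc [z Zz] [h [k [hm km hk kh]]]]]]]].
have [hf ufd] := fact; have [pi [surj ker]] := quotient_presentation hf.
have prime p q : divides (trinom K grp l) (p * q) ->
    divides (trinom K grp l) p \/ divides (trinom K grp l) q.
  by move/ker; rewrite rmorphM => /(ufd_domain ufd)[] /ker; [left|right].
have f_hom : homogeneous_poly (trinom K grp l).
  by exists N; apply: rpred_sum => i _; rewrite dhomogX; apply/eqP; exact: mdeg_block.
have null := trinom_nullstellensatz charK l_gt0 N_gt1 lN prime.
have Yz : times_line Z (row_mx z 0) by rewrite /times_line /= row_mxKl.
have [p] := cylinder_field charK f_hom null surj ker ufd hS hm km hk kh Yz.
exact: factorial_no_field.
Qed.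

End Criterion.

Section Numbering.
Variables (K : closedFieldType) (n0 n1 n2 : nat).
Variables (l0 : 'I_n0 -> nat) (l1 : 'I_n1 -> nat) (l2 : 'I_n2 -> nat).

Definition term_of (j : 'I_(n0 + n1 + n2)) : 'I_3 :=
  match split j with
  | inl a => match split a with inl _ => 0 | inr _ => 1 end
  | inr _ => 2
  end.

Definition exponent_of (j : 'I_(n0 + n1 + n2)) : nat :=
  match split j with
  | inl a => match split a with inl b => l0 b | inr b => l1 b end
  | inr b => l2 b
  end.

Lemma split_lshift m k (i : 'I_m) : split (lshift k i) = inl i.
Proof. exact: (unsplitK (inl i)). Qed.

Lemma split_rshift m k (i : 'I_k) : split (rshift m i) = inr i.
Proof. exact: (unsplitK (inr i)). Qed.

Lemma term_of0 j : term_of (lshift n2 (lshift n1 j)) = 0.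
Proof. by rewrite /term_of !split_lshift. Qed.
Lemma term_of1 j : term_of (lshift n2 (rshift n0 j)) = 1.
Proof. by rewrite /term_of split_lshift split_rshift. Qed.
Lemma term_of2 j : term_of (rshift (n0 + n1) j) = 2.
Proof. by rewrite /term_of split_rshift. Qed.
Lemma exponent_of0 j : exponent_of (lshift n2 (lshift n1 j)) = l0 j.
Proof. by rewrite /exponent_of !split_lshift. Qed.
Lemma exponent_of1 j : exponent_of (lshift n2 (rshift n0 j)) = l1 j.
Proof. by rewrite /exponent_of split_lshift split_rshift. Qed.
Lemma exponent_of2 j : exponent_of (rshift (n0 + n1) j) = l2 j.
Proof. by rewrite /exponent_of split_rshift. Qed.

Definition numberingE :=
  (term_of0, term_of1, term_of2, exponent_of0, exponent_of1, exponent_of2).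

Lemma trinomialE : trinomial K l0 l1 l2 = trinom K term_of exponent_of.
Proof.
have blockE i : 'X_[K, block term_of exponent_of i] =
    \prod_(j < n0) 'X_(lshift n2 (lshift n1 j)) ^+ (if 0 == i then l0 j else 0%N) *
    (\prod_(j < n1) 'X_(lshift n2 (rshift n0 j)) ^+ (if 1 == i then l1 j else 0%N)) *
    \prod_(j < n2) 'X_(rshift (n0 + n1) j) ^+ (if 2 == i then l2 j else 0%N).
  rewrite mpolyXE_id !big_split_ord /=; congr (_ * _ * _); apply: eq_bigr => j _;
    by rewrite mnmE !numberingE.
rewrite /trinomial /trinom big_ord3 /= addrA !blockE.
have one m (F : 'I_m -> {mpoly K[n0 + n1 + n2]}) : \prod_j F j ^+ 0 = 1.
  by rewrite big1 // => j _; rewrite expr0.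
by rewrite /= !one !mulr1 !mul1r.
Qed.

Lemma exponent_sum N : (\sum_j l0 j = N)%N -> (\sum_j l1 j = N)%N ->
  (\sum_j l2 j = N)%N ->
  forall i, (\sum_(j | term_of j == i) exponent_of j)%N = N.
Proof.
move=> e0 e1 e2 i; rewrite !big_split_ord /=.
under eq_bigl do rewrite numberingE.
under eq_bigr do rewrite numberingE.
under [X in (_ + X + _)%N]eq_bigl do rewrite numberingE.
under [X in (_ + X + _)%N]eq_bigr do rewrite numberingE.
under [X in (_ + X)%N]eq_bigl do rewrite numberingE.
under [X in (_ + X)%N]eq_bigr do rewrite numberingE.
by case: (ord3_cases i) => ->; rewrite ?big_pred0_eq /= ?e0 ?e1 ?e2 ?addn0.
Qed.

Lemma forall_exponent (P : nat -> Prop) : (forall j, P (exponent_of j)) <->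
  [/\ forall j, P (l0 j), forall j, P (l1 j) & forall j, P (l2 j)].
Proof.
split=> [h|[h0 h1 h2] j].
  split=> j; [rewrite -exponent_of0|rewrite -exponent_of1|rewrite -exponent_of2];
    exact: h.
by rewrite /exponent_of; case: split => [a|b]; [case: split|].
Qed.

End Numbering.

Theorem theorem3 (K : closedFieldType) (hK : [pchar K] =i pred0)
  (n0 n1 n2 : nat) (hn0 : (0 < n0)%N) (hn1 : (0 < n1)%N) (hn2 : (0 < n2)%N)
  (l0 : 'I_n0 -> nat) (l1 : 'I_n1 -> nat) (l2 : 'I_n2 -> nat)
  (hl0 : forall j, (0 < l0 j)%N) (hl1 : forall j, (0 < l1 j)%N)
  (hl2 : forall j, (0 < l2 j)%N)
  (hnl0 : (1 < n0 * l0 (Ordinal hn0))%N)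
  (hnl1 : (1 < n1 * l1 (Ordinal hn1))%N)
  (hnl2 : (1 < n2 * l2 (Ordinal hn2))%N)
  (hfact : factorial_hypersurface (trinomial K l0 l1 l2))
  (hdeg01 : (\sum_j l0 j = \sum_j l1 j)%N)
  (hdeg12 : (\sum_j l1 j = \sum_j l2 j)%N) :
  ~ contains_cylinder (proj_hypersurface (trinomial K l0 l1 l2)) <->
  [/\ forall j, (2 <= l0 j)%N, forall j, (2 <= l1 j)%N
    & forall j, (2 <= l2 j)%N].
Proof.
have exp_gt0 : forall j, (0 < exponent_of l0 l1 l2 j)%N.
  by apply/(forall_exponent l0 l1 l2 (fun e => 0 < e)%N).
have deg_gt1 : (1 < \sum_j l0 j)%N.
  have le1 : (l0 (Ordinal hn0) <= \sum_j l0 j)%N by rewrite (bigD1 (Ordinal hn0)) //=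
    leq_addr.
  have le2 : (n0 <= \sum_j l0 j)%N.
    rewrite -[X in (X <= _)%N]card_ord -sum1_card; apply: leq_sum => j _; exact: hl0.
  by nia.
have deg := exponent_sum (erefl (\sum_j l0 j)%N) (esym hdeg01) (esym (etrans hdeg01
  hdeg12)).
rewrite trinomialE in hfact *.
rewrite (cylinder_criterion hK exp_gt0 deg_gt1 deg hfact).
exact: (forall_exponent l0 l1 l2 (fun e => 1 < e)%N).
Qed.
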